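(* Let $a\neq b$ be complex numbers and let $\mathcal{R}$ be a (finite or infinite) set of prime numbers. Let $P\in U(\mathcal{R})$ and $Q\in U_1(\mathcal{R})$, and put $p=P'$, $q=Q'$. Then the Abel equation $y'=p(x)y^3+q(x)y^2$ has a parametric center on $[a,b]$ if and only if $P$ and $Q$ satisfy the Composition Condition on $[a,b]$.
   Context: $\mathcal{P}$ is the space of complex polynomials vanishing at $a$ and $b$. $U(\mathcal{R})$ is the set of $P=\sum_{i=0}^N a_ix^i\in\mathcal{P}$ such that for every $i$ with $a_i\ne0$, the integer $i$ is either coprime with each $r\in\mathcal{R}$ or is a power of some $r\in\mathcal{R}$. $U_1(\mathcal{R})$ is the set of $Q=\sum_i b_ix^i\in\mathcal{P}$ such that for every $i$ with $b_i\neq 0$, all prime factors of $i$ belong to $\mathcal{R}$. The equation $y'=py^3+qy^2$ has a parametric center on $[a,b]$ if for every $\epsilon\in\mathbb{C}$ every solution of $y'=p y^3+\epsilon q y^2$ with $|y(a)|$ sufficiently small satisfies $y(b)=y(a)$ (continuation along the segment $[a,b]$). $P,Q$ satisfy the Composition Condition on $[a,b]$ if there exist polynomials $\widetilde P,\widetilde Q,W$ with $W(a)=W(b)$ such that $P=\widetilde P\circ W$ and $Q=\widetilde Q\circ W$. *)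

(* Defs.v *)
From Stdlib Require Import Reals List Arith ZArith Znumtheory.
From Coquelicot Require Import Coquelicot.
Open Scope R_scope.

(* Complex polynomials as coefficient lists (constant coefficient first). *)
Definition cpoly := list C.

Definition coef (P : cpoly) (i : nat) : C := nth i P (RtoC 0).

Fixpoint peval (P : cpoly) (x : C) : C :=
  match P with
  | nil => RtoC 0
  | c :: P' => Cplus c (Cmult x (peval P' x))
  end.

Fixpoint pderiv_aux (k : nat) (P : cpoly) : cpoly :=
  match P with
  | nil => nil
  | c :: P' => Cmult (RtoC (INR k)) c :: pderiv_aux (S k) P'
  end.
Definition pderiv (P : cpoly) : cpoly :=
  match P with nil => nil | _ :: P' => pderiv_aux 1 P' end.

Definition nprime (r : nat) : Prop := prime (Z.of_nat r).

Definition in_Pspace (a b : C) (P : cpoly) : Prop :=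
  peval P a = RtoC 0 /\ peval P b = RtoC 0.

Definition in_U (Rs : nat -> Prop) (a b : C) (P : cpoly) : Prop :=
  in_Pspace a b P /\
  forall i : nat, (1 <= i)%nat -> coef P i <> RtoC 0 ->
    (forall r, Rs r -> Nat.gcd i r = 1%nat) \/
    (exists r k, Rs r /\ i = Nat.pow r k).

Definition in_U1 (Rs : nat -> Prop) (a b : C) (Q : cpoly) : Prop :=
  in_Pspace a b Q /\
  forall i : nat, (1 <= i)%nat -> coef Q i <> RtoC 0 ->
    forall r, nprime r -> Nat.divide r i -> Rs r.

Definition seg (a b : C) (t : R) : C := Cplus a (Cmult (RtoC t) (Cminus b a)).

Definition unit_int (t : R) : Prop := 0 <= t <= 1.

(* y : [0,1] -> C is a solution of dy/dx = p(x) y^3 + eps q(x) y^2 along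
   the segment x = a + t (b - a): continuous on [0,1], differentiable in
   (0,1) with dy/dt = (b - a) (p(x) y^3 + eps q(x) y^2). *)
Definition abel_sol_on_seg (p q : cpoly) (a b eps : C) (y : R -> C) : Prop :=
  (forall t, unit_int t ->
     filterlim y (within unit_int (locally t)) (locally (y t))) /\
  (forall t, 0 < t < 1 ->
     @is_derive R_AbsRing C_R_NormedModule y t
       (Cmult (Cminus b a)
          (Cplus (Cmult (peval p (seg a b t)) (Cmult (y t) (Cmult (y t) (y t))))
                 (Cmult eps (Cmult (peval q (seg a b t)) (Cmult (y t) (y t))))))).

Definition parametric_center (p q : cpoly) (a b : C) : Prop :=
  forall eps : C, exists delta : R, 0 < delta /\
    forall y : R -> C, abel_sol_on_seg p q a b eps y ->
      Cmod (y 0) < delta -> y 1 = y 0.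

Definition composition_condition (P Q : cpoly) (a b : C) : Prop :=
  exists Pt Qt W : cpoly,
    peval W a = peval W b /\
    (forall x, peval P x = peval Pt (peval W x)) /\
    (forall x, peval Q x = peval Qt (peval W x)).

(* Main.v *)
(** Along the segment the Picard iterates of the equation started at [s] are
    polynomials in [x] and [s], and they converge geometrically to the solution
    when [s] is small.  If [P = Pt o W] and [Q = Qt o W] with [W(a) = W(b)], every
    iterate is a polynomial in [W], hence takes the value [s] at [b], and so does
    the solution.

    Conversely, a parametric center makes the formal solution [y = s u] satisfy
    [u(b) = 1] identically in [s] and [eps].  Integrating the equation
    [(Z^2)' = -2 s^2 p - 2 eps s q Z] of [Z = 1/u] gives [int q Z = 0]; at [eps = 0]
    one has [Z = sqrt (1 - 2 s^2 P)], so all the moments [int P^i q] vanish.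

    Let [P] be monic of degree [n], [m = deg Q], and let [x = Y(z)/z] be the branch
    at infinity of [P(x) = z^-n].  By residues, the moments are coefficients of
    [z^m Q(Y/z) log V] with [V = (Y - b z)/(Y - a z)], at exponents [m + n i].
    Split [log V] into parts [L_k] according to the exponent mod [n].  Suppose that
    [z^m Q(Y/z)] has a nonzero coefficient at [e] with [k = m - e] prime to [n].
    Eliminating the other parts with Wronskians shows that [L_k] is a quotient of
    series with coefficients in a finitely generated ring.  Let [G = z V'/V]; the
    Frobenius congruence [G_{pj} = G_j^p] mod [p] then forces [L_{k'} = 0] for every
    large prime [p] with [p k' = k] mod [n], since the coefficients [G_j / j] would
    have unbounded denominators.  Iterating over the prime factors of some
    [N = k] mod [n], all of them large, yields [L_1 = 0], which contradicts
    [G_1 = a - b].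

    Hence (take [e = 0]) the degrees of [P] and [Q] are not coprime.  If moreover [n]
    is a power of a prime [r], then [Q(Y/z)] only involves exponents divisible by
    [r], so [P(T) - P(x)] and [Q(T) - Q(x)] have a common factor [W(T) - W(x)], and
    [P], [Q] are polynomials in [W]; if [W(a) <> W(b)] one repeats the argument with
    [W(a)], [W(b)] and polynomials of smaller degree.  The conditions defining [U]
    and [U_1], applied to leading terms, leave only these two cases. *)

Require Import Defs.
From Stdlib Require Import Reals List Arith ZArith Znumtheory Lra Lia.
From Coquelicot Require Import Coquelicot.

(** * Picard iteration *)

(** The definition of a center only speaks of solutions that are given, so the direct implication
    must first construct them for small [s]. Keeping the iterates polynomial in [s] makes the
    passage from analysis to algebra elementary: a polynomial that is O(s^k) for small real s > 0
    has no term below s^k. The relation obtained at [b] is [eps * int q Z = 0], which says nothing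
    at [eps = 0] until [eps] is cancelled. Hence [eps] becomes an indeterminate before it is set to
    0. The coefficients of [P] and [Q] are arbitrary complex numbers, for which denominators have no
    meaning a priori. The substitute: for almost every prime [p] there is a subring that contains
    finitely many prescribed numbers with their inverses, and all [1/j] with [p] not dividing [j],
    but not [1/p]. A single prime in a given class mod [n] would require Dirichlet's theorem; going
    through the prime factors of one suitable integer avoids it. *)

Definition Der (f : R -> C) (t : R) (l : C) : Prop :=
  is_derive (fun x => fst (f x)) t (fst l) /\ is_derive (fun x => snd (f x)) t (snd l).

(** Working by coordinates makes the real mean value theorem and the real theorem on limits of
    derivatives applicable. *)
Lemma Der_is_derive (f : R -> C) t l : @is_derive R_AbsRing C_R_NormedModule f t l <-> Der f t l.
Proof.
split.
- intros H; split.
  + apply (filterdiff_ext_lin (fun x => fst (f x)) (fun y : R => fst (@scal R_AbsRing C_R_NormedModule y l))); [|reflexivity].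
    apply (filterdiff_comp' f (@fst R R) t (fun y : R => @scal R_AbsRing C_R_NormedModule y l) (@fst R R)); [exact H|].
    apply filterdiff_linear. exact (@is_linear_fst R_AbsRing R_NormedModule R_NormedModule).
  + apply (filterdiff_ext_lin (fun x => snd (f x)) (fun y : R => snd (@scal R_AbsRing C_R_NormedModule y l))); [|reflexivity].
    apply (filterdiff_comp' f (@snd R R) t (fun y : R => @scal R_AbsRing C_R_NormedModule y l) (@snd R R)); [exact H|].
    apply filterdiff_linear. exact (@is_linear_snd R_AbsRing R_NormedModule R_NormedModule).
- assert (E : forall z : C, (plus (scal (fst z) ((1, 0) : C_R_NormedModule))
      (scal (snd z) ((0, 1) : C_R_NormedModule)) : C) = z).
  { intros [x y]. apply injective_projections;
    unfold plus, scal; cbn; unfold plus, scal, mult; cbn; unfold mult; cbn; ring. }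
  intros [H1 H2].
  apply (is_derive_ext (fun x => plus (scal (fst (f x)) ((1, 0) : C_R_NormedModule))
      (scal (snd (f x)) ((0, 1) : C_R_NormedModule)))); [intros; apply E|].
  rewrite <- (E l).
  apply @is_derive_plus; apply @is_derive_scal_l; assumption.
Qed.

Definition ccont (f : R -> C) (D : R -> Prop) (t : R) : Prop :=
  forall e, 0 < e -> exists d, 0 < d /\ forall t', D t' -> Rabs (t' - t) < d -> Cmod (f t' - f t) < e.

Lemma Cmod_le_comp z : Cmod z <= Rabs (fst z) + Rabs (snd z).
Proof.
  unfold Cmod. rewrite <- (sqrt_Rsqr (Rabs (fst z) + Rabs (snd z))).
  2: { pose proof (Rabs_pos (fst z)); pose proof (Rabs_pos (snd z)); lra. }
  apply sqrt_le_1_alt. unfold Rsqr.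
  rewrite <- (pow2_abs (fst z)), <- (pow2_abs (snd z)).
  pose proof (Rabs_pos (fst z)); pose proof (Rabs_pos (snd z)); nra.
Qed.

Lemma fst_le_Cmod z : Rabs (fst z) <= Cmod z.
Proof. eapply Rle_trans; [|apply (Rmax_Cmod z)]. apply Rmax_l. Qed.
Lemma snd_le_Cmod z : Rabs (snd z) <= Cmod z.
Proof. eapply Rle_trans; [|apply (Rmax_Cmod z)]. apply Rmax_r. Qed.

Lemma filterlim_ccont f t :
  filterlim f (within unit_int (locally t)) (locally (f t)) <-> ccont f unit_int t.
Proof.
split.
- intros H e He.
  assert (He2 : 0 < e / 2) by lra.
  destruct (H (fun z : C => ball (f t) (mkposreal _ He2) z)) as [d Hd].
  { exists (mkposreal _ He2). intros y Hy; exact Hy. }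
  exists d; split; [apply cond_pos|]. intros t' H1 H2.
  destruct (Hd t') as [Hb1 Hb2]; [exact H2|exact H1|].
  eapply Rle_lt_trans; [apply Cmod_le_comp|].
  change (Rabs (fst (f t') - fst (f t)) < e / 2) in Hb1.
  change (Rabs (snd (f t') - snd (f t)) < e / 2) in Hb2.
  cbn. unfold Rminus in *. lra.
- intros H Pr [e He].
  destruct (H e (cond_pos e)) as [d [Hd H1]].
  exists (mkposreal d Hd). intros t' H2 H3. apply He.
  specialize (H1 t' H3 H2). split.
  + change (Rabs (fst (f t') - fst (f t)) < e).
    eapply Rle_lt_trans; [|exact H1]. apply (fst_le_Cmod (Cminus (f t') (f t))).
  + change (Rabs (snd (f t') - snd (f t)) < e).
    eapply Rle_lt_trans; [|exact H1]. apply (snd_le_Cmod (Cminus (f t') (f t))).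
Qed.

(* Continuity is only one-sided at 0 and T, so the mean value theorem is
   applied to the function frozen outside [0, T]. *)
Lemma mean_value_R (g g' : R -> R) T B : 0 <= T ->
  (forall t, 0 <= t <= T -> forall e, 0 < e -> exists d, 0 < d /\
     forall t', 0 <= t' <= T -> Rabs (t' - t) < d -> Rabs (g t' - g t) < e) ->
  (forall t, 0 < t < T -> is_derive g t (g' t)) ->
  (forall t, 0 < t < T -> Rabs (g' t) <= B) ->
  Rabs (g T - g 0) <= B * T.
Proof.
intros HT Hc Hd HB.
destruct (Req_dec T 0) as [->|HT0].
{ rewrite Rminus_eq_0, Rabs_R0. lra. }
pose (cl := fun t => Rmax 0 (Rmin t T)).
assert (Hcl : forall t, 0 <= cl t <= T).
{ intros t; unfold cl, Rmax, Rmin; repeat destruct Rle_dec; lra. }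
assert (Hid : forall t, 0 <= t <= T -> cl t = t).
{ intros t; unfold cl, Rmax, Rmin; repeat destruct Rle_dec; lra. }
assert (Hlip : forall t t', Rabs (cl t' - cl t) <= Rabs (t' - t)).
{ intros t t'; unfold cl, Rmax, Rmin; repeat destruct Rle_dec; unfold Rabs; repeat destruct Rcase_abs; lra. }
(* [MVT_gen] may return an endpoint, where nothing is known of [g']; the value 0 there still obeys
   the bound, by [B0]. *)
pose (df := fun t => if Rlt_dec 0 t then if Rlt_dec t T then g' t else 0 else 0).
assert (B0 : 0 <= B).
{ eapply Rle_trans; [|apply (HB (T / 2)); lra]. apply Rabs_pos. }
destruct (MVT_gen (fun t => g (cl t)) 0 T df) as [c [Hc1 Hc2]].
- rewrite Rmin_left, Rmax_right by lra. intros x Hx. unfold df.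
  destruct (Rlt_dec 0 x); [|lra]. destruct (Rlt_dec x T); [|lra].
  apply (is_derive_ext_loc g); [|apply Hd; lra].
  assert (He : 0 < Rmin x (T - x)) by (unfold Rmin; destruct Rle_dec; lra).
  exists (mkposreal _ He). intros y Hy. change (Rabs (y - x) < Rmin x (T - x)) in Hy.
  rewrite Hid; [reflexivity|].
  revert Hy. unfold Rabs, Rmin. destruct Rcase_abs, Rle_dec; lra.
- rewrite Rmin_left, Rmax_right by lra. intros x Hx e He.
  destruct (Hc (cl x) (Hcl x) e He) as [d [Hd1 Hd2]].
  exists d; split; [exact Hd1|]. intros y [_ Hy]. cbn in *. unfold R_dist in *.
  apply Hd2; [apply Hcl|]. eapply Rle_lt_trans; [apply Hlip|exact Hy].
- rewrite Rmin_left, Rmax_right in Hc1 by lra. cbn in Hc2.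
  rewrite !Hid in Hc2 by lra. rewrite Hc2, Rminus_0_r, Rabs_mult, (Rabs_pos_eq T) by lra.
  apply Rmult_le_compat_r; [lra|]. unfold df.
  destruct (Rlt_dec 0 c); [|rewrite Rabs_R0; exact B0].
  destruct (Rlt_dec c T); [|rewrite Rabs_R0; exact B0]. apply HB; lra.
Qed.

(** The factor 2 is the price of treating the two coordinates separately. *)
Lemma mean_value_C (f f' : R -> C) T B : 0 <= T ->
  (forall t, 0 <= t <= T -> ccont f (fun t' => 0 <= t' <= T) t) ->
  (forall t, 0 < t < T -> Der f t (f' t)) ->
  (forall t, 0 < t < T -> Cmod (f' t) <= B) ->
  Cmod (f T - f 0) <= 2 * B * T.
Proof.
intros HT Hc Hd HB.
eapply Rle_trans; [apply Cmod_le_comp|].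
assert (H1 : Rabs (fst (f T) - fst (f 0)) <= B * T).
{ apply (mean_value_R (fun t => fst (f t)) (fun t => fst (f' t))); [exact HT| | |].
  - intros t Ht e He. destruct (Hc t Ht e He) as [d [Hd1 Hd2]].
    exists d; split; [exact Hd1|]. intros t' H1 H2.
    eapply Rle_lt_trans; [|apply (Hd2 t' H1 H2)]. apply (fst_le_Cmod (Cminus (f t') (f t))).
  - intros t Ht. apply (Hd t Ht).
  - intros t Ht. eapply Rle_trans; [apply fst_le_Cmod|apply (HB t Ht)]. }
assert (H2 : Rabs (snd (f T) - snd (f 0)) <= B * T).
{ apply (mean_value_R (fun t => snd (f t)) (fun t => snd (f' t))); [exact HT| | |].
  - intros t Ht e He. destruct (Hc t Ht e He) as [d [Hd1 Hd2]].
    exists d; split; [exact Hd1|]. intros t' H2 H3.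
    eapply Rle_lt_trans; [|apply (Hd2 t' H2 H3)]. apply (snd_le_Cmod (Cminus (f t') (f t))).
  - intros t Ht. apply (Hd t Ht).
  - intros t Ht. eapply Rle_trans; [apply snd_le_Cmod|apply (HB t Ht)]. }
cbn. unfold Rminus in *. lra.
Qed.

Lemma Der_ccont f t l D : Der f t l -> ccont f D t.
Proof.
intros [H1 H2] e He.
assert (C1 := ex_derive_continuous (fun x => fst (f x)) t (ex_intro _ _ H1)).
assert (C2 := ex_derive_continuous (fun x => snd (f x)) t (ex_intro _ _ H2)).
assert (He2 : 0 < e / 2) by lra.
destruct (C1 (fun z => Rabs (z - fst (f t)) < e / 2)) as [d1 Hd1].
{ exists (mkposreal _ He2). intros y Hy; exact Hy. }
destruct (C2 (fun z => Rabs (z - snd (f t)) < e / 2)) as [d2 Hd2].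
{ exists (mkposreal _ He2). intros y Hy; exact Hy. }
exists (Rmin d1 d2); split.
{ apply Rmin_pos; apply cond_pos. }
intros t' _ Ht'.
eapply Rle_lt_trans; [apply Cmod_le_comp|].
assert (K1 := Hd1 t' (Rlt_le_trans _ _ _ Ht' (Rmin_l _ _))).
assert (K2 := Hd2 t' (Rlt_le_trans _ _ _ Ht' (Rmin_r _ _))).
cbn in *. unfold Rminus in *. lra.
Qed.

Lemma Der_minus f g t l m : Der f t l -> Der g t m -> Der (fun x => f x - g x)%C t (l - m)%C.
Proof.
intros [H1 H2] [H3 H4]; split; cbn; apply @is_derive_minus; assumption.
Qed.
Lemma ccont_minus f g D t : ccont f D t -> ccont g D t -> ccont (fun x => f x - g x)%C D t.
Proof.
intros Hf Hg e He.
destruct (Hf (e / 2)) as [d1 [Hd1 H1]]; [lra|].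
destruct (Hg (e / 2)) as [d2 [Hd2 H2]]; [lra|].
exists (Rmin d1 d2); split; [apply Rmin_pos; assumption|].
intros t' Ht' Hd.
assert (K1 := H1 t' Ht' (Rlt_le_trans _ _ _ Hd (Rmin_l _ _))).
assert (K2 := H2 t' Ht' (Rlt_le_trans _ _ _ Hd (Rmin_r _ _))).
replace (f t' - g t' - (f t - g t))%C with ((f t' - f t) + - (g t' - g t))%C by ring.
eapply Rle_lt_trans; [apply Cmod_triangle|]. rewrite Cmod_opp. lra.
Qed.
Lemma ccont_sub f (D D' : R -> Prop) t : (forall x, D' x -> D x) -> ccont f D t -> ccont f D' t.
Proof.
intros HD H e He. destruct (H e He) as [d [H1 H2]]. exists d; split; [exact H1|].
intros t' Ht'; apply H2, HD, Ht'.
Qed.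

Section AbelIteration.
Variables (al be : R -> C) (M rho : R) (s : C) (u : nat -> R -> C).
Let F (t : R) (y : C) : C := (al t * (y * (y * y)) + be t * (y * y))%C.
Hypothesis al_le : forall t, 0 <= t <= 1 -> Cmod (al t) <= M.
Hypothesis be_le : forall t, 0 <= t <= 1 -> Cmod (be t) <= M.
Hypothesis rho_le1 : rho <= 1.
Hypothesis rho_gt0 : 0 < rho.
(** The constant 10 is 5, from the Lipschitz bound [3 rho^2 + 2 rho <= 5 rho], times the 2 of
    [mean_value_C]. *)
Hypothesis M_rho : 10 * M * rho <= / 4.
Hypothesis s_le : Cmod s <= rho / 4.
Hypothesis u0 : forall t, u 0%nat t = s.
Hypothesis uS0 : forall k, u (S k) 0 = s.
Hypothesis uSD : forall k t, Der (u (S k)) t (F t (u k t)).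

Lemma M_ge0 : 0 <= M.
Proof. eapply Rle_trans; [|apply (al_le 0); lra]. apply Cmod_ge_0. Qed.

Lemma abel_rhs_le t y : 0 <= t <= 1 -> Cmod y <= rho -> Cmod (F t y) <= 2 * M * rho * rho.
Proof.
intros Ht Hy. unfold F.
eapply Rle_trans; [apply Cmod_triangle|]. rewrite !Cmod_mult.
assert (H1 := al_le t Ht). assert (H2 := be_le t Ht). assert (H3 := M_ge0).
assert (H4 := Cmod_ge_0 y). assert (H5 := Cmod_ge_0 (al t)). assert (H6 := Cmod_ge_0 (be t)).
assert (K1 : 0 <= Cmod y * Cmod y <= rho * rho) by nra.
assert (K2 : 0 <= Cmod y * (Cmod y * Cmod y) <= rho * rho) by nra.
assert (Cmod (al t) * (Cmod y * (Cmod y * Cmod y)) <= M * (rho * rho)) by (apply Rmult_le_compat; lra).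
assert (Cmod (be t) * (Cmod y * Cmod y) <= M * (rho * rho)) by (apply Rmult_le_compat; lra).
lra.
Qed.

Lemma abel_rhs_lipschitz t y z : 0 <= t <= 1 -> Cmod y <= rho -> Cmod z <= rho ->
  Cmod (F t y - F t z) <= 5 * M * rho * Cmod (y - z).
Proof.
intros Ht Hy Hz. unfold F.
replace (al t * (y * (y * y)) + be t * (y * y) - (al t * (z * (z * z)) + be t * (z * z)))%C
  with ((al t * (y * y + (y * z + z * z)) + be t * (y + z)) * (y - z))%C by ring.
rewrite Cmod_mult. apply Rmult_le_compat_r; [apply Cmod_ge_0|].
eapply Rle_trans; [apply Cmod_triangle|]. rewrite !Cmod_mult.
assert (H1 := al_le t Ht). assert (H2 := be_le t Ht). assert (H3 := M_ge0).
assert (H4 := Cmod_ge_0 y). assert (H4' := Cmod_ge_0 z).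
assert (K1 : Cmod (y * y + (y * z + z * z)) <= 3 * rho).
{ eapply Rle_trans; [apply Cmod_triangle|].
  eapply Rle_trans; [apply Rplus_le_compat_l, Cmod_triangle|]. rewrite !Cmod_mult. nra. }
assert (K2 : Cmod (y + z) <= 2 * rho).
{ eapply Rle_trans; [apply Cmod_triangle|]. lra. }
assert (Cmod (al t) * Cmod (y * y + (y * z + z * z)) <= M * (3 * rho))
  by (apply Rmult_le_compat; try apply Cmod_ge_0; lra).
assert (Cmod (be t) * Cmod (y + z) <= M * (2 * rho))
  by (apply Rmult_le_compat; try apply Cmod_ge_0; lra).
lra.
Qed.

(** Input [f] and output [y] are kept apart so that this serves both the iterates and, with [f = y],
    a solution. The gain from [rho] to [rho / 2] is what drives the continuation in
    [solution_le]. *)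
Lemma small_of_bounded (f y : R -> C) T : 0 <= T <= 1 -> y 0 = s ->
  (forall t, 0 <= t <= T -> ccont y unit_int t) ->
  (forall t, 0 < t < T -> Der y t (F t (f t))) ->
  (forall t, 0 < t < T -> Cmod (f t) <= rho) ->
  Cmod (y T) <= rho / 2.
Proof.
intros HT Hy0 Hc HD Hf.
assert (H : Cmod (y T - y 0) <= 2 * (2 * M * rho * rho) * T).
{ apply (mean_value_C y (fun t => F t (f t))); [lra| |exact HD|].
  - intros t Ht. apply (ccont_sub y unit_int); [unfold unit_int; intros; lra|auto].
  - intros t Ht. apply abel_rhs_le; [lra|apply Hf; lra]. }
replace (y T) with (y 0 + (y T - y 0))%C by ring.
eapply Rle_trans; [apply Cmod_triangle|]. rewrite Hy0 at 1.
assert (H3 := M_ge0).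
assert (M * rho * rho * T <= M * rho * rho) by (assert (0 <= M * rho * rho) by nra; nra).
nra.
Qed.

Lemma u_0 k : u k 0 = s.
Proof. destruct k; auto. Qed.

Lemma u_ccont k D t : ccont (u k) D t.
Proof.
destruct k as [|k]; [|apply (Der_ccont _ _ _ _ (uSD k t))].
intros e He; exists 1; split; [lra|]. intros t' _ _. rewrite !u0.
replace (s - s)%C with (RtoC 0) by ring. rewrite Cmod_0. exact He.
Qed.

Lemma u_le k t : 0 <= t <= 1 -> Cmod (u k t) <= rho.
Proof.
revert t; induction k as [|k IH]; intros t Ht.
- rewrite u0. lra.
- apply Rle_trans with (rho / 2); [|lra].
  apply (small_of_bounded (u k)); try easy.
  + intros; apply u_ccont.
  + intros; apply IH; lra.
Qed.

(** Each of the pairs [(f, y)] and [(g, z)] is either two consecutive iterates or a solution paired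
    with itself. *)
Lemma contraction (f g y z : R -> C) D T : 0 <= T <= 1 ->
  (forall t, 0 <= t <= 1 -> Cmod (f t) <= rho) ->
  (forall t, 0 <= t <= 1 -> Cmod (g t) <= rho) ->
  (forall t, 0 <= t <= 1 -> Cmod (f t - g t) <= D) ->
  y 0 = s -> z 0 = s ->
  (forall t, 0 <= t <= 1 -> ccont y unit_int t) ->
  (forall t, 0 <= t <= 1 -> ccont z unit_int t) ->
  (forall t, 0 < t < 1 -> Der y t (F t (f t))) ->
  (forall t, 0 < t < 1 -> Der z t (F t (g t))) ->
  Cmod (y T - z T) <= 10 * M * rho * D.
Proof.
intros HT Hf Hg HD y0 z0 cy cz dy dz.
assert (H : Cmod ((y T - z T) - (y 0 - z 0)) <= 2 * (5 * M * rho * D) * T).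
{ apply (mean_value_C (fun t => y t - z t)%C (fun t => F t (f t) - F t (g t))%C); [lra| | |].
  - intros t Ht. apply (ccont_sub _ unit_int); [unfold unit_int; intros; lra|].
    apply ccont_minus; [apply cy|apply cz]; lra.
  - intros t Ht. apply Der_minus; [apply dy|apply dz]; lra.
  - intros t Ht. eapply Rle_trans; [apply abel_rhs_lipschitz; try apply Hf; try apply Hg; lra|].
    apply Rmult_le_compat_l; [assert (H3 := M_ge0); nra|apply HD; lra]. }
rewrite y0, z0 in H. replace (y T - z T - (s - s))%C with (y T - z T)%C in H by ring.
eapply Rle_trans; [exact H|].
assert (H3 := M_ge0).
assert (0 <= D) by (eapply Rle_trans; [apply Cmod_ge_0|apply (HD 0); lra]).
assert (0 <= 5 * M * rho * D) by (repeat apply Rmult_le_pos; lra). nra.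
Qed.

Lemma triangle_2rho y z : Cmod y <= rho -> Cmod z <= rho -> Cmod (y - z) <= 2 * rho.
Proof.
intros Hy Hz. unfold Cminus. eapply Rle_trans; [apply Cmod_triangle|]. rewrite Cmod_opp. lra.
Qed.

(** A given solution is only known to be continuous and small at 0. Let [S] be the supremum of the
    times up to which it stays below [rho]: before [S] it is even below [rho / 2], so by continuity
    the bound [rho] persists a little beyond [S], which forces the end 1 to be reached. *)
Lemma solution_le y : y 0 = s ->
  (forall t, 0 <= t <= 1 -> ccont y unit_int t) ->
  (forall t, 0 < t < 1 -> Der y t (F t (y t))) ->
  forall t, 0 <= t <= 1 -> Cmod (y t) <= rho.
Proof.
intros y0 yc yD.
pose (E T := 0 <= T <= 1 /\ forall t, 0 <= t <= T -> Cmod (y t) <= rho).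
assert (E0 : E 0).
{ split; [lra|]. intros t Ht. replace t with 0 by lra. rewrite y0. lra. }
destruct (completeness E) as [S [HS1 HS2]].
{ exists 1. intros T [HT _]; lra. }
{ exists 0; exact E0. }
assert (S0 : 0 <= S) by (apply HS1, E0).
assert (S1 : S <= 1) by (apply HS2; intros T [HT _]; lra).
assert (Hlt : forall t, 0 <= t < S -> Cmod (y t) <= rho / 2).
{ intros t Ht. destruct (Classical_Prop.classic (exists T, E T /\ t < T)) as [[T [[HT HE] HtT]]|Hn].
  - apply (small_of_bounded y y t); try easy; [lra| | |].
    + intros; apply yc; lra.
    + intros; apply yD; lra.
    + intros; apply HE; lra.
  - exfalso. assert (S <= t); [|lra]. apply HS2. intros T HT.
    destruct (Rle_lt_dec T t) as [|Hl]; [assumption|]. exfalso; apply Hn; exists T; split; assumption. }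
destruct (yc S (conj S0 S1) (rho / 4)) as [d [Hd Hyd]]; [lra|].
assert (HyS : Cmod (y S) <= 3 * rho / 4).
{ destruct (Req_dec S 0) as [->|Sn]; [rewrite y0; lra|].
  pose (t0 := Rmax 0 (S - d / 2)).
  assert (Ht0 : 0 <= t0 < S) by (unfold t0, Rmax; destruct Rle_dec; lra).
  assert (Ht1 : Rabs (t0 - S) < d).
  { unfold t0, Rmax, Rabs; destruct Rle_dec; destruct Rcase_abs; lra. }
  assert (K1 := Hlt t0 Ht0).
  assert (K2 := Hyd t0 (conj (proj1 Ht0) (Rle_trans _ _ _ (Rlt_le _ _ (proj2 Ht0)) S1)) Ht1).
  replace (y S) with (y t0 + - (y t0 - y S))%C by ring.
  eapply Rle_trans; [apply Cmod_triangle|]. rewrite Cmod_opp. lra. }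
(* Since [S] is an upper bound of [E], membership of [T'] is only possible when the minimum is 1. *)
pose (T' := Rmin 1 (S + d / 2)).
assert (HT' : 0 <= T' <= 1) by (unfold T', Rmin; destruct Rle_dec; lra).
assert (HE : E T').
{ split; [exact HT'|]. intros t Ht.
  destruct (Rlt_le_dec t S) as [H|H]; [assert (K := Hlt t (conj (proj1 Ht) H)); lra|].
  assert (K : Cmod (y t - y S) < rho / 4).
  { apply Hyd; [unfold unit_int; lra|].
    assert (T' <= S + d / 2) by apply Rmin_r.
    rewrite Rabs_pos_eq; lra. }
  replace (y t) with (y S + (y t - y S))%C by ring.
  eapply Rle_trans; [apply Cmod_triangle|]. lra. }
assert (H1 : T' = 1).
{ assert (H := HS1 T' HE). unfold T', Rmin in *. destruct Rle_dec; lra. }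
rewrite H1 in HE. apply HE.
Qed.

Lemma picard_error y : y 0 = s ->
  (forall t, 0 <= t <= 1 -> ccont y unit_int t) ->
  (forall t, 0 < t < 1 -> Der y t (F t (y t))) ->
  forall k t, 0 <= t <= 1 -> Cmod (y t - u k t) <= (10 * M * rho) ^ k * (2 * rho).
Proof.
intros y0 yc yD k.
assert (Hy := solution_le y y0 yc yD).
induction k as [|k IH]; intros t Ht.
- cbn. rewrite Rmult_1_l. apply triangle_2rho; [apply Hy, Ht|apply u_le, Ht].
- cbn [pow]. rewrite Rmult_assoc. apply (contraction y (u k)); auto.
  + apply u_le.
  + intros; apply u_ccont.
Qed.

Lemma picard_cauchy j k t : 0 <= t <= 1 -> (k <= j)%nat ->
  Cmod (u j t - u k t) <= (10 * M * rho) ^ k * (2 * rho).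
Proof.
revert j t; induction k as [|k IH]; intros j t Ht Hj.
- cbn. rewrite Rmult_1_l. apply triangle_2rho; apply u_le, Ht.
- destruct j as [|j]; [lia|]. cbn [pow]. rewrite Rmult_assoc.
  apply (contraction (u j) (u k)); auto; try (apply u_le); try (intros; apply u_ccont).
  intros; apply IH; [assumption|lia].
Qed.

Lemma contraction_pow_lt D e : 0 < e -> 0 <= D -> exists N, forall k, (N <= k)%nat ->
  (10 * M * rho) ^ k * D < e.
Proof.
intros He HD. assert (H3 := M_ge0).
assert (Hq : 0 <= 10 * M * rho <= / 4) by (split; [repeat apply Rmult_le_pos; lra|assumption]).
destruct (pow_lt_1_zero (10 * M * rho)) with (y := e / (D + 1)) as [N HN].
{ rewrite Rabs_pos_eq; lra. }
{ apply Rdiv_lt_0_compat; lra. }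
exists N. intros k Hk. specialize (HN k Hk).
rewrite Rabs_pos_eq in HN by (apply pow_le; lra).
apply Rle_lt_trans with ((10 * M * rho) ^ k * (D + 1)).
- apply Rmult_le_compat_l; [apply pow_le; lra|lra].
- apply Rmult_lt_compat_r with (r := D + 1) in HN; [|lra].
  replace (e / (D + 1) * (D + 1)) with e in HN by (field; lra). exact HN.
Qed.

Lemma picard_component_limit (c : C -> R) t : (forall z w, Rabs (c z - c w) <= Cmod (z - w)) ->
  0 <= t <= 1 ->
  is_lim_seq (fun k => c (u k t)) (Finite (real (Lim_seq (fun k => c (u k t))))) /\
  forall k, Rabs (real (Lim_seq (fun k => c (u k t))) - c (u k t)) <= (10 * M * rho) ^ k * (2 * rho).
Proof.
intros Hc Ht.
assert (L : is_lim_seq (fun k => c (u k t)) (Finite (real (Lim_seq (fun k => c (u k t)))))).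
{ apply Lim_seq_correct', ex_lim_seq_cauchy_corr. intros [e He].
  destruct (contraction_pow_lt (2 * rho) (e / 2)) as [N HN]; [lra|lra|].
  exists N. intros n m Hn Hm. cbn.
  assert (K : forall n, (N <= n)%nat -> Rabs (c (u n t) - c (u N t)) < e / 2).
  { intros n' Hn'. eapply Rle_lt_trans; [apply Hc|].
    eapply Rle_lt_trans; [apply picard_cauchy; assumption|]. apply HN; lia. }
  assert (K1 := K n Hn). assert (K2 := K m Hm). revert K1 K2.
  unfold Rabs; repeat destruct Rcase_abs; lra. }
split; [exact L|]. intros k.
assert (L' : is_lim_seq (fun j => Rabs (c (u (j + k)%nat t) - c (u k t)))
  (Rabs (real (Lim_seq (fun k => c (u k t))) - c (u k t)))).
{ apply (is_lim_seq_abs _ (Finite (real (Lim_seq (fun k => c (u k t))) - c (u k t)))).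
  apply is_lim_seq_minus'; [|apply is_lim_seq_const].
  apply (is_lim_seq_incr_n (fun j => c (u j t))), L. }
refine (is_lim_seq_le _ (fun _ => (10 * M * rho) ^ k * (2 * rho)) _ _ _ L' (is_lim_seq_const _)).
intros j. eapply Rle_trans; [apply Hc|]. apply picard_cauchy; [assumption|lia].
Qed.

Lemma picard_limit : exists y, y 0 = s /\
  (forall t, 0 <= t <= 1 -> ccont y unit_int t) /\
  (forall t, 0 < t < 1 -> Der y t (F t (y t))).
Proof.
pose (y t := (real (Lim_seq (fun k => fst (u k t))), real (Lim_seq (fun k => snd (u k t)))) : C).
assert (Hf := fun t => picard_component_limit fst t (fun z w => fst_le_Cmod (Cminus z w))).
assert (Hs := fun t => picard_component_limit snd t (fun z w => snd_le_Cmod (Cminus z w))).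
assert (Hy : forall t k, 0 <= t <= 1 -> Cmod (y t - u k t) <= (10 * M * rho) ^ k * (4 * rho)).
{ intros t k Ht. eapply Rle_trans; [apply Cmod_le_comp|].
  assert (H1 := proj2 (Hf t Ht) k). assert (H2 := proj2 (Hs t Ht) k).
  cbn in *. unfold Rminus in *. lra. }
assert (y0 : y 0 = s).
{ unfold y. rewrite (Lim_seq_ext _ (fun _ => fst s)) by (intros; rewrite u_0; reflexivity).
  rewrite (Lim_seq_ext (fun k => snd _) (fun _ => snd s)) by (intros; rewrite u_0; reflexivity).
  rewrite !Lim_seq_const. destruct s; reflexivity. }
assert (yc : forall t, 0 <= t <= 1 -> ccont y unit_int t).
{ intros t Ht e He.
  destruct (contraction_pow_lt (4 * rho) (e / 3)) as [N HN]; [lra|lra|].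
  specialize (HN N (Nat.le_refl N)).
  destruct (u_ccont N unit_int t (e / 3)) as [d [Hd Hu]]; [lra|].
  exists d; split; [exact Hd|]. intros t' Ht' Htd.
  specialize (Hu t' Ht' Htd).
  assert (K1 := Hy t N Ht). assert (K2 := Hy t' N Ht').
  replace (y t' - y t)%C with ((y t' - u N t') + ((u N t' - u N t) + - (y t - u N t)))%C by ring.
  eapply Rle_lt_trans; [apply Cmod_triangle|].
  eapply Rle_lt_trans; [apply Rplus_le_compat_l, Cmod_triangle|]. rewrite Cmod_opp. lra. }
assert (yle : forall t, 0 <= t <= 1 -> Cmod (y t) <= rho).
{ intros t Ht. apply Rnot_lt_le. intros Hlt.
  destruct (contraction_pow_lt (4 * rho) (Cmod (y t) - rho)) as [N HN]; [lra|lra|].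
  specialize (HN N (Nat.le_refl N)). assert (K := Hy t N Ht). assert (K' := u_le N t Ht).
  replace (y t) with ((y t - u N t) + u N t)%C in HN, Hlt at 1 by ring.
  assert (K2 := Cmod_triangle (y t - u N t) (u N t)).
  replace ((y t - u N t) + u N t)%C with (y t) in * by ring. lra. }
exists y; split; [exact y0|]; split; [exact yc|].
(* [CVU_derivable] works on an open ball; the interval (0, 1) is the ball of centre and radius
   1/2. *)
assert (Hhalf : 0 < / 2) by lra.
assert (HB : forall t, Boule (/ 2) (mkposreal _ Hhalf) t -> 0 < t < 1).
{ intros t Ht. unfold Boule in Ht. cbn in Ht. revert Ht. unfold Rabs; destruct Rcase_abs; lra. }
assert (HC : forall (c : C -> R), (forall z w, Rabs (c z - c w) <= Cmod (z - w)) ->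
  CVU (fun k t => c (F t (u k t))) (fun t => c (F t (y t))) (/ 2) (mkposreal _ Hhalf)).
{ intros c Hc e He.
  destruct (contraction_pow_lt (4 * rho) e) as [N HN]; [lra|lra|].
  exists N. intros n t Hn Ht. apply HB in Ht.
  assert (Ht' : 0 <= t <= 1) by lra.
  eapply Rle_lt_trans; [apply Hc|].
  eapply Rle_lt_trans; [apply abel_rhs_lipschitz; auto; apply u_le, Ht'|].
  specialize (HN n Hn). assert (K := Hy t n Ht'). assert (H3 := M_ge0).
  assert (0 <= 5 * M * rho <= 1).
  { split; [repeat apply Rmult_le_pos|]; lra. }
  assert (K2 := Cmod_ge_0 (y t - u n t)). nra. }
intros t Ht.
assert (Bt : Boule (/ 2) (mkposreal _ Hhalf) t).
{ unfold Boule; cbn. unfold Rabs; destruct Rcase_abs; lra. }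
split; apply is_derive_Reals.
- apply (CVU_derivable (fun k t => fst (u (S k) t)) _ (fun t => fst (y t)) _ _ _ (HC fst (fun z w => fst_le_Cmod (Cminus z w)))); [| |exact Bt].
  + intros x Hx. apply HB in Hx. apply is_lim_seq_Reals.
    apply (is_lim_seq_incr_1 (fun k => fst (u k x))). apply Hf; lra.
  + intros n x _. apply is_derive_Reals. apply uSD.
- apply (CVU_derivable (fun k t => snd (u (S k) t)) _ (fun t => snd (y t)) _ _ _ (HC snd (fun z w => snd_le_Cmod (Cminus z w)))); [| |exact Bt].
  + intros x Hx. apply HB in Hx. apply is_lim_seq_Reals.
    apply (is_lim_seq_incr_1 (fun k => snd (u k x))). apply Hs; lra.
  + intros n x _. apply is_derive_Reals. apply uSD.
Qed.

End AbelIteration.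

(** * Solutions of the Abel equation on a segment against their iterates *)

Lemma peval_seg_bounded (P : cpoly) a b :
  exists M, 0 <= M /\ forall t, 0 <= t <= 1 -> Cmod (peval P (seg a b t)) <= M.
Proof.
assert (HS : forall t, 0 <= t <= 1 -> Cmod (seg a b t) <= Cmod a + Cmod (b - a)).
{ intros t Ht. unfold seg. eapply Rle_trans; [apply Cmod_triangle|].
  rewrite Cmod_mult, Cmod_R, Rabs_pos_eq by lra.
  assert (K := Cmod_ge_0 (b - a)). nra. }
induction P as [|c P [M [HM IH]]].
- exists 0. split; [lra|]. intros t _. cbn. rewrite Cmod_0. lra.
- assert (K1 := Cmod_ge_0 c). assert (K2 := Cmod_ge_0 a). assert (K3 := Cmod_ge_0 (b - a)).
  exists (Cmod c + (Cmod a + Cmod (b - a)) * M). split; [nra|].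
  intros t Ht. cbn. eapply Rle_trans; [apply Cmod_triangle|]. rewrite Cmod_mult.
  apply Rplus_le_compat_l. apply Rmult_le_compat; auto; apply Cmod_ge_0.
Qed.

Definition abel_rhs (p q : cpoly) (a b eps : C) (t : R) (y : C) : C :=
  Cmult (Cminus b a)
    (Cplus (Cmult (peval p (seg a b t)) (Cmult y (Cmult y y)))
           (Cmult eps (Cmult (peval q (seg a b t)) (Cmult y y)))).

Definition picard_iterates (p q : cpoly) (a b eps s : C) (u : nat -> R -> C) : Prop :=
  (forall t, u 0%nat t = s) /\ (forall k, u (S k) 0 = s) /\
  (forall k t, Der (u (S k)) t (abel_rhs p q a b eps t (u k t))).

(** [M] is chosen before [rho] and [s], so that [rho] may shrink together with [s]. *)
Lemma abel_picard (p q : cpoly) (a b eps : C) :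
  exists M, 1 <= M /\ forall rho s (u : nat -> R -> C),
    0 < rho -> 10 * M * rho <= / 4 -> Cmod s <= rho / 4 ->
    picard_iterates p q a b eps s u ->
    (exists y, abel_sol_on_seg p q a b eps y /\ y 0 = s) /\
    (forall y, abel_sol_on_seg p q a b eps y -> y 0 = s ->
       forall k, Cmod (y 1 - u k 1) <= (10 * M * rho) ^ k * (2 * rho)).
Proof.
destruct (peval_seg_bounded p a b) as [A [HA HpA]].
destruct (peval_seg_bounded q a b) as [B [HB HqB]].
pose (D := Cmod (b - a)). assert (HD : 0 <= D) by apply Cmod_ge_0.
pose (E := Cmod eps). assert (HE : 0 <= E) by apply Cmod_ge_0.
exists (1 + D * A + D * (E * B)).
assert (0 <= D * A) by (apply Rmult_le_pos; assumption).
assert (0 <= D * (E * B)) by (repeat apply Rmult_le_pos; assumption).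
split; [lra|].
intros rho s u Hrho Hq Hs [u0 [uS uD]].
assert (Hrho1 : rho <= 1) by nra.
pose (al t := Cmult (Cminus b a) (peval p (seg a b t))).
pose (be t := Cmult (Cminus b a) (Cmult eps (peval q (seg a b t)))).
assert (Hal : forall t, 0 <= t <= 1 -> Cmod (al t) <= 1 + D * A + D * (E * B)).
{ intros t Ht. unfold al. rewrite Cmod_mult.
  apply Rle_trans with (D * A); [apply Rmult_le_compat_l; auto|lra]. }
assert (Hbe : forall t, 0 <= t <= 1 -> Cmod (be t) <= 1 + D * A + D * (E * B)).
{ intros t Ht. unfold be. rewrite !Cmod_mult.
  apply Rle_trans with (D * (E * B)); [|lra].
  apply Rmult_le_compat_l; [assumption|]. apply Rmult_le_compat_l; auto. }
assert (HF : forall t y, abel_rhs p q a b eps t y = (al t * (y * (y * y)) + be t * (y * y))%C).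
{ intros t y. unfold abel_rhs, al, be. ring. }
assert (uD' : forall k t, Der (u (S k)) t (al t * (u k t * (u k t * u k t)) + be t * (u k t * u k t))%C).
{ intros k t. rewrite <- HF. apply uD. }
split.
- destruct (picard_limit al be _ rho s u Hal Hbe Hrho1 Hrho Hq Hs u0 uS uD') as [y [y0 [yc yD]]].
  exists y; split; [|exact y0]. split.
  + intros t Ht. apply filterlim_ccont, yc, Ht.
  + intros t Ht. apply Der_is_derive. specialize (yD t Ht). rewrite <- HF in yD. exact yD.
- intros y [yc yD] y0 k.
  apply (picard_error al be _ rho s u Hal Hbe Hrho1 Hrho Hq Hs u0 uS uD' y y0); [| |lra].
  + intros t Ht. apply filterlim_ccont, yc, Ht.
  + intros t Ht. rewrite <- HF. apply Der_is_derive, yD, Ht.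
Qed.

Definition center_at (p q : cpoly) (a b eps : C) : Prop :=
  exists delta : R, 0 < delta /\
    forall y : R -> C, abel_sol_on_seg p q a b eps y -> Cmod (y 0) < delta -> y 1 = y 0.

(** With [rho] proportional to the initial value [x], the contraction factor is itself O(x), so
    geometric convergence becomes an order of vanishing: the [k]-th iterate differs from the
    solution by O(x^(k+1)). *)
Lemma center_iterates_small p q a b eps : center_at p q a b eps ->
  exists d, 0 < d /\ forall k, exists A, 0 <= A /\
    forall x u, 0 < x < d -> picard_iterates p q a b eps (RtoC x) u ->
      Cmod (RtoC x - u k 1) <= A * x ^ k * x.
Proof.
intros [delta [Hdelta Hc]].
destruct (abel_picard p q a b eps) as [M [HM Hp]].
(* For [rho = 4 x], the condition [10 M rho <= 1/4] reads [x <= 1 / (160 M)]. *)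
assert (H160 : 0 < / (160 * M)) by (apply Rinv_0_lt_compat; lra).
exists (Rmin delta (/ (160 * M))).
split; [apply Rmin_pos; assumption|]. intros k.
exists ((40 * M) ^ k * 8). split; [apply Rmult_le_pos; [apply pow_le|]; lra|].
intros x u [Hx0 Hx] Hu.
assert (Hx1 : x < delta) by (eapply Rlt_le_trans; [exact Hx|apply Rmin_l]).
assert (Hx2 : x < / (160 * M)) by (eapply Rlt_le_trans; [exact Hx|apply Rmin_r]).
assert (Cx : Cmod (RtoC x) = x) by (rewrite Cmod_R, Rabs_pos_eq; lra).
destruct (Hp (4 * x) (RtoC x) u) as [[y [Hy y0]] He]; [lra| | rewrite Cx; lra | exact Hu|].
{ apply Rmult_lt_compat_l with (r := 160 * M) in Hx2; [|lra].
  rewrite Rinv_r in Hx2 by lra. lra. }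
specialize (He y Hy y0 k).
rewrite (Hc y Hy) in He by (rewrite y0, Cx; exact Hx1).
rewrite y0 in He. eapply Rle_trans; [exact He|].
replace (10 * M * (4 * x)) with (40 * M * x) by ring. rewrite Rpow_mult_distr. right; ring.
Qed.

(** Here [rho] stays fixed: iterates that all end at [s] converge to the end value of any solution
    starting at [s]. *)
Lemma center_of_iterates p q a b eps :
  (forall s, exists u, picard_iterates p q a b eps s u /\ forall k, u k 1 = s) ->
  center_at p q a b eps.
Proof.
intros Hu. destruct (abel_picard p q a b eps) as [M [HM Hp]].
pose (rho := / (40 * M)). assert (Hrho : 0 < rho) by (apply Rinv_0_lt_compat; lra).
assert (Hq : 10 * M * rho = / 4) by (unfold rho; field; lra).
exists (rho / 4). split; [lra|].
intros y Hy Hs. destruct (Hu (y 0)) as [u [Hi H1]].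
destruct (Hp rho (y 0) u) as [_ He]; [lra|lra|lra|exact Hi|].
specialize (He y Hy eq_refl).
replace (y 1) with (y 0 + (y 1 - y 0))%C by ring.
enough (E : (y 1 - y 0)%C = RtoC 0) by (rewrite E; ring).
apply Cmod_eq_0, Rle_antisym; [|apply Cmod_ge_0].
apply Rnot_lt_le. intros Hpos.
destruct (pow_lt_1_zero (/ 4)) with (y := Cmod (y 1 - y 0) / (2 * rho)) as [N HN].
{ rewrite Rabs_pos_eq; lra. }
{ apply Rdiv_lt_0_compat; lra. }
specialize (HN N (Nat.le_refl N)). rewrite Rabs_pos_eq in HN by (apply pow_le; lra).
specialize (He N). rewrite Hq, H1 in He.
apply Rmult_lt_compat_r with (r := 2 * rho) in HN; [|lra].
replace (Cmod (y 1 - y 0) / (2 * rho) * (2 * rho)) with (Cmod (y 1 - y 0)) in HN by (field; lra).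
lra.
Qed.

Lemma Der_const c t : Der (fun _ => c) t (RtoC 0).
Proof. split; apply @is_derive_const. Qed.

Lemma Der_plus f g t l m : Der f t l -> Der g t m -> Der (fun x => Cplus (f x) (g x)) t (Cplus l m).
Proof. intros [H1 H2] [H3 H4]; split; cbn; apply @is_derive_plus; assumption. Qed.

Lemma Der_mult f g t l m : Der f t l -> Der g t m ->
  Der (fun x => Cmult (f x) (g x)) t (Cplus (Cmult l (g t)) (Cmult (f t) m)).
Proof.
intros [H1 H2] [H3 H4].
assert (K : forall (f g : R -> R) l m, is_derive f t l -> is_derive g t m ->
  is_derive (fun x => f x * g x) t (l * g t + f t * m)).
{ intros f' g' l' m' Hf Hg. apply (is_derive_mult f' g' t l' m' Hf Hg). intros; apply Rmult_comm. }
split; cbn.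
- replace (fst l * fst (g t) - snd l * snd (g t) + (fst (f t) * fst m - snd (f t) * snd m))
    with ((fst l * fst (g t) + fst (f t) * fst m) - (snd l * snd (g t) + snd (f t) * snd m)) by ring.
  apply @is_derive_minus; apply K; assumption.
- replace (fst l * snd (g t) + snd l * fst (g t) + (fst (f t) * snd m + snd (f t) * fst m))
    with ((fst l * snd (g t) + fst (f t) * snd m) + (snd l * fst (g t) + snd (f t) * fst m)) by ring.
  apply @is_derive_plus; apply K; assumption.
Qed.

Lemma Der_seg a b t : Der (seg a b) t (Cminus b a).
Proof.
assert (K : Der (fun x => RtoC x) t (RtoC 1)).
{ split; cbn; [apply @is_derive_id|apply @is_derive_const]. }
assert (H := Der_plus _ _ _ _ _ (Der_const a t) (Der_mult _ _ _ _ _ K (Der_const (Cminus b a) t))).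
replace (Cminus b a) with (Cplus (RtoC 0) (Cplus (Cmult (RtoC 1) (Cminus b a)) (Cmult (RtoC t) (RtoC 0)))) by ring.
exact H.
Qed.

From HB Require Import structures.
From mathcomp Require Import all_boot all_order all_algebra all_solvable all_field.
From mathcomp Require Import boolp Rstruct complex ring zify.
Set Implicit Arguments. Unset Strict Implicit. Unset Printing Implicit Defensive.
Import Order.TTheory GRing.Theory Num.Theory.
Local Open Scope ring_scope.

(** * Formal power series *)

Record ps (R : Type) := PS { pc : nat -> R }.

Lemma psP (R : Type) (f g : ps R) : (forall n, pc f n = pc g n) -> f = g.
Proof. by case: f g => [f] [g] /= H; congr PS; apply/funext. Qed.

HB.instance Definition _ (R : Type) := gen_eqMixin (ps R).
HB.instance Definition _ (R : Type) := gen_choiceMixin (ps R).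

Section PSRing.
Variable R : comNzRingType.
Implicit Types f g h : ps R.

Definition ps_zero : ps R := PS (fun=> 0).
Definition ps_one : ps R := PS (fun n => (n == 0)%:R).
Definition ps_opp f : ps R := PS (fun n => - pc f n).
Definition ps_add f g : ps R := PS (fun n => pc f n + pc g n).
Definition ps_mul f g : ps R := PS (fun n => \sum_(i < n.+1) pc f i * pc g (n - i)).
Definition ps_trunc N f : {poly R} := \poly_(i < N.+1) pc f i.

(** Reduction to truncations lets the product inherit commutativity and associativity from
    [{poly R}]. *)
Lemma ps_trunc_mul N f g n : (n <= N)%N ->
  pc (ps_mul f g) n = (ps_trunc N f * ps_trunc N g)`_n.
Proof.
move=> leN; rewrite coefM /=; apply: eq_bigr => i _.
by rewrite !coef_poly !ltnS (leq_trans (leq_ord i) leN) (leq_trans (leq_subr _ _) leN).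
Qed.

Fact ps_addA : associative ps_add.
Proof. by move=> f g h; apply: psP => n /=; rewrite addrA. Qed.
Fact ps_addC : commutative ps_add.
Proof. by move=> f g; apply: psP => n /=; rewrite addrC. Qed.
Fact ps_add0 : left_id ps_zero ps_add.
Proof. by move=> f; apply: psP => n /=; rewrite add0r. Qed.
Fact ps_addN : left_inverse ps_zero ps_opp ps_add.
Proof. by move=> f; apply: psP => n /=; rewrite addNr. Qed.
Fact ps_mulC : commutative ps_mul.
Proof. by move=> f g; apply: psP => n; rewrite !(@ps_trunc_mul n) // mulrC. Qed.
Fact ps_mulA : associative ps_mul.
Proof.
have eqt N f (p : {poly R}) n : (n <= N)%N -> (forall i, (i <= N)%N -> pc f i = p`_i) ->
  forall g (q : {poly R}), (forall i, (i <= N)%N -> pc g i = q`_i) -> pc (ps_mul f g) n = (p * q)`_n.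
  move=> leN Hf g q Hg; rewrite coefM /=; apply: eq_bigr => i _.
  by rewrite Hf ?Hg // ?(leq_trans (leq_subr _ _) leN) // (leq_trans (leq_ord i) leN).
have tr N f i : (i <= N)%N -> pc f i = (ps_trunc N f)`_i by move=> h; rewrite coef_poly ltnS h.
move=> f g h; apply: psP => n.
rewrite (@eqt n f (ps_trunc n f) n _ _ _ (ps_trunc n g * ps_trunc n h)) //; first last.
- by move=> i hi; rewrite (@ps_trunc_mul n).
- by move=> i; apply: tr.
rewrite (@eqt n _ (ps_trunc n f * ps_trunc n g) n _ _ _ (ps_trunc n h)) ?mulrA //.
- by move=> i hi; rewrite (@ps_trunc_mul n).
- by move=> i; apply: tr.
Qed.
Fact ps_mul1 : left_id ps_one ps_mul.
Proof.
move=> f; apply: psP => n /=; rewrite big_ord_recl /= subn0 mul1r big1 ?addr0 // => i _.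
by rewrite mul0r.
Qed.
Fact ps_mulDl : left_distributive ps_mul ps_add.
Proof.
move=> f g h; apply: psP => n /=; rewrite -big_split /=; apply: eq_bigr => i _.
by rewrite mulrDl.
Qed.
Fact ps_one_neq0 : ps_one != ps_zero.
Proof. by apply/eqP => /(congr1 (fun f => pc f 0))/= /eqP; rewrite oner_eq0. Qed.

HB.instance Definition _ := GRing.isZmodule.Build (ps R) ps_addA ps_addC ps_add0 ps_addN.
HB.instance Definition _ := GRing.Zmodule_isComNzRing.Build (ps R)
  ps_mulA ps_mulC ps_mul1 ps_mulDl ps_one_neq0.

Lemma pc0 n : pc (0 : ps R) n = 0. Proof. by []. Qed.
Lemma pc1 n : pc (1 : ps R) n = (n == 0)%:R. Proof. by []. Qed.
Lemma pcN f n : pc (- f) n = - pc f n. Proof. by []. Qed.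
Lemma pcD f g n : pc (f + g) n = pc f n + pc g n. Proof. by []. Qed.
Lemma pcB f g n : pc (f - g) n = pc f n - pc g n. Proof. by []. Qed.
Lemma pcM f g n : pc (f * g) n = \sum_(i < n.+1) pc f i * pc g (n - i).
Proof. by []. Qed.

Definition coefps n f := pc f n.
Fact coefps_is_zmod n : zmod_morphism (coefps n). Proof. by []. Qed.
HB.instance Definition _ n := GRing.isZmodMorphism.Build (ps R) R (coefps n) (coefps_is_zmod n).

Lemma pc_sum I (r : seq I) (P : pred I) (F : I -> ps R) n :
  pc (\sum_(i <- r | P i) F i) n = \sum_(i <- r | P i) pc (F i) n.
Proof. exact: (raddf_sum (coefps n)). Qed.

Lemma pcMn f k n : pc (f *+ k) n = pc f n *+ k.
Proof. exact: (raddfMn (coefps n)). Qed.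

Definition psC (c : R) : ps R := PS (fun n => if n == 0%N then c else 0).
Lemma pc_C c n : pc (psC c) n = if n == 0%N then c else 0. Proof. by []. Qed.
Lemma pcCM c f n : pc (psC c * f) n = c * pc f n.
Proof.
rewrite pcM big_ord_recl /= subn0 big1 ?addr0 // => i _.
by rewrite mul0r.
Qed.
Fact psC_is_zmod : zmod_morphism psC.
Proof. by move=> a b; apply: psP => n; rewrite pcB !pc_C; case: ifP => // _; rewrite subr0. Qed.
Fact psC_is_monoid : monoid_morphism psC.
Proof.
split; first by apply: psP => n; rewrite pc_C pc1; case: eqP.
by move=> a b; apply: psP => n; rewrite pcCM !pc_C; case: ifP => // _; rewrite mulr0.
Qed.
HB.instance Definition _ := GRing.isZmodMorphism.Build R (ps R) psC psC_is_zmod.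
HB.instance Definition _ := GRing.isMonoidMorphism.Build R (ps R) psC psC_is_monoid.

Definition psX : ps R := PS (fun n => (n == 1%N)%:R).
Lemma pc_X n : pc psX n = (n == 1%N)%:R. Proof. by []. Qed.
Lemma pcXM f n : pc (psX * f) n = if n is k.+1 then pc f k else 0.
Proof.
case: n => [|n]; first by rewrite pcM big_ord1 pc_X mul0r.
rewrite pcM big_ord_recl pc_X mul0r add0r big_ord_recl pc_X /= mul1r subn1 /= big1 ?addr0 // => i _.
by rewrite mul0r.
Qed.
Lemma pcXnM k f n : pc (psX ^+ k * f) n = if (k <= n)%N then pc f (n - k) else 0.
Proof.
elim: k n => [|k IH] n; first by rewrite expr0 mul1r subn0.
by rewrite exprS -mulrA pcXM; case: n => [|n] //; rewrite IH ltnS subSS.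
Qed.
Lemma pc_Xn k n : pc (psX ^+ k) n = (n == k)%:R.
Proof.
rewrite -[psX ^+ k]mulr1 pcXnM pc1 -[(n - k == 0)%N]/(n <= k)%N; case: leqP => h; last first.
  by rewrite ltn_eqF.
by rewrite eqn_leq h andbT.
Qed.
Lemma psX_dvd f : pc f 0 = 0 -> exists g, f = psX * g.
Proof.
move=> h; exists (PS (fun n => pc f n.+1)); apply: psP => n; rewrite pcXM.
by case: n.
Qed.
Lemma pc0M f g : pc (f * g) 0 = pc f 0 * pc g 0.
Proof. by rewrite pcM big_ord1 subn0. Qed.
Lemma pc0X f k : pc (f ^+ k) 0 = pc f 0 ^+ k.
Proof. by elim: k => [|k IH]; rewrite ?pc1 // !exprS pc0M IH. Qed.

(* Euler derivation z d/dz *)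
Definition psT f : ps R := PS (fun n => pc f n *+ n).
Lemma pcT f n : pc (psT f) n = pc f n *+ n. Proof. by []. Qed.
Fact psT_is_zmod : zmod_morphism psT.
Proof. by move=> f g; apply: psP => n; rewrite /= mulrnBl. Qed.
HB.instance Definition _ := GRing.isZmodMorphism.Build (ps R) (ps R) psT psT_is_zmod.
Lemma psTM f g : psT (f * g) = psT f * g + f * psT g.
Proof.
apply: psP => n; rewrite pcD !pcM pcT pcM -sumrMnl -big_split /=; apply: eq_bigr => i _.
by rewrite mulrnAl mulrnAr -mulrnDr subnKC // -ltnS.
Qed.
Lemma psT1 : psT 1 = 0.
Proof. by apply: psP => -[|n]; rewrite pcT ?mulr0n // pc1 mul0rn. Qed.
Lemma psTC c : psT (psC c) = 0.
Proof. by apply: psP => -[|n]; rewrite pcT ?mulr0n // pc_C mul0rn. Qed.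
Lemma psTX : psT psX = psX.
Proof. by apply: psP => n; rewrite pcT pc_X; case: eqP => [->|] //; rewrite mul0rn. Qed.
Lemma psTexp f k : psT (f ^+ k.+1) = (f ^+ k * psT f) *+ k.+1.
Proof.
elim: k => [|k IH]; first by rewrite expr1 expr0 mul1r.
by rewrite exprS psTM IH mulrnAr [f * (_ * _)]mulrA -exprS [psT f * _]mulrC -mulrS.
Qed.
Lemma psTXn k : psT (psX ^+ k) = psX ^+ k *+ k.
Proof.
case: k => [|k]; first by rewrite expr0 psT1 mulr0n.
by rewrite psTexp psTX -exprSr.
Qed.

(** Congruence modulo [psX ^+ k], that is, closeness in the X-adic metric. *)
Definition eqm k f g := forall i, (i < k)%N -> pc f i = pc g i.
Lemma eqm0 f g : eqm 0 f g. Proof. by move=> i; rewrite ltn0. Qed.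
Lemma eqm_refl k f : eqm k f f. Proof. by []. Qed.
Lemma eqm_sym k f g : eqm k f g -> eqm k g f.
Proof. by move=> h i hi; rewrite h. Qed.
Lemma eqm_trans k f g h : eqm k f g -> eqm k g h -> eqm k f h.
Proof. by move=> H1 H2 i hi; rewrite H1 ?H2. Qed.
Lemma eqm_le k l f g : (k <= l)%N -> eqm l f g -> eqm k f g.
Proof. by move=> h H i hi; apply: H; apply: leq_trans hi h. Qed.
Lemma eqmD k f g f' g' : eqm k f f' -> eqm k g g' -> eqm k (f + g) (f' + g').
Proof. by move=> H1 H2 i hi; rewrite !pcD H1 ?H2. Qed.
Lemma eqmM k f g f' g' : eqm k f f' -> eqm k g g' -> eqm k (f * g) (f' * g').
Proof.
move=> H1 H2 i hi; rewrite !pcM; apply: eq_bigr => j _.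
by rewrite H1 ?H2 // ?(leq_ltn_trans (leq_subr _ _) hi) // (leq_ltn_trans (leq_ord j) hi).
Qed.
Lemma eqmE k f f' e : eqm k f f' -> eqm k (f ^+ e) (f' ^+ e).
Proof. by move=> H; elim: e => [|e IH] //; rewrite !exprS; apply: eqmM. Qed.
Lemma eqmT k f f' : eqm k f f' -> eqm k (psT f) (psT f').
Proof. by move=> H i hi; rewrite !pcT H. Qed.
Lemma eqm_dvd k f g : eqm k f g -> exists h, f - g = psX ^+ k * h.
Proof.
move=> H; exists (PS (fun n => pc (f - g) (k + n))); apply: psP => n; rewrite pcXnM /=.
by case: leqP => h; rewrite ?subnKC // H ?subrr.
Qed.
Lemma dvd_eqm k f g h : f - g = psX ^+ k * h -> eqm k f g.
Proof.
move=> H i hi; apply/eqP; rewrite -subr_eq0 -pcB H pcXnM.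
by rewrite leqNgt hi.
Qed.
Lemma eqmS_mulX k f g : eqm k f g -> eqm k.+1 (psX * f) (psX * g).
Proof. by move=> H [|i] hi; rewrite !pcXM // H. Qed.
Lemma eqm_eq f g : (forall k, eqm k f g) -> f = g.
Proof. by move=> H; apply: psP => n; apply: (H n.+1). Qed.

(** The contraction principle for the X-adic metric on a closed invariant set [I]. The convergence
    of the iterates is kept in the conclusion because it is through them that coefficients of the
    fixed point are later controlled. *)
Lemma ps_fix (I : ps R -> Prop) (Phi : ps R -> ps R) x0 :
  I x0 -> (forall f, I f -> I (Phi f)) ->
  (forall f, (forall k, exists2 g, I g & eqm k f g) -> I f) ->
  (forall k f g, I f -> I g -> eqm k f g -> eqm k.+1 (Phi f) (Phi g)) ->
  exists u, [/\ I u, Phi u = u & forall k, eqm k (iter k Phi x0) u].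
Proof.
move=> I0 IP Icl Hc.
have Ii k : I (iter k Phi x0) by elim: k => //= k; apply: IP.
have Hs k : eqm k (iter k Phi x0) (iter k.+1 Phi x0).
  elim: k => [|k IH]; first exact: eqm0.
  by rewrite !iterS; apply: Hc; rewrite -?iterS.
have Hl k l : (k <= l)%N -> eqm k (iter k Phi x0) (iter l Phi x0).
  move=> /subnK <-; elim: (l - k)%N => [|j IH] //=.
  by apply: eqm_trans IH _; exact: (eqm_le (leq_addl j k) (Hs (j + k)%N)).
(* The coefficient at [n] no longer changes from the iterate [n.+1] on. *)
pose u := PS (fun n => pc (iter n.+1 Phi x0) n).
have Hu k : eqm k (iter k Phi x0) u.
  by move=> i hi /=; rewrite -iterS; apply/esym; apply: Hl.
have Iu : I u by apply: Icl => k; exists (iter k Phi x0) => //; apply: eqm_sym.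
exists u; split => //; apply: eqm_eq => -[|k]; first exact: eqm0.
apply: (@eqm_trans _ _ (iter k.+1 Phi x0)); last exact: Hu.
by rewrite iterS; apply: Hc => //; apply: eqm_sym.
Qed.

Lemma ps_inv_ex f : pc f 0 = 1 -> exists g, g * f = 1.
Proof.
move=> f0.
have [h Hh] : exists h, 1 - f = psX * h by apply: psX_dvd; rewrite pcB f0 pc1 subrr.
have Hc k a b : True -> True -> eqm k a b ->
    eqm k.+1 (1 + psX * h * a) (1 + psX * h * b).
  move=> _ _ Hab; apply: eqmD => //; rewrite -!mulrA; apply: eqmS_mulX.
  exact: eqmM.
have [g [_ gE _]] := @ps_fix (fun=> True) (fun g => 1 + psX * h * g) 0 I (fun _ _ => I) (fun _ _ => I) Hc.
exists g; have -> : f = 1 - psX * h by rewrite -Hh; ring.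
by rewrite mulrBr mulr1 -[X in X - _]gE [g * _]mulrC addrK.
Qed.

Definition ps_unit : {pred ps R} := fun f => `[< exists g, g * f = 1 >].
Definition ps_inv f : ps R :=
  if pselect (exists g, g * f = 1) is left H then sval (cid H) else f.
Fact ps_mulVf : {in ps_unit, left_inverse 1 ps_inv *%R}.
Proof.
move=> f /asboolP fu; rewrite /ps_inv; case: pselect => // H; exact: (svalP (cid H)).
Qed.
Fact ps_unitP f g : g * f = 1 -> ps_unit f.
Proof. by move=> h; apply/asboolP; exists g. Qed.
Fact ps_inv_out : {in [predC ps_unit], ps_inv =1 id}.
Proof.
move=> f; rewrite inE => /negP h; rewrite /ps_inv; case: pselect => // H.
by case: h; apply/asboolP.
Qed.
HB.instance Definition _ := GRing.ComNzRing_hasMulInverse.Build (ps R) ps_mulVf ps_unitP ps_inv_out.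

Lemma ps_unit1 f : pc f 0 = 1 -> f \is a GRing.unit.
Proof. by move=> /ps_inv_ex[g /ps_unitP]. Qed.
Lemma pc0V f : pc f 0 = 1 -> pc f^-1 0 = 1.
Proof. by move=> h; have := divrr (ps_unit1 h); move/(congr1 (fun f => pc f 0)); rewrite pc0M h mul1r pc1. Qed.
Lemma psTV f : f \is a GRing.unit -> psT f^-1 = - (psT f * f^-1 * f^-1).
Proof.
move=> fu; have := psTM f f^-1; rewrite divrr // psT1 => h.
have : f^-1 * (psT f * f^-1 + f * psT f^-1) = 0 by rewrite -h mulr0.
rewrite mulrDr mulrA mulrA mulVr // mul1r => /eqP; rewrite addrC addr_eq0 => /eqP ->.
by rewrite [psT f * _]mulrC.
Qed.
Lemma eqmV k f g : pc f 0 = 1 -> pc g 0 = 1 -> eqm k f g -> eqm k f^-1 g^-1.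
Proof.
move=> f0 g0 /eqm_dvd[h H]; apply: (@dvd_eqm _ _ _ (- (h * f^-1 * g^-1))).
rewrite mulrN mulrA mulrA -H !mulrBl divrr ?ps_unit1 // mul1r.
by rewrite -[g * _ * _]mulrA [g * _]mulrC -[_ * _ * g]mulrA mulVr ?ps_unit1 // mulr1 opprB.
Qed.
End PSRing.

Arguments ps_mul {R} f g : simpl never.
Arguments psX {R}.
Arguments psC {R} c.

Section PSDomain.
Variable R : idomainType.
Implicit Types f g : ps R.

Lemma ps_ord f : f != 0 -> exists d, pc f d != 0 /\ forall i, (i < d)%N -> pc f i = 0.
Proof.
move=> f0; have H : exists d, pc f d != 0.
  apply: contrapT => H; case/eqP: f0; apply: psP => n; rewrite pc0.
  by apply/eqP; apply: contrapT => /negP h; apply: H; exists n.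
case: (ex_minnP H) => d hd hm; exists d; split => // i hi.
by apply/eqP; apply: contraTT hi => /hm; rewrite -leqNgt.
Qed.

Lemma pcM_low f g d e : (forall i, (i < d)%N -> pc f i = 0) -> (forall i, (i < e)%N -> pc g i = 0) ->
  pc (f * g) (d + e) = pc f d * pc g e.
Proof.
move=> Hf Hg; rewrite pcM (bigD1 (inord d)) //= inordK ?ltnS ?leq_addr // addKn big1 ?addr0 // => i.
rewrite -val_eqE /= inordK ?ltnS ?leq_addr // neq_ltn => /orP[h|h].
  by rewrite Hf ?mul0r.
rewrite Hg ?mulr0 // ltn_subLR; last by rewrite -ltnS.
by rewrite ltn_add2r.
Qed.

Fact ps_integral : GRing.integral_domain_axiom (ps R).
Proof.
move=> f g /eqP; case: (altP (f =P 0)) => // /ps_ord[d [fd fl]].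
case: (altP (g =P 0)) => // /ps_ord[e [ge gl]] /eqP h.
move/(congr1 (fun h => pc h (d + e))): h; rewrite pcM_low // pc0 => /eqP.
by rewrite mulf_eq0 (negPf fd) (negPf ge).
Qed.
HB.instance Definition _ := GRing.ComUnitRing_isIntegral.Build (ps R) ps_integral.
End PSDomain.
Global Opaque ps_mul ps_inv.

(** * Specialization of finitely generated fields *)

Section Subrings.
Variable F : numFieldType.
Implicit Types (A K : F -> Prop) (U V : {poly F}) (x : F).

Definition subring A := [/\ A 1, forall x y, A x -> A y -> A (x - y)
  & forall x y, A x -> A y -> A (x * y)].
Definition subfield K := subring K /\ forall x, K x -> K x^-1.

Section Closure.
Variables (A : F -> Prop) (hA : subring A).
Lemma sub1 : A 1. Proof. by case: hA. Qed.
Lemma subB x y : A x -> A y -> A (x - y). Proof. by case: hA => _ h _; apply: h. Qed.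
Lemma subM x y : A x -> A y -> A (x * y). Proof. by case: hA => _ _ h; apply: h. Qed.
Lemma sub0 : A 0. Proof. by rewrite -(subrr 1); apply: subB; exact: sub1. Qed.
Lemma subN x : A x -> A (- x). Proof. by rewrite -[- x]add0r; apply: subB; exact: sub0. Qed.
Lemma subD x y : A x -> A y -> A (x + y).
Proof. by move=> hx hy; rewrite -[y]opprK; apply: subB => //; apply: subN. Qed.
Lemma sub_sum I (r : seq I) (P : pred I) (E : I -> F) :
  (forall i, P i -> A (E i)) -> A (\sum_(i <- r | P i) E i).
Proof. by move=> h; elim/big_rec: _ => [|i y hi hy]; [exact: sub0|apply: subD => //; apply: h]. Qed.
Lemma subMn x n : A x -> A (x *+ n).
Proof. by move=> h; elim: n => [|n IH]; rewrite ?mulr0n ?mulrS; [exact: sub0|apply: subD]. Qed.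
Lemma subn n : A n%:R. Proof. exact/subMn/sub1. Qed.
Lemma subX x n : A x -> A (x ^+ n).
Proof. by move=> h; elim: n => [|n IH]; rewrite ?expr0 ?exprS; [exact: sub1|apply: subM]. Qed.

Definition polyin A (p : {poly F}) := forall i, A p`_i.
Lemma polyinB p q : polyin A p -> polyin A q -> polyin A (p - q).
Proof. by move=> hp hq i; rewrite coefB; apply: subB. Qed.
Lemma polyinD p q : polyin A p -> polyin A q -> polyin A (p + q).
Proof. by move=> hp hq i; rewrite coefD; apply: subD. Qed.
Lemma polyinM p q : polyin A p -> polyin A q -> polyin A (p * q).
Proof. by move=> hp hq i; rewrite coefM; apply: sub_sum => j _; apply: subM. Qed.
Lemma polyinZ c p : A c -> polyin A p -> polyin A (c *: p).
Proof. by move=> hp hq i; rewrite coefZ; apply: subM. Qed.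
Lemma polyinC c : A c -> polyin A c%:P.
Proof. by move=> h i; rewrite coefC; case: ifP => // _; exact: sub0. Qed.
Lemma polyinXn n : polyin A 'X^n.
Proof. by move=> i; rewrite coefXn; apply: subn. Qed.
Lemma polyin1 : polyin A 1. Proof. exact: (polyinXn 0). Qed.
Lemma polyin0 : polyin A 0. Proof. by move=> i; rewrite coef0; exact: sub0. Qed.

(** Division is redone by hand to see that quotient and remainder keep their coefficients in [A],
    which is a mere predicate. *)
Lemma div_monic V : V \is monic -> polyin A V -> forall U, polyin A U ->
  exists q r, [/\ polyin A q, polyin A r, U = q * V + r & (size r < size V)%N].
Proof.
move=> mV hV U; move: {2}(size U) (leqnn (size U)) => n; elim: n U => [|n IH] U sU hU.
  exists 0, 0; split; rewrite ?size_poly0 ?size_poly_gt0 ?monic_neq0 //; try exact: polyin0.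
  by rewrite mul0r addr0; apply/eqP; rewrite -size_poly_eq0 -leqn0.
have [sUV|sUV] := ltnP (size U) (size V).
  by exists 0, U; split; rewrite ?mul0r ?add0r //; exact: polyin0.
have [U0|U0] := eqVneq U 0.
  exists 0, 0; split; rewrite ?size_poly0 ?size_poly_gt0 ?monic_neq0 ?mul0r ?addr0 //; try exact: polyin0.
pose T := lead_coef U *: 'X^(size U - size V).
have hT : polyin A T by apply: polyinZ; [exact: hU|exact: polyinXn].
have sTV : size (T * V) = size U.
  rewrite size_Mmonic // ?scaler_eq0 ?lead_coef_eq0 ?negb_or ?U0 ?monic_neq0 ?monicXn //.
  by rewrite size_scale ?lead_coef_eq0 // size_polyXn addSn /= subnK.
have lTV : lead_coef (T * V) = lead_coef U.
  by rewrite lead_coefM (monicP mV) mulr1 /T lead_coefZ lead_coefXn mulr1.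
have : (size (U - T * V)%R <= n)%N.
  have sU0 : (0 < size U)%N by rewrite size_poly_gt0.
  have : (size (U - T * V)%R <= (size U).-1)%N.
    apply/leq_sizeP => j hj; rewrite coefB.
    have [hj'|hj'] := leqP (size U) j.
      by rewrite [U`_j]nth_default ?[(T * V)`_j]nth_default ?subr0 ?sTV.
    have -> : j = (size U).-1 by lia.
    by rewrite -{2}sTV -!lead_coefE lTV subrr.
  by lia.
case/IH => [|q [r [hq hr E sr]]]; first by apply: polyinB => //; apply: polyinM.
exists (q + T), r; split => //; first exact: polyinD.
by rewrite mulrDl addrAC -E subrK.
Qed.
End Closure.

Definition unitsin A (Gs : seq F) := forall g, g \in Gs -> A g /\ A g^-1.
Definition nz (Gs : seq F) := forall g, g \in Gs -> g != 0.

Lemma unitsin_cat A Gs Hs : unitsin A (Gs ++ Hs) <-> unitsin A Gs /\ unitsin A Hs.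
Proof.
split=> [h|[h1 h2] g]; last by rewrite mem_cat => /orP[/h1|/h2].
by split=> g hg; apply: h; rewrite mem_cat hg ?orbT.
Qed.
Lemma nz_cat Gs Hs : nz Gs -> nz Hs -> nz (Gs ++ Hs).
Proof. by move=> h1 h2 g; rewrite mem_cat => /orP[/h1|/h2]. Qed.
Lemma unitsin1 A g : unitsin A [:: g] <-> A g /\ A g^-1.
Proof. by split=> [h|h x]; [apply: h; rewrite inE|rewrite inE => /eqP->]. Qed.

Definition nzcoefs U := [seq c <- polyseq U | c != 0].
Lemma nz_nzcoefs U : nz (nzcoefs U).
Proof. by move=> g; rewrite mem_filter => /andP[]. Qed.
Lemma polyin_nzcoefs A U : subring A -> unitsin A (nzcoefs U) -> polyin A U.
Proof.
move=> hA h i; have [->|ui] := eqVneq U`_i 0; first exact: sub0.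
suff : U`_i \in nzcoefs U by case/h.
rewrite mem_filter ui /= mem_nth // ltnNge; apply: contraNN ui => hi.
by rewrite nth_default.
Qed.
Lemma nzcoefsK K U : polyin K U -> forall g, g \in nzcoefs U -> K g.
Proof. by move=> h g; rewrite mem_filter => /andP[_ /(nthP 0)[i _ <-]]. Qed.

(* For all but finitely many primes p, some subring of K contains the given
   elements and their inverses, but not 1/p. *)
Definition specializable K := forall Gs, nz Gs -> (forall g, g \in Gs -> K g) ->
  exists B, forall p, prime p -> (B < p)%N -> exists A,
    [/\ subring A, forall x, A x -> K x, unitsin A Gs & ~ A p%:R^-1].

(** What the transcendental and algebraic extensions share: [T] enlarges a subring of [K] to one of
    [K'] without creating [1/p], and a nonzero element of [K'] becomes a unit of [T A] as soon as
    finitely many elements of [K] are units of [A]. *)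
Lemma spec_step K K' (T : (F -> Prop) -> F -> Prop) L0 :
  nz L0 -> (forall g, g \in L0 -> K g) ->
  (forall A, subring A -> (forall x, A x -> K x) -> unitsin A L0 ->
     [/\ subring (T A), forall x, T A x -> K' x & forall p, prime p -> T A p%:R^-1 -> A p%:R^-1]) ->
  (forall g, K' g -> g != 0 -> exists L, [/\ nz L, forall h, h \in L -> K h &
     forall A, subring A -> (forall x, A x -> K x) -> unitsin A L -> T A g /\ T A g^-1]) ->
  specializable K -> specializable K'.
Proof.
move=> nL0 KL0 HT Hg HK Gs nG KG.
have [L [nL KL HL]] : exists L, [/\ nz L, forall h, h \in L -> K h &
     forall A, subring A -> (forall x, A x -> K x) -> unitsin A L -> unitsin (T A) Gs].
  elim: Gs nG KG => [|g Gs IH] nG KG.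
    by exists [::]; split.
  have [|h hh|L [nL KL HL]] := IH.
  - by move=> h hh; apply: nG; rewrite inE hh orbT.
  - by apply: KG; rewrite inE hh orbT.
  have [||L' [nL' KL' HL']] := Hg g; [by apply: KG; rewrite mem_head|by apply: nG; rewrite mem_head|].
  exists (L' ++ L); split; first exact: nz_cat.
    by move=> h; rewrite mem_cat => /orP[/KL'|/KL].
  move=> A hA AK /unitsin_cat[u1 u2] h; rewrite inE => /orP[/eqP->|]; first exact: HL'.
  exact: HL.
have [||B HB] := HK (L0 ++ L); first exact: nz_cat.
  by move=> h; rewrite mem_cat => /orP[/KL0|/KL].
exists B => p pp Bp; have [A [hA AK /unitsin_cat[u1 u2] nA]] := HB p pp Bp.
have [h1 h2 h3] := HT A hA AK u1.
exists (T A); split => //; first exact: HL.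
by move/(h3 _ pp).
Qed.

Definition ratin x := exists (a : int) (b : nat), (0 < b)%N /\ x = a%:~R / b%:R.

Lemma ratin_subfield : subfield ratin.
Proof.
split; first split.
- by exists 1, 1%N; rewrite divr1.
- move=> _ _ [a [b [b0 ->]]] [c [d [d0 ->]]]; exists (a * d%:Z - c * b%:Z), (b * d)%N.
  rewrite muln_gt0 b0 d0; split => //; rewrite natrM rmorphB !rmorphM /=.
  by field; rewrite !pnatr_eq0 -!lt0n b0 d0.
- move=> _ _ [a [b [b0 ->]]] [c [d [d0 ->]]]; exists (a * c), (b * d)%N.
  by rewrite muln_gt0 b0 d0; split => //; rewrite natrM rmorphM /= mulf_div.
move=> _ [[[|a]|a] [b [b0 ->]]].
- by exists 0, 1%N; rewrite mul0r invr0 mul0r.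
- by exists b%:Z, a.+1; split => //; rewrite invf_div.
- exists (- b%:Z), a.+1; split => //; rewrite invf_div NegzE !rmorphN /=.
  by rewrite invrN mulrN mulNr.
Qed.

(** The subring is the localization of the integers at [p], for [p] above all numerators and
    denominators that occur in [Gs]. *)
Lemma spec_rat : specializable ratin.
Proof.
pose A p x := exists (a : int) (b : nat), [/\ (0 < b)%N, ~~ (p %| b)%N & x = a%:~R / b%:R].
have HA p : prime p -> subring (A p) /\ ~ A p p%:R^-1.
  move=> pp; split; first split.
  - by exists 1, 1%N; rewrite divr1 Euclid_dvd1.
  - move=> _ _ [a [b [b0 pb ->]]] [c [d [d0 pd ->]]]; exists (a * d%:Z - c * b%:Z), (b * d)%N.
    rewrite muln_gt0 b0 d0; split => //; first by rewrite Euclid_dvdM // negb_or pb.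
    by rewrite natrM rmorphB !rmorphM /=; field; rewrite !pnatr_eq0 -!lt0n b0 d0.
  - move=> _ _ [a [b [b0 pb ->]]] [c [d [d0 pd ->]]]; exists (a * c), (b * d)%N.
    rewrite muln_gt0 b0 d0; split => //; first by rewrite Euclid_dvdM // negb_or pb.
    by rewrite natrM rmorphM /= mulf_div.
  case=> a [b [b0 /negP pb E]]; apply: pb.
  have bE : (b%:Z)%:~R = (p%:Z * a)%:~R :> F.
    rewrite rmorphM /=; have p0 : p%:R != 0 :> F by rewrite pnatr_eq0 -lt0n prime_gt0.
    have b0' : b%:R != 0 :> F by rewrite pnatr_eq0 -lt0n.
    by move/(congr1 (fun x => x * b%:R * p%:R)): E; rewrite divfK // mulrAC mulVf // mul1r mulrC.
  move/(@intr_inj F): bE => bE.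
  have -> : b = (p * `|a|)%N by rewrite -[b]/(`|b%:Z|%N) bE abszM.
  exact: dvdn_mulr.
move=> Gs nG KG.
suff [B HB] : exists B, forall p, prime p -> (B < p)%N -> unitsin (A p) Gs.
  exists B => p pp /HB - /(_ pp) hp; have [h1 h2] := HA p pp; exists (A p); split => //.
  by move=> x [a [b [b0 _ ->]]]; exists a, b.
elim: Gs nG KG => [|g Gs IH] nG KG; first by exists 0%N.
have [|h hh|B HB] := IH.
- by move=> h hh; apply: nG; rewrite inE hh orbT.
- by apply: KG; rewrite inE hh orbT.
have [a [b [b0 gE]]] : ratin g by apply: KG; rewrite mem_head.
have g0 : g != 0 by apply: nG; rewrite mem_head.
have a0 : (0 < `|a|)%N.
  by rewrite absz_gt0; apply: contraNN g0 => /eqP a0; rewrite gE a0 mul0r.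
exists (maxn B (maxn `|a| b)) => p pp; rewrite !gtn_max => /and3P[Bp ap bp].
move=> h; rewrite inE => /orP[/eqP->|]; last by apply: HB.
have nd k : (0 < k)%N -> (k < p)%N -> ~~ (p %| k)%N by move=> k0 kp; rewrite gtnNdvd.
split; first by exists a, b; rewrite nd.
case: a a0 ap gE => [a|a] /= a0 ap ->.
  by exists b%:Z, a; rewrite nd // invf_div.
exists (- b%:Z), a.+1; rewrite nd //; split => //; rewrite invf_div NegzE !rmorphN /=.
by rewrite invrN mulrN mulNr.
Qed.

Definition adjoin K x y := exists U V, [/\ polyin K U, polyin K V, V.[x] != 0 & y = U.[x] / V.[x]].

Lemma adjoinK K x y : subfield K -> K y -> adjoin K x y.
Proof.
move=> [hK _] hy; exists y%:P, 1; split; try by [apply: polyinC|exact: polyin1].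
  by rewrite hornerC oner_eq0.
by rewrite !hornerC divr1.
Qed.
Lemma adjoinx K x : subfield K -> adjoin K x x.
Proof.
move=> [hK _]; exists 'X^1, 1; split; try by [apply: polyinXn|exact: polyin1].
  by rewrite hornerC oner_eq0.
by rewrite expr1 hornerX !hornerC divr1.
Qed.
Lemma adjoin_subfield K x : subfield K -> subfield (adjoin K x).
Proof.
move=> hK; have [hK1 hK2] := hK; split; first split.
- by apply: adjoinK => //; exact: sub1.
- move=> _ _ [U [V [hU hV V0 ->]]] [U' [V' [hU' hV' V0' ->]]].
  exists (U * V' - U' * V), (V * V'); split; try by do ?[apply: polyinB|apply: polyinM].
    by rewrite hornerM mulf_neq0.
  by rewrite !hornerE; field; rewrite V0' V0.
- move=> _ _ [U [V [hU hV V0 ->]]] [U' [V' [hU' hV' V0' ->]]].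
  exists (U * U'), (V * V'); split; try by do ?[apply: polyinB|apply: polyinM].
    by rewrite hornerM mulf_neq0.
  by rewrite !hornerM mulf_div.
move=> _ [U [V [hU hV V0 ->]]]; have [U0|U0] := eqVneq U.[x] 0.
  by rewrite U0 mul0r invr0; apply: adjoinK => //; exact: sub0.
by exists V, U; split => //; rewrite invf_div.
Qed.

(** [T A] consists of the fractions in [x] over [A] with monic denominator. Monic denominators keep
    [1/p] out, and a general fraction is reached by making the two leading coefficients and the
    remaining ones invertible in [A]. *)
Lemma spec_transc K x : subfield K -> (forall U, polyin K U -> U.[x] = 0 -> U = 0) ->
  specializable K -> specializable (adjoin K x).
Proof.
move=> hK tr; have [hK1 hK2] := hK.
pose T A y := exists U V, [/\ polyin A U, polyin A V, V \is monic & y = U.[x] / V.[x]].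
have mon0 A V : (forall x, A x -> K x) -> polyin A V -> V \is monic -> V.[x] != 0.
  move=> AK hV mV; apply: contraNneq (monic_neq0 mV) => V0; apply/eqP; apply: tr => // i.
  exact: AK.
apply: (@spec_step K _ T [::]) => //.
- move=> A hA AK _; split; first split.
  + by exists 1, 1; split; rewrite ?hornerC ?divr1 ?monic1 //; exact: polyin1.
  + move=> _ _ [U [V [hU hV mV ->]]] [U' [V' [hU' hV' mV' ->]]].
    exists (U * V' - U' * V), (V * V'); split; try by do ?[apply: polyinB|apply: polyinM].
      by rewrite monicMl.
    have V0 := mon0 A V AK hV mV; have V0' := mon0 A V' AK hV' mV'.
    by rewrite !hornerE; field; rewrite V0' V0.
  + move=> _ _ [U [V [hU hV V0 ->]]] [U' [V' [hU' hV' V0' ->]]].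
    exists (U * U'), (V * V'); split; try by do ?[apply: polyinB|apply: polyinM].
      by rewrite monicMl.
    by rewrite !hornerM mulf_div.
  + move=> _ [U [V [hU hV mV ->]]]; exists U, V; split => //.
    * by move=> i; apply: AK.
    * by move=> i; apply: AK.
    * exact: mon0 AK hV mV.
  move=> p pp [U [V [hU hV mV E]]].
  have V0 := mon0 A V AK hV mV; have p0 : p%:R != 0 :> F by rewrite pnatr_eq0 -lt0n prime_gt0.
  (* If [1/p = U(x)/V(x)], then [V = p U]; comparing leading coefficients exhibits [1/p] as a
     coefficient of [U]. *)
  have VE : V - p%:R *: U = 0.
    apply: tr; first by move=> i; apply: AK; apply: polyinB => //; apply: polyinZ => //; exact: subn.
    rewrite !hornerE; apply/eqP; rewrite subr_eq0.
    by rewrite -[U.[x]](divfK V0) -E mulrA divff // mul1r.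
  move/eqP: VE; rewrite subr_eq0 => /eqP VE.
  have := monicP mV; rewrite lead_coefE {1}VE coefZ => pU.
  by have -> : p%:R^-1 = U`_(size V).-1 by apply: (mulfI p0); rewrite divff // pU.
move=> g [U [V [hU hV V0 gE]]] g0.
have U0 : U.[x] != 0 by apply: contraNneq g0 => U0; rewrite gE U0 mul0r.
have nU : U != 0 by apply: contraNneq U0 => ->; rewrite horner0.
have nV : V != 0 by apply: contraNneq V0 => ->; rewrite horner0.
pose u := lead_coef U; pose v := lead_coef V.
have u0 : u != 0 by rewrite lead_coef_eq0.
have v0 : v != 0 by rewrite lead_coef_eq0.
pose U1 := u^-1 *: U; pose V1 := v^-1 *: V.
have mU1 : U1 \is monic by apply/monicP; rewrite lead_coefZ mulVf.
have mV1 : V1 \is monic by apply/monicP; rewrite lead_coefZ mulVf.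
have hu : K u by exact: hU.
have hv : K v by exact: hV.
exists ([:: u / v] ++ nzcoefs U1 ++ nzcoefs V1); split.
- apply: nz_cat; last by apply: nz_cat; exact: nz_nzcoefs.
  by move=> h; rewrite inE => /eqP->; rewrite mulf_neq0 ?invr_neq0.
- move=> h; rewrite !mem_cat inE => /or3P[/eqP->|/nzcoefsK h1|/nzcoefsK h1].
  + by apply: subM => //; apply: hK2.
  + by apply: h1; apply: polyinZ => //; apply: hK2.
  + by apply: h1; apply: polyinZ => //; apply: hK2.
move=> A hA AK /unitsin_cat[/unitsin1[uv vu] /unitsin_cat[/(polyin_nzcoefs hA) hU1 /(polyin_nzcoefs hA) hV1]].
split; [exists ((u / v) *: U1), V1|exists ((u / v)^-1 *: V1), U1]; split => //; try exact: polyinZ.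
  by rewrite gE /U1 /V1 !hornerZ; field; rewrite ?u0 ?v0 ?U0 ?V0.
by rewrite gE /U1 /V1 !hornerZ; field; rewrite ?u0 ?v0 ?U0 ?V0.
Qed.

(** Once the coefficients of the minimal polynomial [mu] are in [A], the ring [A[x]] is free over
    [A] on the powers of [x] below the degree of [mu]; so [1/p] in [A[x]] would already lie in
    [A]. *)
Lemma spec_alg K x U0 : subfield K -> polyin K U0 -> U0.[x] = 0 -> U0 != 0 ->
  specializable K -> specializable (adjoin K x).
Proof.
move=> hK; have [hK1 hK2] := hK => hU0 U0x nU0.
have [mu [mmu hmu mux mumin]] : exists mu, [/\ mu \is monic, polyin K mu, mu.[x] = 0 &
    forall U, polyin K U -> U.[x] = 0 -> (size U < size mu)%N -> U = 0].
  have H : exists n, `[< exists U, [/\ polyin K U, U.[x] = 0, U != 0 & size U = n] >].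
    by exists (size U0); apply/asboolP; exists U0.
  case: (ex_minnP H) => n /asboolP[U [hU Ux nU sU]] hmin.
  have l0 : lead_coef U != 0 by rewrite lead_coef_eq0.
  exists ((lead_coef U)^-1 *: U); split.
  - by apply/monicP; rewrite lead_coefZ mulVf.
  - by apply: polyinZ => //; apply: hK2; exact: hU.
  - by rewrite hornerZ Ux mulr0.
  move=> W hW Wx; rewrite size_scale ?invr_neq0 // sU => sW; apply/eqP; apply: contraTT sW => nW.
  by rewrite -leqNgt; apply: hmin; apply/asboolP; exists W.
have smu : (1 < size mu)%N.
  rewrite ltnNge; apply/negP => /size1_polyC E; move: mux; rewrite E hornerC => c0.
  by move: (monic_neq0 mmu); rewrite E c0 polyC0 eqxx.
(* [K[x]] is a field, by the Euclidean algorithm: a large [V] is reduced modulo [mu], and [mu] is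
   reduced modulo a small [V]. *)
have inv V : polyin K V -> V.[x] != 0 -> exists2 W, polyin K W & W.[x] * V.[x] = 1.
  move: {2}(size V) (leqnn (size V)) => n; elim: n V => [|n IH] V sV hV V0.
    by move: V0; move: sV; rewrite leqn0 size_poly_eq0 => /eqP->; rewrite horner0 eqxx.
  have nV : V != 0 by apply: contraNneq V0 => ->; rewrite horner0.
  have l0 : lead_coef V != 0 by rewrite lead_coef_eq0.
  have [/size1_polyC VC|sV1] := leqP (size V) 1.
    exists (V`_0)^-1%:P; first by apply: polyinC => //; apply: hK2.
    by move: V0; rewrite VC !hornerC coefC /= => V0; rewrite mulVf.
  have [sm|sm] := leqP (size mu) (size V).
    have [q [r [hq hr E sr]]] := div_monic hK1 mmu hmu hV.
    have Vr : V.[x] = r.[x] by rewrite E !hornerE mux mulr0 add0r.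
    have [W hW WE] : exists2 W, polyin K W & W.[x] * r.[x] = 1.
      by apply: IH; rewrite -?Vr // -ltnS; apply: leq_trans sr (leq_trans sm sV).
    by exists W; rewrite // Vr.
  pose V1 := (lead_coef V)^-1 *: V.
  have hl : K (lead_coef V)^-1 by apply: hK2; exact: hV.
  have mV1 : V1 \is monic by apply/monicP; rewrite lead_coefZ mulVf.
  have hV1 : polyin K V1 by exact: polyinZ.
  have sV1E : size V1 = size V by rewrite size_scale ?invr_neq0.
  have [q [r [hq hr E sr]]] := div_monic hK1 mV1 hV1 hmu.
  rewrite sV1E in sr.
  have rx : r.[x] = - (q.[x] * V1.[x]).
    by apply/eqP; rewrite -subr_eq0 opprK addrC; move: mux; rewrite E !hornerE => ->.
  have r0 : r.[x] != 0.
    apply/eqP => r0; have rr : r = 0 by apply: mumin => //; apply: ltn_trans sr sm.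
    have nq : q != 0.
      by apply: contraTneq (monic_neq0 mmu) => q0; rewrite E rr q0 mul0r addr0 eqxx.
    case/eqP: nq; apply: mumin => //.
      move: rx; rewrite r0 => /esym/eqP; rewrite oppr_eq0 mulf_eq0 hornerZ mulf_eq0 invr_eq0.
      by rewrite (negPf l0) (negPf V0) !orbF => /eqP.
    rewrite E rr addr0 size_Mmonic ?sV1E //; last first.
      by apply: contraTneq (monic_neq0 mmu) => q0; rewrite E rr q0 mul0r addr0 eqxx.
    by lia.
  have [W hW WE] : exists2 W, polyin K W & W.[x] * r.[x] = 1.
    by apply: IH => //; rewrite -ltnS; apply: leq_trans sr sV.
  exists (- ((lead_coef V)^-1 *: (W * q))).
    by rewrite -[- _]add0r; apply: polyinB => //; [exact: polyin0|apply: polyinZ => //; apply: polyinM].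
  by rewrite -WE rx hornerN !hornerZ hornerM; ring.
pose T A y := exists2 U, polyin A U & y = U.[x].
apply: (@spec_step K _ T (nzcoefs mu)) => //; first exact: nz_nzcoefs.
- exact: nzcoefsK.
- move=> A hA AK /(polyin_nzcoefs hA) hmuA; split; first split.
  + by exists 1; rewrite ?hornerC //; exact: polyin1.
  + by move=> _ _ [U hU ->] [U' hU' ->]; exists (U - U'); rewrite ?hornerD ?hornerN //; exact: polyinB.
  + by move=> _ _ [U hU ->] [U' hU' ->]; exists (U * U'); rewrite ?hornerM //; exact: polyinM.
  + move=> _ [U hU ->]; exists U, 1; split; rewrite ?hornerC ?divr1 ?oner_eq0 //; last exact: polyin1.
    by move=> i; apply: AK.
  move=> p pp [U hU E].
  have [q [r [hq hr UE sr]]] := div_monic hA mmu hmuA hU.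
  have p0 : p%:R != 0 :> F by rewrite pnatr_eq0 -lt0n prime_gt0.
  (* It vanishes at [x] and is shorter than [mu]; its constant coefficient then gives [1/p] in
     [A]. *)
  have : p%:R *: r - 1 = 0.
    apply: mumin.
    - by move=> i; apply: AK; apply: polyinB; [|apply: polyinZ => //; exact: subn|exact: polyin1].
    - have rE : r.[x] = p%:R^-1 by rewrite E UE hornerD hornerM mux mulr0 add0r.
      by rewrite hornerD hornerN hornerZ hornerC rE divff ?subrr.
    rewrite (leq_ltn_trans (size_polyD _ _)) // size_polyN size_polyC gtn_max.
    rewrite (leq_ltn_trans (size_scale_leq _ _)) //=; apply: leq_ltn_trans smu.
    by case: (1 != 0).
  move/(congr1 (fun p : {poly F} => p`_0)); rewrite coefB coefZ coef1 coef0 => /eqP; rewrite subr_eq0 => /eqP cpart.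
  by have -> : p%:R^-1 = r`_0 by apply: (mulfI p0); rewrite divff // cpart.
have repr y : adjoin K x y -> exists2 U, polyin K U & y = U.[x].
  move=> [U [V [hU hV V0 ->]]]; have [W hW WE] := inv V hV V0.
  exists (U * W); first exact: polyinM.
  by rewrite hornerM; congr (_ * _); rewrite -[W.[x]](mulfK V0) WE div1r.
move=> g Kg g0.
have [U hU UE] := repr g Kg.
have [|W hW WE] := repr g^-1; first by apply: (adjoin_subfield x hK).2.
exists (nzcoefs U ++ nzcoefs W); split.
- by apply: nz_cat; exact: nz_nzcoefs.
- by move=> h; rewrite mem_cat => /orP[] /nzcoefsK; apply.
move=> A hA AK /unitsin_cat[/(polyin_nzcoefs hA) h1 /(polyin_nzcoefs hA) h2].
by split; [exists U|exists W].
Qed.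

Lemma spec_adjoin K x : subfield K -> specializable K -> specializable (adjoin K x).
Proof.
move=> hK sK; have [H|H] := pselect (exists U, [/\ polyin K U, U.[x] = 0 & U != 0]).
  by case: H => U [h1 h2 h3]; apply: spec_alg h2 h3 sK.
apply: spec_transc => // U hU Ux; apply/eqP; apply: contrapT => /negP nU.
by apply: H; exists U.
Qed.

(** The field is built by adjoining the elements of [Gs] to the rationals one at a time. *)
Lemma spec (Gs : seq F) : nz Gs -> exists B, forall p, prime p -> (B < p)%N -> exists A,
  [/\ subring A, unitsin A Gs, forall j, ~~ (p %| j)%N -> A j%:R^-1 & ~ A p%:R^-1].
Proof.
move=> nG.
have [K [hK sK GK]] : exists K, [/\ subfield K, specializable K & forall g, g \in Gs -> K g].
  elim: Gs {nG} => [|g Gs [K [hK sK GK]]].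
    by exists ratin; split => //; [exact: ratin_subfield|exact: spec_rat].
  exists (adjoin K g); split; [exact: adjoin_subfield|exact: spec_adjoin|].
  move=> h; rewrite inE => /orP[/eqP->|/GK]; [exact: adjoinx|exact: adjoinK].
have [B HB] := sK Gs nG GK; exists B => p pp Bp.
have [A [hA AK u nA]] := HB p pp Bp.
(* Localizing [A] at the integers prime to [p] supplies the inverses [1/j]. It does not create
   [1/p]: from [N/p] in [A] and the Bezout relation [a N = b p + 1] one would get
   [1/p = a (N/p) - b] in [A]. *)
exists (fun x => exists2 N, ~~ (p %| N)%N & A (N%:R * x)); split.
- split.
  + by exists 1%N; rewrite ?Euclid_dvd1 // mulr1; exact: sub1.
  + move=> x y [N pN hx] [M pM hy]; exists (N * M)%N; first by rewrite Euclid_dvdM // negb_or pN.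
    have -> : (N * M)%:R * (x - y) = M%:R * (N%:R * x) - N%:R * (M%:R * y) by rewrite natrM; ring.
    by apply: subB => //; apply: subM => //; exact: subn.
  + move=> x y [N pN hx] [M pM hy]; exists (N * M)%N; first by rewrite Euclid_dvdM // negb_or pN.
    have -> : (N * M)%:R * (x * y) = (N%:R * x) * (M%:R * y) by rewrite natrM; ring.
    exact: subM.
- by move=> g /u[h1 h2]; split; exists 1%N; rewrite ?Euclid_dvd1 // mul1r.
- move=> j pj; exists j => //; rewrite divff; first exact: sub1.
  by rewrite pnatr_eq0; apply: contraNneq pj => ->; rewrite dvdn0.
case=> N pN hN; apply: nA.
have cNp : coprime N p by rewrite coprime_sym prime_coprime.
have [|a b E _] := @egcdnP N p; first by rewrite lt0n; apply: contraNneq pN => ->; rewrite dvdn0.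
have p0 : p%:R != 0 :> F by rewrite pnatr_eq0 -lt0n prime_gt0.
move/eqP: cNp => cNp; rewrite cNp in E.
move/(congr1 (fun k => k%:R : F)): E; rewrite natrD !natrM => E.
have -> : p%:R^-1 = a%:R * (N%:R / p%:R) - b%:R :> F.
  by rewrite mulrA E mulrDl mulfK // mul1r addrC addKr.
by apply: subB => //; [apply: subM => //|]; exact: subn.
Qed.
End Subrings.

(** * Series with coefficients in a finitely generated ring *)

(** [z f'/f]: the Euler derivation leaves exponents in place, as the congruence between exponents
    [j] and [p j] requires. *)
Definition logd (R : comNzRingType) (f : ps R) := psT f * f^-1.

Section Logd.
Variable R : comNzRingType.
Implicit Types f g : ps R.
Lemma logd0 f : pc (logd f) 0 = 0.
Proof. by rewrite pc0M pcT mulr0n mul0r. Qed.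
Lemma logdM f g : f \is a GRing.unit -> g \is a GRing.unit -> logd (f * g) = logd f + logd g.
Proof.
move=> fu gu; rewrite /logd psTM invrM // mulrDl; congr (_ + _).
  by rewrite mulrA -[_ * g * _]mulrA divrr // mulr1.
by rewrite [g^-1 * _]mulrC mulrA [f * _]mulrC -[_ * f * _]mulrA divrr // mulr1.
Qed.
Lemma logdV f : f \is a GRing.unit -> logd f^-1 = - logd f.
Proof.
by move=> fu; rewrite /logd psTV // invrK mulNr divrK.
Qed.
Lemma eqm_logd k f g : pc f 0 = 1 -> pc g 0 = 1 -> eqm k f g -> eqm k (logd f) (logd g).
Proof. by move=> f0 g0 h; apply: eqmM; [exact: eqmT|exact: eqmV]. Qed.
End Logd.

Section OverSubring.
Variable F : numFieldType.
Implicit Types (f g : ps F) (A : F -> Prop).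
Definition over A f := forall n, A (pc f n).

Section Closure.
Variables (A : F -> Prop) (hA : subring A).
Lemma overC c : A c -> over A (psC c).
Proof. by move=> h n; rewrite pc_C; case: ifP => // _; exact: sub0. Qed.
Lemma over1 : over A 1.
Proof. by move=> n; rewrite pc1; exact: subn. Qed.
Lemma overX : over A psX.
Proof. by move=> n; rewrite pc_X; exact: subn. Qed.
Lemma overD f g : over A f -> over A g -> over A (f + g).
Proof. by move=> h1 h2 n; rewrite pcD; apply: subD. Qed.
Lemma overB f g : over A f -> over A g -> over A (f - g).
Proof. by move=> h1 h2 n; rewrite pcB; apply: subB. Qed.
Lemma overM f g : over A f -> over A g -> over A (f * g).
Proof. by move=> h1 h2 n; rewrite pcM; apply: sub_sum => // i _; apply: subM. Qed.
Lemma overE f k : over A f -> over A (f ^+ k).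
Proof. by move=> h; elim: k => [|k IH]; rewrite ?exprS; [exact: over1|exact: overM]. Qed.
Lemma overT f : over A f -> over A (psT f).
Proof. by move=> h n; rewrite pcT; apply: subMn. Qed.
Lemma over_sum I (r : seq I) (P : pred I) (E : I -> ps F) :
  (forall i, P i -> over A (E i)) -> over A (\sum_(i <- r | P i) E i).
Proof. by move=> h n; rewrite pc_sum; apply: sub_sum => // i /h. Qed.
Lemma overV f : pc f 0 = 1 -> over A f -> over A f^-1.
Proof.
move=> f0 hf n; elim/ltn_ind: n => n IH.
have := divrr (ps_unit1 f0) => /(congr1 (fun f => pc f n)).
rewrite pcM big_ord_recl f0 mul1r subn0 => E.
have -> : pc f^-1 n = pc 1 n - \sum_(i < n) pc f (lift ord0 i) * pc f^-1 (n - lift ord0 i).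
  by rewrite -E addrK.
apply: subB => //; first exact: over1.
apply: sub_sum => // i _; apply: subM => //; apply: IH.
by rewrite lift0 /=; have := ltn_ord i; lia.
Qed.
Lemma over_logd f : pc f 0 = 1 -> over A f -> over A (logd f).
Proof. by move=> f0 h; apply: overM; [exact: overT|exact: overV]. Qed.

Variables (p : nat) (pp : prime p).
(** Membership in the ideal [pA], written through the inverse that [p] has in [F]. *)
Definition pmul x := A (p%:R^-1 * x).
Let p0 : p%:R != 0 :> F.
Proof. by rewrite pnatr_eq0 -lt0n prime_gt0. Qed.
Lemma pmulD x y : pmul x -> pmul y -> pmul (x + y).
Proof. by rewrite /pmul mulrDr; exact: subD. Qed.
Lemma pmulB x y : pmul x -> pmul y -> pmul (x - y).
Proof. by rewrite /pmul mulrBr; exact: subB. Qed.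
Lemma pmulN x : pmul x -> pmul (- x).
Proof. by rewrite /pmul mulrN; exact: subN. Qed.
Lemma pmulMl x y : A x -> pmul y -> pmul (x * y).
Proof. by rewrite /pmul mulrCA; exact: subM. Qed.
Lemma pmul0 : pmul 0.
Proof. by rewrite /pmul mulr0; exact: sub0. Qed.
Lemma pmulp x : A x -> pmul (p%:R * x).
Proof. by rewrite /pmul mulKf. Qed.
Lemma pmuln k x : (p %| k)%N -> A x -> pmul (x *+ k).
Proof.
move=> /dvdnP[l ->] hx; rewrite mulrnA -mulr_natl; apply: pmulp; exact: subMn.
Qed.
Lemma pmul_sum I (r : seq I) (P : pred I) (E : I -> F) :
  (forall i, P i -> pmul (E i)) -> pmul (\sum_(i <- r | P i) E i).
Proof. by move=> h; elim/big_rec: _ => [|i y hi hy]; [exact: pmul0|apply: pmulD => //; apply: h]. Qed.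
Lemma freshman x y : A x -> A y -> pmul ((x + y) ^+ p - (x ^+ p + y ^+ p)).
Proof.
move=> hx hy; have E q : (x + y) ^+ q.+1 - (x ^+ q.+1 + y ^+ q.+1) =
    \sum_(i < q) x ^+ (q.+1 - i.+1) * y ^+ i.+1 *+ 'C(q.+1, i.+1).
  rewrite exprDn big_ord_recl big_ord_recr /= subn0 expr0 mulr1 bin0 mulr1n.
  rewrite /bump /= add1n subnn expr0 mul1r binn mulr1n.
  by set S := \sum_(_ < _) _; rewrite (_ : _ - _ = S) //; ring.
rewrite -{1 2 3}(prednK (prime_gt0 pp)) E.
apply: pmul_sum => i _; apply: pmuln; last by apply: subM => //; apply: subX.
by rewrite prednK ?prime_gt0 // prime_dvd_bin //= -[X in (_ < X)%N](prednK (prime_gt0 pp)) ltnS ltn_ord.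
Qed.
Lemma fermat k : pmul (k%:R ^+ p - k%:R).
Proof.
elim: k => [|k IH]; first by rewrite expr0n gtn_eqF ?prime_gt0 // subrr; exact: pmul0.
have := pmulD (freshman (subn hA k) (sub1 hA)) IH.
by rewrite expr1n -natr1; congr pmul; ring.
Qed.
(** Deduced from [freshman] at [x + (- x) = 0], which treats [p = 2] like the odd primes. *)
Lemma frobN x : A x -> pmul ((- x) ^+ p + x ^+ p).
Proof.
move=> hx; have := pmulN (freshman hx (subN hA hx)).
by rewrite subrr expr0n gtn_eqF ?prime_gt0 // sub0r opprK addrC.
Qed.

Definition frob_congr f := forall j, pmul (pc f (p * j) - pc f j ^+ p).
Lemma frob_congrD f g : over A f -> over A g -> frob_congr f -> frob_congr g -> frob_congr (f + g).
Proof.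
move=> hf hg ff fg j; have := pmulB (pmulD (ff j) (fg j)) (freshman (hf j) (hg j)).
by rewrite !pcD; congr pmul; ring.
Qed.

(** The logarithmic derivative is [- k (c X^k + c^2 X^(2k) + ...)]. At multiples of [k] the
    congruence is Fermat's for the integer [k]; if [k] divides [p j] but not [j], then [p] divides
    [k]. *)
Lemma frob_binomial c k : (0 < k)%N -> A c -> frob_congr (logd (1 - psC c * psX ^+ k)).
Proof.
move=> k0 hc; set f := 1 - _.
pose S : ps F := PS (fun j => if (k %| j)%N && (0 < j)%N then - (c ^+ (j %/ k) *+ k) else 0).
have f0 : pc f 0 = 1.
  by rewrite pcB pc1 pcCM pc_Xn (ltn_eqF k0) mulr0 subr0.
have -> : logd f = S.
  have fu := ps_unit1 f0.
  apply: (mulIr fu); rewrite /logd divrK // /f raddfB /= psT1 sub0r psTM psTC mul0r add0r psTXn.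
  apply: psP => j; rewrite mulrBr mulr1 pcN pcB [S * _]mulrC pcCM pcMn pc_Xn -mulrA pcCM pcXnM /=.
  have [kj|kj] := leqP k j; last first.
    rewrite mulr0 subr0 (ltn_eqF kj) mul0rn mulr0 oppr0; case: ifP => // /andP[/dvdn_leq] h1 /h1.
    by rewrite leqNgt kj.
  rewrite -{2}(subnK kj) dvdn_addl // [(0 < j)%N](leq_trans k0 kj) andbT.
  have [->|nj] := eqVneq j k; first by rewrite subnn dvdn0 /= mulr0 subr0 divnn k0 expr1 mulrnAr mulr1.
  have kj' : (k < j)%N by rewrite ltn_neqAle eq_sym nj.
  rewrite subn_gt0 kj' andbT mul0rn mulr0 oppr0; case: ifP => dk; last by rewrite mulr0 subrr.
  rewrite mulrN opprK -{1}(subnK kj) divnDr // divnn k0 addn1 exprS.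
  by rewrite mulrnAr addNr.
move=> j /=; have p1 : (0 < p)%N by exact: prime_gt0.
have [->|j0] := posnP j; first by rewrite muln0 !dvdn0 /= expr0n (gtn_eqF p1) subr0; exact: pmul0.
rewrite muln_gt0 p1 j0 !andbT; case: (boolP (k %| j)%N) => kj; last first.
  rewrite expr0n (gtn_eqF p1) subr0; case: ifP => kpj; last exact: pmul0.
  apply: pmulN; apply: pmuln; last exact: subX.
  apply: contraNT kj => npk; rewrite -(@Gauss_dvdr k p) //.
  by rewrite coprime_sym prime_coprime.
rewrite dvdn_mull // -muln_divA //; set x := c ^+ (j %/ k).
have hx : A x by exact: subX.
have -> : - (c ^+ (p * (j %/ k)) *+ k) - (- (x *+ k)) ^+ p =
    x ^+ p * (k%:R ^+ p - k%:R) - ((- (x *+ k)) ^+ p + (x *+ k) ^+ p).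
  rewrite mulnC exprM -/x -mulr_natl; set z := (- _) ^+ p; rewrite -(mulr_natl x) exprMn.
  by set u := x ^+ p; set v := _ ^+ p; ring.
apply: pmulB; last by apply: frobN; exact: subMn.
by apply: pmulMl; [exact: subX|exact: fermat].
Qed.

(* Frobenius congruence for a logarithmic derivative: it is additive, and every
   series with constant term 1 is, to any order, a product of binomials. *)
Lemma frob_logd f : pc f 0 = 1 -> over A f -> frob_congr (logd f).
Proof.
move=> f0 hf j.
have H N : exists g, [/\ pc g 0 = 1, over A g, eqm N.+1 f g & frob_congr (logd g)].
  elim: N => [|N [g [g0 hg fg frg]]].
    exists 1; split; [by rewrite pc1|exact: over1|by move=> [|i] //; rewrite f0 pc1|].
    have -> : logd 1 = 0 :> ps F by rewrite /logd psT1 mul0r.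
    by move=> i; rewrite !pc0 expr0n gtn_eqF ?prime_gt0 // subr0; exact: pmul0.
  (* Multiplication by [b] subtracts [c] from the coefficient of [g] at [N.+1] and leaves the lower
     ones unchanged. *)
  pose c := pc g N.+1 - pc f N.+1; pose b := 1 - psC c * psX ^+ N.+1.
  have hc : A c by apply: subB.
  have b0 : pc b 0 = 1 by rewrite pcB pc1 pcCM pc_Xn mulr0 subr0.
  have hb : over A b.
    by apply: overB; [exact: over1|apply: overM; [exact: overC|exact: overE overX]].
  exists (g * b); split.
  - by rewrite pc0M g0 b0 mulr1.
  - exact: overM.
  - move=> i; rewrite ltnS leq_eqVlt mulrBr mulr1 pcB mulrCA pcCM [g * _]mulrC pcXnM.
    move=> /orP[/eqP->|hi]; first by rewrite leqnn subnn g0 mulr1 /c opprB addrC subrK.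
    by rewrite leqNgt hi mulr0 subr0 fg.
  rewrite logdM ?ps_unit1 //; apply: frob_congrD => //; try exact: over_logd.
  exact: frob_binomial.
have [g [g0 hg fg frg]] := H (p * j)%N.
have E := eqm_logd f0 g0 fg.
rewrite !E //; first by rewrite ltnS leq_pmull // prime_gt0.
Qed.
End Closure.

(* All coefficients lie in one ring generated by finitely many nonzero elements
   and their inverses. *)
Definition bdd f := exists Gs, nz Gs /\ forall A, subring A -> unitsin A Gs -> over A f.

Lemma bdd_fin f k : (forall j, (k <= j)%N -> pc f j = 0) -> bdd f.
Proof.
move=> H; exists (nzcoefs (\poly_(i < k) pc f i)); split; first exact: nz_nzcoefs.
move=> A hA /(polyin_nzcoefs hA) h n; have := h n; rewrite coef_poly; case: ltnP => // hn _.
by rewrite H //; exact: sub0.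
Qed.
Lemma bdd2 (op : ps F -> ps F -> ps F) f g :
  (forall A, subring A -> over A f -> over A g -> over A (op f g)) -> bdd f -> bdd g -> bdd (op f g).
Proof.
move=> H [Gs [nG hG]] [Hs [nH hH]]; exists (Gs ++ Hs); split; first exact: nz_cat.
by move=> A hA /unitsin_cat[h1 h2]; apply: H => //; [apply: hG|apply: hH].
Qed.
Lemma bddD f g : bdd f -> bdd g -> bdd (f + g).
Proof. by apply: (bdd2 (op := fun f g => f + g)) => A hA; exact: overD. Qed.
Lemma bddB f g : bdd f -> bdd g -> bdd (f - g).
Proof. by apply: (bdd2 (op := fun f g => f - g)) => A hA; exact: overB. Qed.
Lemma bddM f g : bdd f -> bdd g -> bdd (f * g).
Proof. by apply: (bdd2 (op := fun f g => f * g)) => A hA; exact: overM. Qed.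
Lemma bdd_le f g : (forall A, subring A -> over A f -> over A g) -> bdd f -> bdd g.
Proof. by move=> H [Gs [nG hG]]; exists Gs; split => // A hA /(hG A hA); exact: H. Qed.
Lemma bddT f : bdd f -> bdd (psT f).
Proof. by apply: bdd_le => A hA; exact: overT. Qed.
Lemma bddV f : pc f 0 = 1 -> bdd f -> bdd f^-1.
Proof. by move=> f0; apply: bdd_le => A hA; exact: overV. Qed.
Lemma bdd1 : bdd 1.
Proof. by exists [::]; split=> // A hA _; exact: over1. Qed.
Lemma bdd0 : bdd 0.
Proof. by exists [::]; split=> // A hA _ n; exact: sub0. Qed.
Lemma bddX : bdd psX.
Proof. by exists [::]; split=> // A hA _; exact: overX. Qed.
Lemma bddC c : bdd (psC c).
Proof. by apply: (@bdd_fin _ 1%N) => -[|j]. Qed.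
Lemma bddE f k : bdd f -> bdd (f ^+ k).
Proof. by apply: bdd_le => A hA; exact: overE. Qed.
Lemma bdd_sum (I : eqType) (r : seq I) (E : I -> ps F) :
  (forall i, i \in r -> bdd (E i)) -> bdd (\sum_(i <- r) E i).
Proof.
move=> h; rewrite big_seq; elim/big_rec: _ => [|i y hi hy]; [exact: bdd0|apply: bddD => //; exact: h].
Qed.

Section Classes.
Variable n : nat.
Hypothesis n0 : (0 < n)%N.

Definition in_class e f := forall j, pc f j != 0 -> j = e %[mod n].
Definition cpart e f : ps F := PS (fun j => if j == e %[mod n] then pc f j else 0).
Lemma in_class_cpart e f : in_class e (cpart e f).
Proof. by move=> j /=; case: ifP => [/eqP|_]; rewrite ?eqxx. Qed.
Lemma bdd_cpart e f : bdd f -> bdd (cpart e f).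
Proof. by apply: bdd_le => A hA h j /=; case: ifP => // _; exact: sub0. Qed.
Lemma in_classM e1 e2 f g : in_class e1 f -> in_class e2 g -> in_class (e1 + e2) (f * g).
Proof.
move=> hf hg j; rewrite pcM => H.
have [i fi gi] : exists2 i : 'I_j.+1, pc f i != 0 & pc g (j - i) != 0.
  apply: contrapT => h; case/eqP: H; apply: big1 => i _.
  have [->|fi] := eqVneq (pc f i) 0; first by rewrite mul0r.
  have [->|gi] := eqVneq (pc g (j - i)) 0; first by rewrite mulr0.
  by case: h; exists i.
rewrite -[in LHS](@subnKC i j); last by rewrite -ltnS.
by rewrite -modnDm (hf _ fi) (hg _ gi) modnDm.
Qed.
Lemma in_classB e f g : in_class e f -> in_class e g -> in_class e (f - g).
Proof.
move=> hf hg j; rewrite pcB; have [fj|fj _] := eqVneq (pc f j) 0; last exact: hf.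
by rewrite fj sub0r oppr_eq0; exact: hg.
Qed.
Lemma in_classT e f : in_class e f -> in_class e (psT f).
Proof. by move=> h j; rewrite pcT; have [->|fj _] := eqVneq (pc f j) 0; [rewrite mul0rn eqxx|exact: h]. Qed.

(** [W] may have any order: later its lowest nonzero coefficient is put among the elements to be
    inverted. *)
Definition bdd_quotient f := exists W, [/\ W != 0, bdd W & bdd (W * f)].

Variable L : 'I_n -> ps F.
Hypothesis bddTL : forall k, bdd (psT (L k)).

(* Differentiating a relation among the L k (whose derivatives are bdd) and
   eliminating one of them leaves Wronskians as coefficients, which do not
   vanish because the supports lie in different classes mod n. *)
Lemma wronskian_descent (s : seq 'I_n) e (al : 'I_n -> ps F) : uniq s ->
  (forall k, bdd (al k)) -> (forall k : 'I_n, in_class (e + (n - k)) (al k)) ->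
  bdd (\sum_(k <- s) al k * L k) -> forall k, k \in s -> al k != 0 -> bdd_quotient (L k).
Proof.
elim: s e al => [|k0 s IH] e al // /andP[k0s us] bal cal; rewrite big_cons => bs.
have [a0|a0] := eqVneq (al k0) 0.
  move=> k; rewrite inE => /orP[/eqP->|ks]; first by rewrite a0 eqxx.
  by apply: IH ks => //; move: bs; rewrite a0 mul0r add0r.
set T := _ + _ in bs.
pose al' k := al k0 * psT (al k) - al k * psT (al k0).
have bal' k : bdd (al' k) by apply: bddB; apply: bddM => //; exact: bddT.
have cal' (k : 'I_n) : in_class (e + (n - k0) + e + (n - k)) (al' k).
  apply: in_classB; first by rewrite -addnA; apply: in_classM => //; exact: in_classT.
  rewrite -addnA addnC; apply: in_classM => //; exact: in_classT.
have bs' : bdd (\sum_(k <- s) al' k * L k).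
  have -> : \sum_(k <- s) al' k * L k = al k0 * psT T - psT (al k0) * T
      - al k0 * (\sum_(k <- k0 :: s) al k * psT (L k)).
    have -> : psT T = psT (al k0) * L k0 + al k0 * psT (L k0)
        + (\sum_(k <- s) psT (al k) * L k + \sum_(k <- s) al k * psT (L k)).
      rewrite /T raddfD /= psTM raddf_sum /= -big_split /=; congr (_ + _).
      by apply: eq_bigr => k _; rewrite psTM.
    rewrite big_cons; set S1 := \sum_(_ <- _) _ * psT _; set S2 := \sum_(_ <- _) psT _ * _.
    have -> : \sum_(k <- s) al' k * L k = al k0 * S2 - psT (al k0) * \sum_(k <- s) al k * L k.
      by rewrite !mulr_sumr -sumrB; apply: eq_bigr => k _; rewrite /al'; ring.
    by rewrite /T; set S3 := \sum_(_ <- _) _; ring.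
  apply: bddB; first by apply: bddB; apply: bddM => //; exact: bddT.
  by apply: bddM => //; apply: bdd_sum => k _; apply: bddM.
have Hs k : k \in s -> al k != 0 -> bdd_quotient (L k).
  move=> ks ak; apply: (IH _ _ us bal' cal' bs' k ks).
  (* The coefficient of the Wronskian at [d0 + d] is [d - d0] times the product of the two lowest
     coefficients, and [d], [d0] lie in different classes mod [n]. *)
  have [d [ad dl]] := ps_ord ak; have [d0 [ad0 dl0]] := ps_ord a0.
  have kk0 : k != k0 by apply: contraNneq k0s => <-.
  have dd0 : d != d0.
    apply: contraNneq kk0 => dd0; have := cal _ _ ad; rewrite dd0 (cal _ _ ad0) => /eqP.
    rewrite eqn_modDl => /eqP E; apply/eqP/val_inj => /=.
    have : (n - k0 + (k + k0) = n - k + (k + k0) %[mod n])%N by rewrite -modnDml E modnDml.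
    have -> : (n - k0 + (k + k0) = n + k)%N by have := ltn_ord k0; lia.
    have -> : (n - k + (k + k0) = n + k0)%N by have := ltn_ord k; lia.
    by rewrite !modnDl !modn_small.
  apply/eqP => /(congr1 (fun f => pc f (d0 + d)%N)); rewrite pc0 pcB pcM_low //; last first.
    by move=> i /dl; rewrite pcT => ->; rewrite mul0rn.
  rewrite addnC pcM_low //; last by move=> i /dl0; rewrite pcT => ->; rewrite mul0rn.
  rewrite !pcT !mulrnAr [_ * pc (al k0) _]mulrC => /eqP; rewrite subr_eq0 => /eqP.
  have : pc (al k0) d0 * pc (al k) d != 0 by rewrite mulf_neq0.
  rewrite -!(mulr_natr (_ * _)) => nz /(mulfI nz) /eqP; rewrite eqr_nat.
  by rewrite (negPf dd0).
move=> k; rewrite inE => /orP[/eqP->|]; last exact: Hs.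
move=> _.
(* A common denominator for the other terms, so that the relation can be solved for [L k0]. *)
have [W [W0 bW bWs]] : exists W, [/\ W != 0, bdd W & bdd (W * \sum_(k <- s) al k * L k)].
  elim: (s) Hs => [|k1 s1 IHs] Hs.
    by exists 1; rewrite oner_neq0 big_nil mulr0; split=> //; [exact: bdd1|exact: bdd0].
  have [|W [W0 bW bWs]] := IHs; first by move=> k2 h; apply: Hs; rewrite inE h orbT.
  have [ak1|ak1] := eqVneq (al k1) 0.
    by exists W; rewrite big_cons ak1 mul0r add0r.
  have [|W1 [W10 bW1 bWs1]] := Hs k1 _ ak1; first by rewrite mem_head.
  exists (W * W1); split; [by rewrite mulf_neq0|exact: bddM|].
  rewrite big_cons mulrDr; apply: bddD.
    have -> : W * W1 * (al k1 * L k1) = W * al k1 * (W1 * L k1) by ring.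
    by apply: bddM => //; apply: bddM.
  by rewrite [W * W1]mulrC -mulrA; apply: bddM.
exists (W * al k0); split; [by rewrite mulf_neq0|exact: bddM|].
have -> : W * al k0 * L k0 = W * T - W * \sum_(k <- s) al k * L k by rewrite /T; ring.
by apply: bddB => //; apply: bddM.
Qed.
End Classes.
End OverSubring.

Lemma eq_mod_mull n p a b : coprime n p -> p * a = p * b %[mod n] -> a = b %[mod n].
Proof.
move=> cnp /eqP; wlog ab : a b / (a <= b)%N => [H E|].
  have [ab|/ltnW ba] := leqP a b; first exact: H.
  by apply/esym; apply: H => //; rewrite eq_sym.
rewrite eq_sym eqn_mod_dvd ?leq_mul2l ?ab ?orbT // -mulnBr Gauss_dvdr // -eqn_mod_dvd //.
by rewrite eq_sym => /eqP.
Qed.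

(** * Descent along primes for the parts of a logarithm *)

Section LogSeries.
Variable F : numFieldType.
Variables (n : nat) (n0 : (0 < n)%N) (V : ps F) (V0 : pc V 0 = 1) (bV : bdd V).

(** The series log V; at [j = 0] the convention [0^-1 = 0] gives the constant term 0. *)
Definition logs : ps F := PS (fun j => pc (logd V) j / j%:R).
Lemma pc_logs j : pc logs j = pc (logd V) j / j%:R. Proof. by []. Qed.
Lemma psT_logs : psT logs = logd V.
Proof.
apply: psP => -[|j]; first by rewrite pcT mulr0n logd0.
by rewrite pcT -mulr_natr pc_logs divfK // pnatr_eq0.
Qed.
Lemma logs0 : pc logs 0 = 0. Proof. by rewrite pc_logs invr0 mulr0. Qed.

Lemma pc_cpart k f j : pc (cpart n k f : ps F) j = if j == k %[mod n] then pc f j else 0.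
Proof. by []. Qed.
Notation L k := (cpart n k logs).
Lemma bddT_cpart_logs k : bdd (psT (L k)).
Proof.
have -> : psT (L k) = cpart n k (logd V).
  by rewrite -psT_logs; apply: psP => j; rewrite pcT /=; case: ifP => // _; rewrite mul0rn.
by apply: bdd_cpart; apply: bddM; [exact: bddT|exact: bddV].
Qed.

Lemma cpart_mod k k' (f : ps F) : k = k' %[mod n] -> cpart n k f = cpart n k' f.
Proof. by move=> E; apply: psP => j /=; rewrite E. Qed.

(** Suppose [L k'] starts at the exponent [c], with [g] the coefficient of [logd V] there, and [W]
    at [d]. In the coefficient of [W * L k] at [d + p c], the term from [d] and [p c] is
    [W_d g^p / (p c)] modulo [A], and all others lie in [A]. As [W_d], [g] and [c] are units of [A],
    this puts [1/p] in [A], against the choice of [A]. *)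
Lemma bdd_quotient_descent (k k' : nat) : bdd_quotient (L k) ->
  exists B, forall p, prime p -> (B < p)%N -> p * k' = k %[mod n] -> L k' = 0.
Proof.
move=> [W [W0 [GW [nGW hGW]] [GT [nGT hGT]]]].
have [->|/ps_ord[c [Lc Lmin]]] := eqVneq (L k') 0; first by exists 0%N.
have ck' : c = k' %[mod n] by have := @in_class_cpart _ n k' logs c Lc.
have Lc' : pc (L k') c = pc logs c by rewrite /= ck' eqxx.
have c0 : (0 < c)%N by rewrite lt0n; apply: contraNneq Lc => c0; rewrite Lc' c0 logs0.
have cF : c%:R != 0 :> F by rewrite pnatr_eq0 -lt0n.
pose g := pc (logd V) c.
have g0 : g != 0 by apply: contraNneq Lc; rewrite Lc' pc_logs -/g => ->; rewrite mul0r.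
have [d [Wd Wmin]] := ps_ord W0.
case: bV => GV [nGV hGV].
have [|B HB] := @spec F (GW ++ GT ++ GV ++ [:: pc W d; g]).
  by do 3 (apply: nz_cat => //) ; move=> x; rewrite !inE => /orP[]/eqP->.
(* [p > c] makes [1/c] available in [A]; [p > n] makes [p] prime to [n], so that it can be cancelled
   mod [n]. *)
exists (maxn B (maxn c n)) => p pp; rewrite !gtn_max => /and3P[Bp cp np] pk.
exfalso; have [A [hA /unitsin_cat[uW /unitsin_cat[uT /unitsin_cat[uV u2]]] Ainv]] := HB p pp Bp.
apply.
have [hWd hWd'] : A (pc W d) /\ A (pc W d)^-1 by apply: u2; rewrite !inE eqxx.
have [hg hg'] : A g /\ A g^-1 by apply: u2; rewrite !inE eqxx orbT.
have oW := hGW A hA uW; have oT := hGT A hA uT; have oV := hGV A hA uV.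
have oG := over_logd hA V0 oV.
have p0 : p%:R != 0 :> F by rewrite pnatr_eq0 -lt0n prime_gt0.
have frob := frob_logd hA pp V0 oV.
have Ac : A c%:R^-1 by apply: Ainv; rewrite gtnNdvd.
have [Lk [LkE oTk]] : exists Lk, (forall j, pc Lk j = if j == k %[mod n] then pc (logd V) j / j%:R else 0)
    /\ over A (W * Lk) by exists (L k).
have G0 := logd0 V.
have Lc'0 c' : (c' < c)%N -> c' = k' %[mod n] -> (0 < c')%N -> pc (logd V) c' = 0.
  move=> /Lmin; rewrite pc_cpart pc_logs => + c'k' c'0; rewrite c'k' eqxx => /eqP.
  by rewrite mulf_eq0 invr_eq0 pnatr_eq0 (gtn_eqF c'0) orbF => /eqP.
move: (logd V) @g g0 hg hg' oG frob LkE G0 Lc'0 {HB u2 Lc Lmin Lc' hGV uV oV} => G g g0 hg hg' oG frob LkE G0 Lc'0.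
have E : pmul A p (p%:R * pc (W * Lk) (d + p * c) - pc W d * g ^+ p / c%:R).
  have dJ : (d < (d + p * c).+1)%N by rewrite ltnS leq_addr.
  rewrite pcM (bigD1 (Ordinal dJ)) //= addKn LkE -modnMmr ck' modnMmr pk eqxx mulrDr addrAC.
  apply: pmulD => //.
    have -> : p%:R * (pc W d * (pc G (p * c) / (p * c)%:R)) - pc W d * g ^+ p / c%:R =
        pc W d * c%:R^-1 * (pc G (p * c) - g ^+ p).
      by rewrite natrM; field; rewrite p0 cF.
    by apply: pmulMl => //; apply: subM.
  rewrite mulr_sumr; apply: pmul_sum => // -[i hi] /=; rewrite -val_eqE /= => id.
  have [lid|] := ltnP i d; first by rewrite Wmin // mul0r mulr0; exact: pmul0.
  rewrite leq_eqVlt eq_sym (negPf id) /= => di.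
  have ji : (d + p * c - i < p * c)%N by lia.
  move: (d + p * c - i)%N ji => j jpc; rewrite mulrCA LkE; apply: pmulMl => //.
  case: ifP => [/eqP jk|_]; last by rewrite mulr0; exact: pmul0.
  (* The denominator [j] is harmless unless [j = p c']. Then [c' < c] lies in the class of [k'], so
     the coefficient at [c'] is 0 and the Frobenius congruence makes the one at [p c'] divisible by
     [p]. *)
  have [pj|pj] := boolP (p %| j)%N; last first.
    by apply: pmulp => //; apply: (subM hA (oG j)); apply: Ainv.
  move/dvdnP: pj jpc jk => [c' ->]; rewrite mulnC ltn_mul2l prime_gt0 //= => c'c c'k.
  have [->|c'0] := posnP c'; first by rewrite muln0 G0 mul0r mulr0; exact: pmul0.
  have c'F : c'%:R != 0 :> F by rewrite pnatr_eq0 -lt0n.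
  have -> : p%:R * (pc G (p * c') / (p * c')%:R) = c'%:R^-1 * pc G (p * c').
    by rewrite natrM; field; rewrite p0 c'F.
  apply: pmulMl => //; first by apply: Ainv; rewrite gtnNdvd // (ltn_trans c'c).
  have c'k' : c' = k' %[mod n].
    apply: (@eq_mod_mull n p); last by rewrite c'k pk.
    by rewrite coprime_sym prime_coprime // gtnNdvd.
  by have := frob c'; rewrite (Lc'0 c') // expr0n (gtn_eqF (prime_gt0 pp)) subr0.
have E2 : pmul A p (pc W d * g ^+ p / c%:R).
  have := pmulB hA (pmulp pp (oTk (d + p * c)%N)) E; rewrite opprB addrC subrK //.
have -> : p%:R^-1 = (c%:R * (pc W d)^-1 * g^-1 ^+ p) * (p%:R^-1 * (pc W d * g ^+ p / c%:R)).
  have gp : g ^+ p != 0 by rewrite expf_neq0.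
  rewrite exprVn; field; rewrite gp cF Wd p0 //.
apply: subM => //; apply: subM => //; last exact: subX.
by apply: subM => //; exact: subn.
Qed.

Lemma bdd_quotient_coprime k : bdd_quotient (L k) -> coprime k n -> pc (logd V) 1 = 0.
Proof.
move=> gk kn.
(* One bound for all pairs of classes mod [n], of which there are finitely many. *)
have [B HB] : exists B, forall k k' p, bdd_quotient (L k) -> prime p -> (B < p)%N ->
    p * k' = k %[mod n] -> L k' = 0.
  have H (x : 'I_n * 'I_n) : exists B, forall p, bdd_quotient (L x.1) -> prime p -> (B < p)%N ->
      p * x.2 = x.1 %[mod n] -> L x.2 = 0.
    have [gx|ngx] := pselect (bdd_quotient (L x.1)); last by exists 0%N => p /ngx.
    by have [B HB] := bdd_quotient_descent x.2 gx; exists B => p _; exact: HB.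
  have [b hb] := choice H.
  exists (\max_x b x)%N => k1 k2 p gk1 pp Bp E.
  have h1 := ltn_pmod k1 n0; have h2 := ltn_pmod k2 n0.
  have E2 : L k2 = L (Ordinal h2) by apply: cpart_mod; rewrite /= modn_mod.
  rewrite E2; apply: (hb (Ordinal h1, Ordinal h2) p) => //=.
  - have E1 : L k1 = L (k1 %% n)%N by apply: cpart_mod; rewrite modn_mod.
    by rewrite -E1.
  - by apply: leq_ltn_trans Bp; exact: leq_bigmax.
  - by rewrite modnMmr E modn_mod.
pose k1 := (k + n)%N.
have k1n : coprime k1 n by rewrite /k1 /coprime gcdnC gcdnDr gcdnC.
have k10 : (0 < k1)%N by rewrite addn_gt0 n0 orbT.
(* A prime [q <= B] divides exactly one of [k1] and [n t]: if it divides [k1], it divides neither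
   [n] nor [t]; otherwise it divides [t]. So no such [q] divides [k1 + n t]. *)
pose t := (\prod_(q < B.+1 | prime q && ~~ (q %| k1)) q)%N.
have t0 : (0 < t)%N by rewrite prodn_cond_gt0 // => q /andP[/prime_gt0].
pose N := (k1 + n * t)%N.
have NB q : prime q -> (q %| N)%N -> (B < q)%N.
  move=> pq qN; rewrite ltnNge; apply/negP => qB.
  have qtE : (q %| t)%N = ~~ (q %| k1)%N.
    apply/idP/idP; last first.
      move=> h; rewrite /t (bigD1 (inord q)) /= ?inordK ?ltnS ?pq ?h //; exact: dvdn_mulr.
    rewrite /t Euclid_dvd_prod // big_has_cond => /hasP[r _ /andP[/andP[pr' hr]]].
    by rewrite dvdn_prime2 // => /eqP->.
  have [qk|qk] := boolP (q %| k1)%N.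
    move: qN; rewrite dvdn_addr // Euclid_dvdM // qtE qk orbF => qn.
    have q1 : (q %| 1)%N by rewrite -(eqP k1n) dvdn_gcd qk.
    by move: pq; rewrite (eqP (_ : q == 1%N)) // -dvdn1.
  by move: qN; rewrite dvdn_addl ?(negPf qk) // dvdn_mull // qtE.
(* Each prime factor yields a part equal to 0, which is trivially a quotient again, so the next
   factor can be used. *)
have chain M : (0 < M)%N -> (forall q, prime q -> (q %| M)%N -> (B < q)%N) -> forall k k',
    bdd_quotient (L k) -> M * k' = k %[mod n] -> (1 < M)%N -> L k' = 0.
  elim/ltn_ind: M => M IH M0 HM k2 k3 gk2 E M1.
  have pp := pdiv_prime M1; have /dvdnP[M' ME] := pdiv_dvd M.
  have M'0 : (0 < M')%N by rewrite lt0n; apply: contraTneq M0; rewrite ME => ->.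
  have z : L (M' * k3) = 0.
    apply: (HB k2 _ (pdiv M)) => //; first by apply: HM => //; exact: pdiv_dvd.
    by rewrite mulnA [(_ * M')%N]mulnC -ME.
  have [M'1|M'1] := leqP M' 1.
    by have /eqP M'E : M' == 1%N; [rewrite eqn_leq M'1|move: z; rewrite M'E mul1n].
  apply: (IH M' _ M'0 _ (M' * k3)%N) => //.
  - by rewrite [X in (_ < X)%N]ME ltn_Pmulr // prime_gt1.
  - by move=> q pq qM'; apply: HM => //; rewrite ME dvdn_mulr.
  - by rewrite z; exists 1; rewrite oner_neq0 mulr0; split => //; [exact: bdd1|exact: bdd0].
have L1 : L 1 = 0.
  apply: (chain N _ NB k) => //; rewrite /N; first by rewrite addn_gt0 k10.
  - have -> : ((k1 + n * t) * 1 = t.+1 * n + k)%N by rewrite /k1; lia.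
    by rewrite modnMDl.
  - have : (0 < n * t)%N by rewrite muln_gt0 n0.
    lia.
by move/(congr1 (fun f => pc f 1)): L1; rewrite /= eqxx divr1.
Qed.

(** [n - k] stands for [- k] mod [n]. *)
Lemma cpart_mul m (q l : ps F) :
  cpart n m (q * l) = \sum_(k <- index_enum 'I_n) cpart n (m + (n - k)) q * cpart n k l.
Proof.
apply: psP => j; rewrite pc_sum; under eq_bigr do rewrite pcM.
rewrite exchange_big /=; case: eqP => jm; last first.
  rewrite big1 // => i _; rewrite big1 // => k _; case: eqP => [h1|]; last by rewrite mul0r.
  case: eqP => [h2|]; last by rewrite mulr0.
  case: jm; rewrite -[in LHS](@subnKC i j) ?leq_ord // -modnDm h1 h2 modnDm.
  by rewrite -addnA subnK ?modnDr // ltnW.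
apply: eq_bigr => i _; pose k := Ordinal (ltn_pmod (j - i) n0).
rewrite (bigD1 k) //= modn_mod eqxx big1 ?addr0.
  have -> : i == m + (n - (j - i) %% n) %[mod n].
    have jE : (j = i + (j - i) %% n %[mod n])%N by rewrite modnDmr subnKC ?leq_ord.
    by rewrite -modnDml -jm jE modnDml -addnA subnKC ?modnDr // ltnW // ltn_pmod.
  by [].
move=> k' kk'; case: (_ == _ %[mod n]); last by rewrite mul0r.
rewrite [(k' %% n)%N]modn_small //; case: eqP; last by rewrite mulr0.
by move=> h; case/eqP: kk'; apply: val_inj; rewrite /= h.
Qed.

(* Sorting the vanishing coefficients by classes mod n gives a relation
   between the class components of logs, hence one of them is a bdd_quotient. *)
Lemma coprime_coef_eq0 q m e k : bdd q -> pc (logd V) 1 != 0 ->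
  (forall i, (0 < i)%N -> pc (q * logs) (m + n * i) = 0) ->
  coprime k n -> e + k = m %[mod n] -> pc q e = 0.
Proof.
move=> bq G1 H kn ek; apply/eqP; apply: contraNT G1 => qe; apply/eqP.
apply: (@bdd_quotient_coprime k) => //.
have E := cpart_mul m q logs.
(* By the vanishing hypothesis this part of the product is a polynomial of degree at most [m]; its
   finitely many coefficients need not vanish. *)
have bE : bdd (\sum_(k <- index_enum 'I_n) cpart n (m + (n - k)) q * L k).
  rewrite -E; apply: (@bdd_fin _ _ m.+1) => j mj /=; case: eqP => // jm.
  have /dvdnP[i iE] : (n %| j - m)%N by rewrite -eqn_mod_dvd ?jm // ltnW.
  have -> : j = (m + n * i)%N by rewrite mulnC -iE subnKC // ltnW.
  by apply: H; rewrite lt0n; apply: contraTneq mj => i0; move: iE; rewrite i0; lia.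
pose l := Ordinal (ltn_pmod k n0).
have -> : L k = L l by apply: cpart_mod; rewrite /= modn_mod.
have bL (i : 'I_n) : bdd (psT (L i)) by exact: bddT_cpart_logs.
apply: (@wronskian_descent _ _ n0 (fun k : 'I_n => L k) bL (index_enum 'I_n) m
  (fun k : 'I_n => cpart n (m + (n - k)) q)) => //.
- exact: index_enum_uniq.
- by move=> i; apply: bdd_cpart.
- by move=> i; apply: in_class_cpart.
- exact: mem_index_enum.
apply: contraNneq qe => /(congr1 (fun f => pc f e)) /=.
case: eqP => [_ ->|] //; case; apply/eqP; rewrite -(eqn_modDr (k %% n)) -addnA.
by rewrite subnK 1?ltnW ?ltn_pmod // modnDr modnDmr ek.
Qed.
End LogSeries.

(** * Moments and the branch at infinity *)

Section Hat.
Variable F : fieldType.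
Implicit Types (Y : ps F) (f g : {poly F}).

(* Homogenization: hat Y N f stands for z^N f(Y/z). *)
Definition hat Y N f := \sum_(i < N.+1) psC f`_i * (Y ^+ i * psX ^+ (N - i)).

(** [Y/z] has a pole, so polynomials are evaluated at it in the fraction field of the power
    series. *)
Definition ps_emb : F -> {fraction (ps F)} := @tofrac (ps F) \o @psC F.
HB.instance Definition _ := GRing.RMorphism.copy ps_emb (@tofrac (ps F) \o @psC F).
Definition ev (y : {fraction (ps F)}) : {poly F} -> {fraction (ps F)} :=
  horner_eval y \o map_poly ps_emb.
HB.instance Definition _ y := GRing.RMorphism.copy (ev y) (horner_eval y \o map_poly ps_emb).

Lemma frac_psX_neq0 : tofrac (psX : ps F) != 0.
Proof.
rewrite tofrac_eq0; apply/eqP => /(congr1 (fun h : ps F => pc h 1)) /eqP.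
by rewrite pc_X pc0 oner_eq0.
Qed.

Lemma hat_frac Y K f : (size f <= K.+1)%N ->
  tofrac (hat Y K f) = tofrac psX ^+ K * ev (tofrac Y / tofrac psX) f.
Proof.
move=> sh; rewrite /ev /= /horner_eval (@horner_coef_wide _ K.+1); last first.
  by rewrite (leq_trans _ sh) // size_poly.
rewrite mulr_sumr rmorph_sum; apply: eq_bigr => i _.
rewrite coef_map /= !rmorphM !rmorphXn /= expr_div_n.
have -> : tofrac (psX : ps F) ^+ K = tofrac psX ^+ (K - i) * tofrac psX ^+ i.
  by rewrite -exprD subnK // -ltnS.
rewrite -mulrA [X in _ = _ * X]mulrCA [X in _ = _ * (_ * X)]mulrCA divff ?expf_neq0 ?frac_psX_neq0 // mulr1.
by rewrite mulrA mulrC.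
Qed.

Lemma hatM Y N M f g : (size f <= N.+1)%N -> (size g <= M.+1)%N ->
  hat Y (N + M) (f * g) = hat Y N f * hat Y M g.
Proof.
move=> sf sg; apply/eqP; rewrite -tofrac_eq rmorphM !hat_frac //; last first.
  by apply: leq_trans (size_polyMleq _ _) _; lia.
by apply/eqP; rewrite rmorphM exprD /= !hat_frac //; apply: mulrACA.
Qed.

Lemma hat1 Y : hat Y 0 1 = 1.
Proof. by rewrite /hat big_ord1 coef1 /= !expr0 !mulr1 rmorph1. Qed.

Lemma hatX Y N k f : (size f <= N.+1)%N -> hat Y N f = 1 -> hat Y (N * k) (f ^+ k) = 1.
Proof.
move=> sf h; elim: k => [|k IH]; first by rewrite muln0 expr0 hat1.
rewrite mulnS exprS hatM // ?h ?IH ?mulr1 //.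
apply: leq_trans (size_poly_exp_leq _ _) _; rewrite ltnS leq_mul2r; apply/orP; right; lia.
Qed.

(** The chain rule for z d/dz on [z^(N+1) f(Y/z)]: applied to [Y/z] the derivation gives
    [(psT Y - Y)/z]. *)
Lemma psT_hat Y N f :
  psT (hat Y N.+1 f) = hat Y N.+1 f *+ N.+1 + hat Y N f^`() * (psT Y - Y).
Proof.
rewrite /hat raddf_sum /= -sumrMnl mulr_suml.
rewrite big_ord_recl [X in _ = X + _]big_ord_recl /= !expr0 !mul1r subn0 psTM psTC mul0r add0r psTXn mulrnAr.
rewrite -addrA; congr (_ + _); rewrite -big_split /=; apply: eq_bigr => i _.
rewrite /bump /= add1n subSS psTM psTC mul0r add0r psTM psTexp psTXn coef_deriv rmorphMn /= exprSr.
have : (i <= N)%N by rewrite -ltnS.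
move: (nat_of_ord i) => k kN; have [j ->] : exists j, (N = k + j)%N by exists (N - k)%N; rewrite subnKC.
rewrite addKn; move: (psT Y) (Y ^+ k) (psX ^+ j) (psC _) => x1 x2 x3 x4.
by ring.
Qed.
End Hat.

Section Residue.
Variable F : numFieldType.
Implicit Types (Y : ps F) (f g : {poly F}) (c : F).


(** For [e > 0], [(Y/z)^e (1 - logd Y)] is [- 1/e] times the Euler derivative of [(Y/z)^e], and an
    Euler derivative has no constant term. *)
Lemma pc_pow_logd Y e : pc Y 0 = 1 -> pc (Y ^+ e * (1 - logd Y)) e = (e == 0)%N%:R.
Proof.
move=> Y0; case: e => [|e]; first by rewrite expr0 mul1r pcB logd0 subr0 pc1.
have Yu := ps_unit1 Y0.
rewrite mulrBr mulr1 pcB; apply/eqP; rewrite subr_eq0; apply/eqP.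
have : pc (psT (Y ^+ e.+1)) e.+1 = pc (Y ^+ e * psT Y) e.+1 *+ e.+1 by rewrite psTexp pcMn.
rewrite pcT -[LHS]mulr_natr -[RHS]mulr_natr => /mulIf -> //; last by rewrite pnatr_eq0.
by congr (pc _ _); rewrite /logd exprSr -mulrA; congr (_ * _); rewrite mulrCA divrr // mulr1.
Qed.

(** With [x = Y/z], this is the constant term of [x^j] times the logarithmic derivative of
    [1 - c/x]. In the geometric expansion, positive powers of [x] contribute nothing by
    [pc_pow_logd], negative powers have positive order in [z], and only [c^j x^0] remains. *)
Lemma residue1 Y c j : pc Y 0 = 1 -> (0 < j)%N ->
  pc (Y ^+ j * (logd (Y - psC c * psX) - logd Y)) j = - c ^+ j.
Proof.
move=> Y0; case: j => // j _; have Yu := ps_unit1 Y0.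
pose T := psX * Y^-1; pose B := 1 - psC c * T.
have B0 : pc B 0 = 1 by rewrite pcB pcCM pc1 pc0M pc_X mul0r mulr0 subr0.
have Bu := ps_unit1 B0.
have -> : Y - psC c * psX = Y * B.
  by rewrite mulrBr mulr1 /T [psX * _]mulrC !mulrA [Y * _]mulrC mulrK.
rewrite logdM // addrAC subrr add0r.
have TB : psT B = - (psC c * (T * (1 - logd Y))).
  rewrite raddfB /= psT1 sub0r psTM psTC mul0r add0r /T psTM psTX psTV // /logd; congr (- (_ * _)); ring.
pose w := psC c * T; pose J := j.+1.
have BV : B^-1 = \sum_(i < J) w ^+ i + w ^+ J * B^-1.
  apply: (mulIr Bu); rewrite mulVr // mulrDl divrK //.
  have -> : (\sum_(i < J) w ^+ i) * B = - ((w - 1) * \sum_(i < J) w ^+ i) by rewrite /B -/w; ring.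
  by rewrite -subrX1 opprB subrK.
have YT k : (k <= J)%N -> Y ^+ J * T ^+ k = psX ^+ k * Y ^+ (J - k).
  move=> kJ; rewrite -{1}(subnK kJ) exprD /T exprMn exprVn mulrACA divrr ?unitrX //.
  by rewrite mulr1 mulrC.
have -> : Y ^+ J * logd B = - (\sum_(i < J) psC (c ^+ i.+1) * (psX ^+ i.+1 * (Y ^+ (J - i.+1) * (1 - logd Y)))
    + psX ^+ J.+1 * (Y^-1 * (1 - logd Y) * psC c ^+ J.+1 * B^-1)).
  rewrite {1}/logd TB [in LHS]BV mulrDr mulrDr opprD; congr (_ + _).
    rewrite mulr_sumr mulr_sumr -sumrN; apply: eq_bigr => i _.
    rewrite [psX ^+ i.+1 * _]mulrA -YT // rmorphXn /= /w exprMn !exprS.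
    have R1 (R : comNzRingType) (y d t l di ti : R) :
      y * (- (d * (t * (1 - l))) * (di * ti)) = - (d * di * (y * (t * ti) * (1 - l))) by ring.
    exact: R1.
  rewrite [psX ^+ J.+1]exprS; have := YT J (leqnn _); rewrite subnn expr0 mulr1 => <-.
  rewrite /w exprMn exprS /T.
  have R2 (R : comNzRingType) (y d x v l dj tj b : R) :
    y * (- (d * (x * v * (1 - l))) * (dj * tj * b)) = - (x * (y * tj) * (v * (1 - l) * (d * dj) * b)).
    by ring.
  exact: R2.
rewrite pcN pcD pc_sum pcXnM ltnn addr0; congr (- _).
rewrite (bigD1 ord_max) // big1 ?addr0 => [|i ij].
  rewrite /J [nat_of_ord ord_max]/= pcCM pcXnM leqnn subnn expr0 mul1r.
  by rewrite [LHS]addr0 pcB logd0 subr0 pc1 mulr1.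
have iJ : (i < j)%N by have := ltn_ord i; move: ij; rewrite -val_eqE /= /J; lia.
rewrite pcCM pcXnM ltnS (ltnW iJ) pc_pow_logd // /J subSS subn_eq0 leqNgt iJ mulr0 //.
Qed.

Section Main.
Variables (P : {poly F}) (n : nat) (a b : F).
Hypotheses (mP : P \is monic) (sP : size P = n.+1) (n0 : (0 < n)%N).

(** Newton's iteration with the derivative frozen at its constant term [n]. The only division is by
    [n], so the coefficients of [Y] lie in the ring generated by [1/n] and those of [P]. *)
Lemma inverse_branch : exists Y, [/\ pc Y 0 = 1, hat Y n P = 1 & bdd Y].
Proof.
have Pn : P`_n = 1 by have := monicP mP; rewrite lead_coefE sP.
have nF : n%:R != 0 :> F by rewrite pnatr_eq0 -lt0n.
pose low (f : ps F) := \sum_(i < n) psC P`_i * (f ^+ i * psX ^+ (n - i)).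
have hatlow (f : ps F) : hat f n P = low f + f ^+ n.
  by rewrite /hat big_ord_recr [nat_of_ord ord_max]/= Pn rmorph1 mul1r subnn expr0 mulr1.
pose Phi (f : ps F) := f - psC n%:R^-1 * (hat f n P - 1).
have h0 (f : ps F) : pc f 0 = 1 -> pc (hat f n P) 0 = 1.
  move=> f0; rewrite /hat pc_sum big_ord_recr big1 => [|i _].
    by rewrite [LHS]add0r pcCM [nat_of_ord ord_max]/= Pn subnn expr0 mulr1 mul1r pc0X f0 expr1n.
  rewrite [nat_of_ord _]/=.
  have : (0 < n - i)%N by rewrite subn_gt0.
  case: (n - i)%N => // k _; rewrite exprS pcCM mulrCA pcXM mulr0 //.
have [||||Y [Y0 YE YL]] := @ps_fix F (fun f : ps F => pc f 0 = 1) Phi 1.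
- by rewrite pc1.
- by move=> f f0; rewrite pcB pcCM pcB h0 // pc1 subrr mulr0 subr0.
- by move=> f /(_ 1%N)[g g0 fg]; rewrite fg.
- move=> k f g f0 g0 fg.
  have : eqm k.+1 (f - psC n%:R^-1 * f ^+ n) (g - psC n%:R^-1 * g ^+ n).
    have [h fgE] := eqm_dvd fg.
    (* [f^n - g^n = (f - g) S] and [S] has constant term [n], so [1 - S/n] gains one factor
       [psX]. *)
    pose S := \sum_(i < n) f ^+ (n.-1 - i) * g ^+ i.
    have S0 : pc (1 - psC n%:R^-1 * S) 0 = 0.
      rewrite pcB pc1 pcCM pc_sum (eq_bigr (fun=> 1)) => [|i _]; last first.
        by rewrite pc0M !pc0X f0 g0 !expr1n mulr1.
      by rewrite sumr_const card_ord mulVf // subrr.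
    have [h' hE] := psX_dvd S0.
    apply: (@dvd_eqm _ _ _ _ (h * h')).
    have -> : f - psC n%:R^-1 * f ^+ n - (g - psC n%:R^-1 * g ^+ n) =
        (f - g) * (1 - psC n%:R^-1 * S).
      have := subrXX f g n; rewrite -/S => E.
      by rewrite mulrBr mulr1 mulrCA -E; ring.
    by rewrite fgE hE exprSr; ring.
  have : eqm k.+1 (low f) (low g).
    move=> l lk; rewrite [LHS]pc_sum [RHS]pc_sum; apply: eq_bigr => i _.
    have -> : (n - i = (n - i).-1.+1)%N by rewrite prednK // subn_gt0.
    move: (n - i).-1 => j; rewrite [LHS]pcCM [RHS]pcCM; congr (_ * _).
    have E (h : ps F) : h ^+ i * psX ^+ j.+1 = psX * (h ^+ i * psX ^+ j) by rewrite exprS mulrCA.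
    rewrite !E; apply: (eqmS_mulX _ lk).
    by apply: eqmM; [exact: eqmE|exact: eqm_refl].
  move: (low f) (low g) (hatlow f) (hatlow g) => Lf Lg Ef Eg H1 H2 i ik.
  have PhiE (h l : ps F) : hat h n P = l + h ^+ n ->
      pc (Phi h) i = pc (h - psC n%:R^-1 * h ^+ n) i - n%:R^-1 * (pc l i - pc 1 i).
    move=> E; rewrite /Phi E !pcB !pcCM !pcB pcD.
    by move: (pc h i) (pc l i) (pc 1 i) (pc (h ^+ n) i) => x1 x2 x3 x4; ring.
  refine (etrans (PhiE f Lf Ef) (etrans _ (esym (PhiE g Lg Eg)))).
  have step (d x1 x2 x3 x4 x5 : F) : x1 = x4 -> x2 = x3 -> x1 - d * (x2 - x5) = x4 - d * (x3 - x5).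
    by move=> -> ->.
  exact: (step _ _ _ _ _ _ (H2 i ik) (H1 i ik)).
have hY : hat Y n P = 1.
  move: YE; rewrite /Phi => /eqP; rewrite -subr_eq0 addrAC subrr add0r oppr_eq0 => /eqP YE.
  have : psC n%:R * (psC n%:R^-1 * (hat Y n P - 1)) = 0 by rewrite YE mulr0.
  rewrite mulrA -rmorphM divff // rmorph1 mul1r => /eqP; rewrite subr_eq0 => /eqP //.
exists Y; split => //.
exists (nzcoefs P ++ [:: n%:R]); split.
  by apply: nz_cat; [exact: nz_nzcoefs|move=> x; rewrite inE => /eqP->].
move=> A hA /unitsin_cat[/(polyin_nzcoefs hA) hP /unitsin1[_ hn]].
have it k : over A (iter k Phi 1).
  elim: k => [|k IH] /=; first exact: over1.
  apply: overB => //; apply: overM => //; first exact: overC.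
  apply: overB => //; last exact: over1.
  apply: over_sum => // i _; apply: overM => //; first exact: overC.
  by apply: overM => //; apply: overE => //; exact: overX.
by move=> j; rewrite -(YL j.+1 j (ltnSn j)); exact: it.
Qed.

Variables (Y : ps F) (Y0 : pc Y 0 = 1) (hY : hat Y n P = 1) (bY : bdd Y).

Definition vratio := (Y - psC b * psX) / (Y - psC a * psX).

Lemma pc0_lin c : pc (Y - psC c * psX) 0 = 1.
Proof. by rewrite pcB Y0 pcCM pc_X mulr0 subr0. Qed.
Lemma bdd_lin c : bdd (Y - psC c * psX).
Proof. by apply: bddB => //; apply: bddM; [exact: bddC|exact: bddX]. Qed.
Lemma vratio0 : pc vratio 0 = 1.
Proof. by rewrite pc0M pc0_lin pc0V ?pc0_lin // mul1r. Qed.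
Lemma bdd_vratio : bdd vratio.
Proof. by apply: bddM; [|apply: bddV]; rewrite ?pc0_lin //; exact: bdd_lin. Qed.
Lemma logd_vratio : logd vratio = logd (Y - psC b * psX) - logd (Y - psC a * psX).
Proof. by rewrite logdM ?logdV ?unitrV // ps_unit1 // pc0_lin. Qed.

Lemma logd_vratio1 : pc (logd vratio) 1 = a - b.
Proof.
have E c : pc (logd (Y - psC c * psX)) 1 = pc Y 1 - c.
  rewrite pcM big_ord_recl big_ord1 /= mulr0n mul0r add0r /bump /= subnn pc0V ?pc0_lin //.
  by rewrite mulr1 mulr1n pcCM pc_X mulr1.
by rewrite logd_vratio pcB !E; ring.
Qed.

Lemma residue N f : (size f <= N.+1)%N -> pc (hat Y N f * logd vratio) N = f.[a] - f.[b].
Proof.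
move=> sf; rewrite !(horner_coef_wide _ sf) -sumrB /hat mulr_suml pc_sum; apply: eq_bigr => i _.
rewrite -mulrA pcCM -mulrBr; congr (_ * _).
rewrite [Y ^+ i * _]mulrC -mulrA pcXnM leq_subr subKn; last by rewrite -ltnS.
have [->|i0] := posnP i; first by rewrite !expr0 mul1r logd0 subrr.
have -> : logd vratio = (logd (Y - psC b * psX) - logd Y) - (logd (Y - psC a * psX) - logd Y).
  by rewrite logd_vratio; ring.
by rewrite mulrBr pcB !residue1 // opprK addrC.
Qed.

Lemma primitive_ex (f : {poly F}) : exists g, g^`() = f.
Proof.
exists (\poly_(i < (size f).+1) (f`_i.-1 / i%:R)); apply/polyP => i.
rewrite coef_deriv coef_poly ltnS; case: ltnP => h; last by rewrite mul0rn nth_default.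
by rewrite -(mulr_natr (_ / _)) divfK // pnatr_eq0.
Qed.

Lemma size_leq_deriv (f : {poly F}) : (size f <= (size f^`()).+1)%N.
Proof.
apply/leq_sizeP => -[|j] // hj; have /eqP := coef_deriv f j.
by rewrite nth_default // eq_sym mulrn_eq0 => /eqP.
Qed.

(** Integration by parts. For a primitive [f] of [P^i P' Q], homogenized in degree [N+1], the
    coefficient at [N+1] of its product with [logd vratio] is [f(a) - f(b) = 0] by [residue]. Since
    [P] becomes 1 on the branch, differentiating [hat f] leaves [N+1] times itself minus [n hat Q],
    and the first term cancels against the Euler derivative of the product. *)
Lemma moment_coef m (Q : {poly F}) : (size Q <= m.+1)%N ->
  (forall i f, (0 < i)%N -> f^`() = P ^+ i.-1 * P^`() * Q -> f.[a] = f.[b]) ->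
  forall i, (0 < i)%N -> pc (hat Y m Q * logs vratio) (m + n * i) = 0.
Proof.
move=> sQ mom [|i] // _.
have [f fE] := primitive_ex (P ^+ i * P^`() * Q).
have fab := mom i.+1 f isT fE.
pose N := (m + n * i + n.-1)%N.
have NE : N.+1 = (m + n * i.+1)%N by rewrite /N mulnS; lia.
have sPd : (size P^`() <= n.-1.+1)%N by rewrite prednK // -ltnS -sP lt_size_deriv // monic_neq0.
have sPi : (size (P ^+ i) <= (n * i).+1)%N.
  by apply: leq_trans (size_poly_exp_leq _ _) _; rewrite sP.
have sf : (size f <= N.+2)%N.
  have : (size f^`() <= N.+1)%N.
    rewrite fE; apply: leq_trans (size_polyMleq _ _) _.
    have := size_polyMleq (P ^+ i) P^`(); rewrite /N; move: sPd sPi sQ; lia.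
  by move=> h; apply: leq_trans (size_leq_deriv f) _.
have hPd : hat Y n.-1 P^`() * (psT Y - Y) = - n%:R.
  have := psT_hat Y n.-1 P; rewrite prednK // hY psT1 => /eqP.
  by rewrite eq_sym addrC addr_eq0 => /eqP->; rewrite -[n%:R]/(1 *+ n).
have hfd : hat Y N f^`() * (psT Y - Y) = - (n%:R * hat Y m Q).
  have -> : hat Y N f^`() = hat Y (n * i) (P ^+ i) * hat Y n.-1 P^`() * hat Y m Q.
    have -> : N = (n * i + n.-1 + m)%N by rewrite /N; lia.
    rewrite fE !hatM //; apply: leq_trans (size_polyMleq _ _) _; move: sPd sPi.
    by move: (size P^`()) (size (P ^+ i)) => s1 s2; lia.
  rewrite hatX ?sP // mul1r mulrAC hPd; ring.
have res := residue sf; rewrite fab subrr in res.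
have E := psT_hat Y N f; rewrite hfd in E.
have H : pc (psT (hat Y N.+1 f * logs vratio)) N.+1 = pc (hat Y N.+1 f * logs vratio) N.+1 *+ N.+1 by [].
have nF : n%:R != 0 :> F by rewrite pnatr_eq0 -lt0n.
move: H; rewrite psTM psT_logs pcD res addr0 E -NE.
have -> : (hat Y N.+1 f *+ N.+1 - n%:R * hat Y m Q) * logs vratio =
   (hat Y N.+1 f * logs vratio) *+ N.+1 - (hat Y m Q * logs vratio) *+ n.
  by rewrite mulr_natl mulrBl !mulrnAl.
rewrite pcB !pcMn => /eqP; rewrite -subr_eq0 addrAC subrr add0r oppr_eq0.
by rewrite -mulr_natr mulf_eq0 (negPf nF) orbF => /eqP.
Qed.

End Main.

Lemma moments_coprime (P Q : {poly F}) n m (a b : F) : P \is monic -> size P = n.+1 -> (0 < n)%N ->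
  (size Q <= m.+1)%N -> a != b ->
  (forall i f, (0 < i)%N -> f^`() = P ^+ i.-1 * P^`() * Q -> f.[a] = f.[b]) ->
  exists Y, [/\ pc Y 0 = 1, hat Y n P = 1 & forall e k, coprime k n -> e + k = m %[mod n] ->
    pc (hat Y m Q) e = 0].
Proof.
move=> mP sP n0 sQ ab mom; have [Y [Y0 hY bY]] := inverse_branch mP sP n0.
exists Y; split => // e k kn ek.
have V0 := vratio0 a b Y0; have bV := bdd_vratio a b Y0 bY.
apply: (coprime_coef_eq0 n0 V0 bV _ _ _ kn ek).
- apply: bdd_sum => i _; apply: bddM; first exact: bddC.
  by apply: bddM; apply: bddE => //; exact: bddX.
- by rewrite logd_vratio1 // subr_eq0.
- exact: (moment_coef mP sP n0 Y0 hY sQ mom).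
Qed.
End Residue.

(** * Right composition factors *)

Section Gauss.
Variable F : closedFieldType.
Implicit Types (c : {poly F}) (p g q : {poly {poly F}}).

Lemma coef_root_dvd p r : map_poly (horner_eval r) p = 0 ->
  exists q, p = ('X - r%:P : {poly F}) *: q.
Proof.
move=> h; pose l : {poly F} := 'X - r%:P.
exists (map_poly (fun f : {poly F} => f %/ l) p); apply/polyP => i.
rewrite coefZ coef_map_id0 ?div0p // mulrC divpK // dvdp_XsubCl rootE; apply/eqP.
by have := congr1 (fun p : {poly F} => p`_i) h; rewrite coef_map coef0.
Qed.

Lemma scale_polyI c p q : c != 0 -> c *: p = c *: q -> p = q.
Proof. by move=> c0; rewrite -!mul_polyC; apply: mulfI; rewrite polyC_eq0. Qed.

(* Gauss' lemma over F[x], removing the roots of the denominator c one by one. *)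
Lemma gauss p : p \is monic -> forall c q g, c != 0 -> c *: p = q * g ->
  exists c1 g1, [/\ g = c1 *: g1, c1 != 0 & exists2 u, u != 0 & lead_coef g1 = u%:P].
Proof.
move=> mp c; move: {2}(size c) (leqnn (size c)) => N; elim: N c => [|N IH] c sc q g c0 E.
  by move: sc; rewrite leqn0 size_poly_eq0 (negPf c0).
have [sc1|sc1] := eqVneq (size c) 1%N.
  exists 1, g; rewrite scale1r oner_neq0; split => //.
  have := congr1 lead_coef E; rewrite lead_coefZ (monicP mp) mulr1 lead_coefM => cE.
  have gl : lead_coef g != 0.
    by apply: contraNneq c0 => g0; rewrite cE g0 mulr0.
  have ql : lead_coef q != 0.
    by apply: contraNneq c0 => q0; rewrite cE q0 mul0r.
  have sg : (size (lead_coef g) <= 1)%N.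
    have := size_mul ql gl; rewrite -cE sc1.
    have : (0 < size (lead_coef q))%N by rewrite size_poly_gt0.
    by move: (size (lead_coef q)) (size (lead_coef g)); lia.
  exists (lead_coef g)`_0; last by rewrite -size1_polyC.
  by apply: contraNneq gl => g0; rewrite (size1_polyC sg) g0 polyC0.
have /closed_rootP[r rc] := sc1.
have /factor_theorem[c' cE] := rc.
pose l : {poly F} := 'X - r%:P; have l0 : l != 0 by rewrite polyXsubC_eq0.
have c'0 : c' != 0 by apply: contraNneq c0 => c'0; rewrite cE c'0 mul0r.
have sc' : (size c' <= N)%N.
  by move: sc; rewrite cE size_Mmonic ?monicXsubC // size_XsubC addn2.
have : map_poly (horner_eval r) q * map_poly (horner_eval r) g = 0.
  rewrite -rmorphM -E; apply/polyP => i; rewrite coef_map coefZ coef0 /= /horner_eval hornerM.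
  by move: rc; rewrite rootE => /eqP ->; rewrite mul0r.
move/eqP; rewrite mulf_eq0 => /orP[]/eqP/coef_root_dvd[h hE].
  apply: (IH c' sc' h g c'0); apply: (scale_polyI l0).
  by rewrite scalerAl -hE -E cE scalerA mulrC.
have [|c1 [g1 [gE c10 ug]]] := IH c' sc' q h c'0.
  by apply: (scale_polyI l0); rewrite scalerAr -hE -E cE scalerA mulrC.
by exists (l * c1), g1; split => //; [rewrite hE gE scalerA|rewrite mulf_neq0].
Qed.

End Gauss.

Lemma prim_root_exists (F : numClosedFieldType) n : (0 < n)%N -> exists z : F, n.-primitive_root z.
Proof.
pose p : {poly F} := 'X^n - 1; have [r Dp] := closed_field_poly_normal p.
move=> n_gt0; rewrite (monicP _) ?monicXnsubC // scale1r in Dp.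
have rn1: all n.-unity_root r by apply/allP=> z; rewrite -root_prod_XsubC -Dp.
have sz_r: (n < (size r).+1)%N.
  by rewrite -(size_prod_XsubC r id) -Dp size_XnsubC.
have [|z] := hasP (has_prim_root n_gt0 rn1 _ sz_r); last by exists z.
by rewrite -separable_prod_XsubC -Dp separable_Xn_sub_1 // pnatr_eq0 -lt0n.
Qed.

Lemma coef_prod_scaled (R : comNzRingType) (c : R) (s : seq R) j :
  (\prod_(z <- s) ('X - (c * z)%:P))`_j * c ^+ j = c ^+ size s * (\prod_(z <- s) ('X - z%:P))`_j.
Proof.
elim: s j => [|z s IH] j.
  rewrite !big_nil !coef1 expr0 mul1r; case: eqP => [->|_]; last by rewrite mul0r.
  by rewrite expr0 mulr1.
rewrite !big_cons !mulrBl !coefB !coefCM !coefXM mulrBl mulrBr -!mulrA IH /=; congr (_ - _).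
  case: j => [|j]; first by rewrite mul0r mulr0.
  by rewrite !exprS mulrCA IH mulrA.
by rewrite exprS; ring.
Qed.

Section Scaling.
Variable F : fieldType.
(** Substitution of [u z] for [z]. *)
Definition psS (u : F) (f : ps F) : ps F := PS (fun j => u ^+ j * pc f j).
Lemma pcS u f j : pc (psS u f) j = u ^+ j * pc f j. Proof. by []. Qed.
Fact psS_is_zmod u : zmod_morphism (psS u).
Proof. by move=> f g; apply: psP => j; rewrite pcB /= mulrBr. Qed.
Fact psS_is_monoid u : monoid_morphism (psS u).
Proof.
split; first by apply: psP => j; rewrite pcS pc1; case: j => [|j]; rewrite ?expr0 ?mulr1 ?mulr0.
move=> f g; apply: psP => j; rewrite [LHS]/= !pcM mulr_sumr; apply: eq_bigr => i _ /=.
have ij : (i <= j)%N by rewrite -ltnS.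
by rewrite mulrACA -exprD subnKC.
Qed.
HB.instance Definition _ u := GRing.isZmodMorphism.Build (ps F) (ps F) (psS u) (psS_is_zmod u).
HB.instance Definition _ u := GRing.isMonoidMorphism.Build (ps F) (ps F) (psS u) (psS_is_monoid u).
Lemma psSC u c : psS u (psC c) = psC c.
Proof. by apply: psP => -[|j] /=; rewrite ?expr0 ?mul1r ?mulr0. Qed.
Lemma psSX u : psS u psX = psC u * psX.
Proof.
by apply: psP => -[|[|j]]; rewrite pcCM /= ?mulr0 ?mulr1 ?expr1.
Qed.
Lemma psSS u v f : psS u (psS v f) = psS (u * v) f.
Proof. by apply: psP => j /=; rewrite mulrA -exprMn. Qed.
Lemma psS1 f : psS 1 f = f.
Proof. by apply: psP => j /=; rewrite expr1n mul1r. Qed.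

(** The factor [u^-1] makes the new point [Y(uz)/(uz)], the old one with [u z] in place of [z]. *)
Lemma hat_scale u Y N (f : {poly F}) : u != 0 ->
  hat (psC u^-1 * psS u Y) N f = psC (u^-1 ^+ N) * psS u (hat Y N f).
Proof.
move=> u0; rewrite /hat raddf_sum mulr_sumr; apply: eq_bigr => i _.
have iN : (i <= N)%N by rewrite -ltnS.
rewrite /= !rmorphM !rmorphXn /= psSC psSX !exprMn.
have -> : psC u^-1 ^+ i = psC u^-1 ^+ N * psC u ^+ (N - i).
  rewrite -!rmorphXn -rmorphM /= -{2}(subnKC iN) exprD -mulrA -exprMn mulVf // expr1n mulr1 //.
move: (psC u^-1 ^+ N) (psC u ^+ _) (psC _) (_ ^+ i) (_ ^+ _) => a b c d e.
have R5 (R : comNzRingType) (x1 x2 x3 x4 x5 : R) :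
  x3 * (x1 * x2 * x4 * x5) = x1 * (x3 * (x4 * (x2 * x5))) by ring.
exact: R5.
Qed.

Lemma pc_hat0 Y N (f : {poly F}) : pc Y 0 = 1 -> pc (hat Y N f) 0 = f`_N.
Proof.
move=> Y0; rewrite /hat pc_sum big_ord_recr big1 => [|i _].
  by rewrite [LHS]add0r pcCM [nat_of_ord ord_max]/= subnn expr0 mulr1 pc0X Y0 expr1n mulr1.
have -> : (N - (widen_ord (leqnSn N) i) = (N - i).-1.+1)%N by rewrite prednK // subn_gt0.
by rewrite pcCM pc0M !pc0X pc_X expr0n /= !mulr0.
Qed.

Lemma hat_shift Y N k (f : {poly F}) : (size f <= N.+1)%N -> hat Y (k + N) f = psX ^+ k * hat Y N f.
Proof.
move=> sf; apply/eqP; rewrite -tofrac_eq rmorphM rmorphXn /= !hat_frac ?exprD ?mulrA //.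
by apply: leq_trans sf _; rewrite ltnS leq_addl.
Qed.

Lemma ev_inj Y (f : {poly F}) : pc Y 0 = 1 -> ev (tofrac Y / tofrac psX) f = 0 -> f = 0.
Proof.
move=> Y0 h; apply/eqP; rewrite -lead_coef_eq0 lead_coefE -(pc_hat0 _ _ Y0).
have : tofrac (hat Y (size f).-1 f) = 0 by rewrite hat_frac ?h ?mulr0 // leqSpred.
by move/eqP; rewrite tofrac_eq0 => /eqP ->.
Qed.
End Scaling.

Lemma eq_mod_gcd n k a b : (0 < n)%N -> k * a = k * b %[mod n] -> a = b %[mod n %/ gcdn k n].
Proof.
move=> n0; set g := gcdn k n; have g0 : (0 < g)%N by rewrite gcdn_gt0 n0 orbT.
have /dvdnP[k' kE] : (g %| k)%N by exact: dvdn_gcdl.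
have /dvdnP[n' nE] : (g %| n)%N by exact: dvdn_gcdr.
have n'0 : (0 < n')%N by move: n0; rewrite nE muln_gt0 => /andP[].
have cop : coprime n' k'.
  rewrite coprime_sym /coprime -(eqn_pmul2r g0) mul1n muln_gcdl -kE -nE //.
have -> : (n %/ g = n')%N by rewrite [in LHS]nE mulnK.
move=> E; apply: (eq_mod_mull cop); apply/eqP.
by rewrite -(eqn_pmul2l g0) !muln_modr !mulnA ![(g * _)%N]mulnC -kE -nE E.
Qed.

Section Luroth.
Variable F : numClosedFieldType.
Local Notation E := {fraction (ps F)}.

Section Represent.
Variables (W : {poly F}) (Y : ps F) (d : nat).
Hypotheses (Y0 : pc Y 0 = 1) (d0 : (0 < d)%N) (mW : W \is monic) (sW : size W = d.+1).
Hypothesis hW : in_class d 0 (hat Y d W).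

(** Homogenizing in a larger degree multiplies by a power of [psX], which shifts exponents and class
    together. *)
Lemma in_class_hat_norm N (f : {poly F}) : f != 0 -> (size f <= N.+1)%N ->
  in_class d N (hat Y N f) -> in_class d (size f).-1 (hat Y (size f).-1 f).
Proof.
move=> f0 sf h e pe; have s0 : (0 < size f)%N by rewrite size_poly_gt0.
pose k := (N - (size f).-1)%N.
have NE : N = (k + (size f).-1)%N by rewrite subnK //; lia.
have /h : pc (hat Y N f) (k + e)%N != 0.
  by rewrite NE hat_shift ?prednK // pcXnM leq_addr addKn.
by rewrite [in X in _ = X %[mod _]]NE => /eqP; rewrite eqn_modDl => /eqP.
Qed.

(** The leading coefficient of [f] sits at exponent 0, so [d] divides the degree of [f]; subtracting
    a multiple of a power of [W] lowers the degree and respects the class. *)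
Lemma represent (f : {poly F}) N : (size f <= N.+1)%N -> in_class d N (hat Y N f) ->
  exists g, f = g \Po W.
Proof.
move: {2}(size f) (leqnn (size f)) => s; elim: s f N => [|s IH] f N sf sN cf.
  by exists 0; rewrite comp_poly0; apply/eqP; rewrite -size_poly_eq0 -leqn0.
have [f0|f0] := eqVneq f 0; first by exists 0; rewrite comp_poly0.
have s0 : (0 < size f)%N by rewrite size_poly_gt0.
have {cf} cf := in_class_hat_norm f0 sN cf; pose M := (size f).-1.
have l0 : lead_coef f != 0 by rewrite lead_coef_eq0.
have /dvdnP[i iE] : (d %| M)%N.
  by have := cf 0%N; rewrite pc_hat0 // -lead_coefE => /(_ l0) /esym/eqP; rewrite mod0n.
pose f' := f - lead_coef f *: W ^+ i.
have sWi : size (W ^+ i) = M.+1 by rewrite -(prednK (_ : 0 < size (W ^+ i))%N) ?size_poly_gt0 ?monic_neq0 ?monic_exp // size_exp sW mulnC -iE.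
have sf' : (size f' <= M)%N.
  apply/leq_sizeP => j hj; rewrite coefB coefZ.
  have [hj'|hj'] := leqP (size f) j.
    rewrite [f`_j]nth_default // [(W ^+ i)`_j]nth_default ?mulr0 ?subrr // sWi /M prednK //.
  have -> : j = M by move: hj hj'; rewrite /M; lia.
  have : (W ^+ i)`_M = 1 by have := monic_exp i mW; rewrite monicE lead_coefE sWi => /eqP.
  by move=> ->; rewrite mulr1 subrr.
have [||g gE] := IH f' M _ (leq_trans sf' (leqnSn M)).
- by apply: leq_trans sf' _; rewrite /M -ltnS prednK.
- have -> : hat Y M f' = hat Y M f - psC (lead_coef f) * hat Y d W ^+ i.
    have hWi k : hat Y (d * k) (W ^+ k) = hat Y d W ^+ k.
      elim: k => [|k IHk]; first by rewrite muln0 !expr0 hat1.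
      rewrite mulnS !exprS hatM ?sW // ?IHk // (leq_trans (size_poly_exp_leq _ _)) // sW //.
    have -> : hat Y d W ^+ i = hat Y M (W ^+ i) by rewrite iE mulnC hWi.
    rewrite /hat mulr_sumr -sumrB; apply: eq_bigr => k _.
    by rewrite /f' coefB coefZ rmorphB rmorphM /= mulrBl -[psC _ * psC _ * _]mulrA.
  apply: in_classB => //.
  have c0 : in_class d 0 (hat Y d W ^+ i).
    elim: (i) => [|k IHk]; first by move=> [|j]; rewrite pc1 ?eqxx.
    by rewrite exprS; apply: (in_classM hW IHk).
  move=> e; rewrite pcCM mulf_eq0 negb_or => /andP[_ /c0 ->].
  by rewrite mod0n iE modnMl.
exists (g + lead_coef f *: 'X^i).
by rewrite rmorphD /= -gE linearZ /= comp_Xn_poly subrK.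
Qed.
End Represent.

Variables (P Q : {poly F}) (n m : nat) (Y : ps F).
Hypotheses (mP : P \is monic) (sP : size P = n.+1) (n0 : (0 < n)%N) (sQ : (size Q <= m.+1)%N).
Hypotheses (Y0 : pc Y 0 = 1) (hY : hat Y n P = 1).

(** This [d] becomes the degree of [W]. It is largest even for divisibility, because admissible
    moduli are stable under lcm. *)
Lemma max_class : exists d, [/\ (d %| n)%N, in_class d m (hat Y m Q) &
  forall d', (d' %| n)%N -> in_class d' m (hat Y m Q) -> (d' %| d)%N].
Proof.
pose S d := (d %| n)%N && `[< in_class d m (hat Y m Q) >].
have ex : exists d, S d by exists 1%N; rewrite /S dvd1n /=; apply/asboolP => e _; rewrite !modn1.
have bd d : S d -> (d <= n)%N by case/andP => /dvdn_leq h _; exact: h.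
case: (ex_maxnP ex bd) => d /andP[dn /asboolP cd] dmax; exists d; split => // d' d'n cd'.
have /dmax : S (lcmn d d').
  rewrite /S dvdn_lcm dn d'n /=; apply/asboolP => e pe.
  wlog em : / (e <= m)%N => [H|].
    have [/H//|/ltnW me] := leqP e m.
    have : (lcmn d d' %| e - m)%N.
      by rewrite dvdn_lcm -!eqn_mod_dvd // (cd _ pe) (cd' _ pe) !eqxx.
    by rewrite -eqn_mod_dvd // => /eqP.
  have : (lcmn d d' %| m - e)%N.
    by rewrite dvdn_lcm -!eqn_mod_dvd // (cd _ pe) (cd' _ pe) !eqxx.
  by rewrite -eqn_mod_dvd // => /eqP.
move=> h; have d0 : (0 < d)%N by exact: dvdn_gt0 dn.
have : (d == lcmn d d')%N.
  rewrite eqn_leq h dvdn_leq ?dvdn_lcml // lcmn_gt0 d0 (dvdn_gt0 n0 d'n) //.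
by move=> /eqP->; exact: dvdn_lcmr.
Qed.

Variable eps : F.
Hypothesis heps : n.-primitive_root eps.

(* Substituting eps^k z for z permutes the roots Y/z of P(x) = z^-n. *)
Definition branch k : ps F := psC (eps ^+ k)^-1 * psS (eps ^+ k) Y.
Definition xbranch k : E := tofrac (branch k) / tofrac psX.
Local Notation x := (tofrac Y / tofrac psX : E).

Let epsX0 k : eps ^+ k != 0.
Proof. by rewrite expf_neq0 // (prim_root_eq0 heps) -lt0n. Qed.

Lemma branch_add j k : psS (eps ^+ j) (branch k) = psC (eps ^+ j) * branch (k + j).
Proof.
rewrite /branch rmorphM /= psSC psSS mulrA -rmorphM /= exprD [eps ^+ j * eps ^+ k]mulrC.
by rewrite invfM mulrCA mulfV // mulr1.
Qed.
Lemma branchn : branch n = Y.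
Proof. by rewrite /branch (prim_expr_order heps) invr1 rmorph1 mul1r psS1. Qed.
Lemma branch0 : branch 0 = Y.
Proof. by rewrite /branch expr0 invr1 rmorph1 mul1r psS1. Qed.
Lemma xbranch0 : xbranch 0 = x.
Proof. by rewrite /xbranch branch0. Qed.

Lemma xbranch_inj k l : (k < n)%N -> (l < n)%N -> xbranch k = xbranch l -> k = l.
Proof.
move=> kn ln /(mulIf (_ : (tofrac psX)^-1 != 0)); rewrite invr_eq0 => /(_ (frac_psX_neq0 F)) /eqP.
rewrite tofrac_eq => /eqP /(congr1 (fun f => pc f 0)).
rewrite /branch !pcCM !pcS !expr0 Y0 !mulr1 => /invr_inj/eqP.
by rewrite (eq_prim_root_expr heps) !modn_small // => /eqP.
Qed.

Lemma hat_branch N k (f : {poly F}) : (size f <= N.+1)%N ->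
  tofrac (hat (branch k) N f) = tofrac psX ^+ N * ev (xbranch k) f.
Proof. exact: hat_frac. Qed.
Lemma hat_branchE N k (f : {poly F}) :
  hat (branch k) N f = psC ((eps ^+ k)^-1 ^+ N) * psS (eps ^+ k) (hat Y N f).
Proof. exact: hat_scale. Qed.
Lemma ev_branch_eq N k (f : {poly F}) : (size f <= N.+1)%N ->
  ev (xbranch k) f = ev x f <-> hat (branch k) N f = hat Y N f.
Proof.
move=> sf; have h1 := hat_branch k sf; have h2 := hat_frac Y sf.
split=> [h|h].
  by apply/eqP; rewrite -tofrac_eq; apply/eqP; rewrite [LHS]h1 [RHS]h2 h.
by apply: (mulfI (expf_neq0 N (frac_psX_neq0 F))); rewrite -[LHS]h1 -[RHS]h2 h.
Qed.

Lemma ev_xbranchP k : ev (xbranch k) P = ev x P.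
Proof.
have sP' : (size P <= n.+1)%N by rewrite sP.
apply: (proj2 (ev_branch_eq k sP')); rewrite [LHS]hat_branchE hY.
have -> : psS (eps ^+ k) 1 = 1 by exact: rmorph1.
have -> : (eps ^+ k)^-1 ^+ n = 1.
  by rewrite exprVn -exprM mulnC exprM (prim_expr_order heps) expr1n invr1.
by rewrite mulr1; exact: rmorph1.
Qed.

Lemma ev_xbranchQ k : ev (xbranch k) Q = ev x Q <->
  (forall e, pc (hat Y m Q) e != 0 -> k * e = k * m %[mod n]).
Proof.
rewrite (ev_branch_eq _ sQ) hat_branchE; split=> [h e pe|h].
  have := congr1 (fun f => pc f e) h; rewrite pcCM pcS mulrA => /eqP.
  rewrite -subr_eq0 -{2}[pc (hat Y m Q) e]mul1r -mulrBl mulf_eq0 (negPf pe) orbF subr_eq0.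
  move/eqP => H; have : eps ^+ k ^+ e == eps ^+ k ^+ m.
    apply/eqP; apply: (mulfI (invr_neq0 (expf_neq0 m (epsX0 k)))).
    by rewrite mulVf; [rewrite -exprVn|exact: expf_neq0].
  by rewrite -!exprM (eq_prim_root_expr heps) => /eqP.
apply: psP => e; rewrite pcCM pcS mulrA; have [->|pe] := eqVneq (pc (hat Y m Q) e) 0; first by rewrite !mulr0.
have /eqP := h e pe; rewrite -(eq_prim_root_expr heps) exprM => /eqP ->.
by rewrite exprVn exprM mulVf ?mul1r //; exact: expf_neq0.
Qed.

Variable d : nat.
Hypotheses (dn : (d %| n)%N) (cd : in_class d m (hat Y m Q)).
Hypothesis dmax : forall d', (d' %| n)%N -> in_class d' m (hat Y m Q) -> (d' %| d)%N.
Local Notation D := (n %/ d)%N.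

(** [Q] agrees on the branches [k] and 0 when [k (e - m) = 0] mod [n] for every exponent [e] that
    occurs, that is, when [n / gcd(k, n)] is an admissible modulus and hence divides [d]. *)
Lemma common_branch k : ev (xbranch k) Q = ev x Q <-> (D %| k)%N.
Proof.
have d0 : (0 < d)%N by exact: dvdn_gt0 dn.
rewrite ev_xbranchQ; split=> [h|/dvdnP[j ->] e /cd em].
  have g0 : (0 < gcdn k n)%N by rewrite gcdn_gt0 n0 orbT.
  have gn : (gcdn k n %| n)%N by exact: dvdn_gcdr.
  have : (n %/ gcdn k n %| d)%N.
    apply: dmax; first by rewrite dvdn_divLR // dvdn_mulr.
    by move=> e /h; apply: eq_mod_gcd.
  rewrite dvdn_divLR // => nd; rewrite dvdn_divLR //.
  apply: dvdn_trans nd _; rewrite mulnC dvdn_mul // dvdn_gcdl //.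
have H y : ((j * D * y) %% n = D * ((j * (y %% d)) %% d))%N.
  by rewrite modnMmr muln_modr divnK // mulnA [(D * j)%N]mulnC.
by rewrite !H em.
Qed.

(** [P(T) - P(x)], with [T] the outer variable and [x] the inner one. *)
Local Notation p1 := (P^:P - P%:P).
Local Notation p2 := (Q^:P - Q%:P).
Local Notation evp := (map_poly (ev x)).

Lemma ev_C (y : E) (c : F) : ev y c%:P = ps_emb c.
Proof. by rewrite /ev /= map_polyC /horner_eval hornerC. Qed.
Lemma evp_diff (f : {poly F}) y : (evp (f^:P - f%:P)).[y] = ev y f - ev x f.
Proof.
rewrite rmorphB /= map_polyC hornerD hornerN hornerC -map_poly_comp; congr (_.[y] - _).
by apply: eq_map_poly => c; exact: ev_C.
Qed.
Lemma size_const_lt : (size (P%:P : {poly {poly F}}) < size P^:P)%N.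
Proof.
rewrite size_map_poly_id0; last by rewrite polyC_eq0 lead_coef_eq0 monic_neq0.
by rewrite sP size_polyC; case: (P != 0) => //=; rewrite ltnS.
Qed.
Lemma monic_p1 : p1 \is monic.
Proof.
rewrite monicE lead_coefDl ?size_polyN ?size_const_lt //.
by rewrite -monicE monic_map.
Qed.
Lemma evp_p1 : evp p1 = \prod_(k < n) ('X - (xbranch k)%:P).
Proof.
have mp : evp p1 \is monic by rewrite monic_map // monic_p1.
have -> : evp p1 = lead_coef (evp p1) *: \prod_(z <- [seq xbranch k | k : 'I_n]) ('X - z%:P).
  2: by rewrite (monicP mp) scale1r big_map big_enum.
apply: all_roots_prod_XsubC.
- have sz : size (evp p1) = size P.
    rewrite size_map_poly_id0; last first.
      by rewrite (monicP monic_p1) rmorph1 oner_eq0.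
    rewrite size_polyDl ?size_polyN ?size_const_lt //.
    by rewrite size_map_poly_id0 // polyC_eq0 lead_coef_eq0 monic_neq0.
  by rewrite sz sP size_map -cardE card_ord.
- apply/allP => _ /mapP[k _ ->]; apply/eqP; refine (etrans (evp_diff P _) _).
  by apply/eqP; rewrite subr_eq0; apply/eqP; exact: ev_xbranchP.
- rewrite uniq_rootsE map_inj_in_uniq ?enum_uniq // => k l _ _ h.
  by apply: val_inj; apply: xbranch_inj h.
Qed.

Lemma ev_scaled_root c (q : {poly {poly F}}) y : c != 0 ->
  root (evp (c *: q)) y = root (evp q) y.
Proof.
move=> c0; rewrite !rootE map_polyZ hornerZ mulf_eq0.
have : ev x c != 0 by apply: contraNneq c0 => /(ev_inj Y0)/eqP.
by move=> /negPf ->.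
Qed.

(** The gcd of [P(T) - P(x)] and [Q(T) - Q(x)] is formed by pseudo-division over [F[x]]; Gauss'
    lemma makes its leading coefficient constant. The roots of the first polynomial are simple, so
    the gcd splits over the common ones. *)
Lemma common_factor : exists (g : {poly {poly F}}) u, [/\ u != 0, lead_coef g = u%:P &
  evp g = ps_emb u *: \prod_(j < d) ('X - (xbranch (D * j))%:P)].
Proof.
have d0 : (0 < d)%N by exact: dvdn_gt0 dn.
pose g := gcdp p1 p2.
have /Pdiv.WeakIdomain.dvdpP[[c q] /= c0 E1] : g %| p1 by exact: dvdp_gcdl.
have [c1 [g1 [gE c10 [u u0 gu]]]] := gauss monic_p1 c0 E1.
exists g1, u; split => //.
have rootg y : root (evp g1) y <-> ev y P = ev x P /\ ev y Q = ev x Q.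
  rewrite -(ev_scaled_root g1 y c10) -gE; split.
    move=> gy; split; apply/eqP; rewrite -subr_eq0 -evp_diff -/(root _ y).
      rewrite -(ev_scaled_root p1 y c0) E1 rmorphM rootM gy orbT //.
    have /Pdiv.WeakIdomain.dvdpP[[c' q'] /= c'0 E2] : g %| p2 by exact: dvdp_gcdr.
    by rewrite -(ev_scaled_root p2 y c'0) E2 rmorphM rootM gy orbT.
  move=> [h1 h2].
  have [[v1 v2] /Pdiv.CommonIdomain.eqpP[[c2 c3] /= /andP[c20 c30] E3]] := Pdiv.CommonIdomain.Bezoutp p1 p2.
  rewrite -(ev_scaled_root g y c30) -E3 ev_scaled_root //.
  by rewrite rootE rmorphD !rmorphM hornerD !hornerM !evp_diff h1 h2 !subrr !mulr0 addr0.
have g1d : evp g1 %| \prod_(k <- [seq xbranch k | k : 'I_n]) ('X - k%:P).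
  rewrite big_map big_enum /= -evp_p1; have := congr1 (fun p => evp p) E1.
  rewrite gE /= rmorphM !map_polyZ => h.
  have ec : ev x c != 0 by apply: contraNneq c0 => /(ev_inj Y0)/eqP.
  have ec1 : ev x c1 != 0 by apply: contraNneq c10 => /(ev_inj Y0)/eqP.
  by rewrite -(dvdpZr _ _ ec) h; apply: dvdp_mull; rewrite /= map_polyZ dvdpZr // dvdpp.
have [msk gm] := dvdp_prod_XsubC g1d.
set s := mask msk _ in gm.
have us : uniq [seq xbranch k | k : 'I_n].
  rewrite map_inj_in_uniq ?enum_uniq // => k l _ _ h.
  by apply: val_inj; apply: xbranch_inj h.
have Dd : (D * d = n)%N by rewrite divnK.
have D0 : (0 < D)%N by rewrite divn_gt0 // dvdn_leq.
have Djn (j : 'I_d) : (D * j < n)%N by rewrite -[X in (_ < X)%N]Dd ltn_pmul2l.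
have ps : perm_eq s [seq xbranch (D * j) | j : 'I_d].
  apply: uniq_perm; first exact: mask_uniq.
    rewrite map_inj_in_uniq ?enum_uniq // => j l _ _ /xbranch_inj; rewrite !Djn => /(_ isT isT) /eqP.
    by rewrite eqn_pmul2l // => /eqP; exact: val_inj.
  move=> y; rewrite -root_prod_XsubC; apply/idP/mapP.
    move=> ys; have : root (evp g1) y by rewrite (eqp_root gm).
    move/rootg=> [_ hQ]; move: ys; rewrite root_prod_XsubC => /mem_mask /mapP[k _ yk].
    move: hQ; rewrite yk common_branch => /dvdnP[j kE].
    have jd : (j < d)%N by rewrite -(ltn_pmul2l D0) Dd mulnC -kE.
    by exists (Ordinal jd); rewrite ?mem_enum //= mulnC -kE.
  move=> [j _ ->]; rewrite -(eqp_root gm); apply/rootg; split; first exact: ev_xbranchP.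
  by apply/common_branch; exact: dvdn_mulr.
have := eqp_eq gm; rewrite (monicP (monic_prod_XsubC _ _ _)) scale1r => ->.
rewrite (perm_big _ ps) big_map big_enum /=; congr (_ *: _).
have eu : ps_emb u != 0 by rewrite (fmorph_eq0 (@ps_emb F)).
have E : lead_coef (evp g1) = ev x (lead_coef g1).
  by apply: lead_coef_map_eq; rewrite gu /= ev_C.
by rewrite E gu ev_C.
Qed.

(* The monic gcd over F(x) is W(T) - W(x): below the constant term its
   coefficients are polynomials in x whose degree is at most d - 1 and, by
   symmetry under z -> eps^D z, a multiple of d. *)
Lemma common_right_factor : exists W, [/\ W \is monic, size W = d.+1 & in_class d 0 (hat Y d W)].
Proof.
have d0 : (0 < d)%N by exact: dvdn_gt0 dn.
have [g [u [u0 gu gE]]] := common_factor.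
pose s := [seq xbranch (D * j) | j : 'I_d].
pose Gam := \prod_(z <- s) ('X - z%:P).
have GamE : evp g = ps_emb u *: Gam by rewrite gE /Gam big_map big_enum.
pose c j : {poly F} := u^-1 *: g`_j.
have cE j : ev x (c j) = Gam`_j.
  have := congr1 (fun p : {poly E} => p`_j) GamE; rewrite coef_map coefZ => h.
  rewrite /c -mul_polyC rmorphM /= ev_C [ev x _]h mulrA -rmorphM mulVf // rmorph1 mul1r //.
(* [Gam] with its roots multiplied by [z], which turns its coefficients into power series. *)
pose gam := \prod_(y <- [seq branch (D * j) | j : 'I_d]) ('X - y%:P).
have Dd : (D * d = n)%N by rewrite divnK.
have ss : size s = d by rewrite size_map -cardE card_ord.
have sGam : size Gam = d.+1 by rewrite size_prod_XsubC ss.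
have X0 := frac_psX_neq0 F.
have gamE j : (j <= d)%N -> tofrac (gam`_j) = tofrac psX ^+ (d - j) * Gam`_j.
  move=> jd; apply: (mulIf (expf_neq0 j X0)); rewrite mulrAC -exprD subnK //.
  have := coef_prod_scaled (tofrac (psX : ps F)) s j; rewrite ss => <-; congr (_ * _).
  rewrite -[tofrac _]/(tofrac gam`_j) -coef_map; congr (_`_j).
  have Ek k : map_poly (@tofrac (ps F)) ('X - (branch k)%:P) = 'X - (tofrac psX * xbranch k)%:P.
    by rewrite rmorphB /= map_polyX map_polyC /= /xbranch mulrC divfK.
  rewrite /gam rmorph_prod /= !big_map; under eq_bigr do rewrite Ek.
  by [].
pose z := eps ^+ D.
have hz : d.-primitive_root z.
  by have := dvdn_prim_root heps dn.
have gamS j : psS z gam`_j * psC z ^+ j = gam`_j.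
  have E1 : map_poly (psS z) gam = \prod_(y <- [seq branch (D * j) | j : 'I_d]) ('X - (psC z * y)%:P).
    have Ek k : map_poly (psS z) ('X - (branch k)%:P) = 'X - (psC z * branch (k + D))%:P.
      by rewrite rmorphB /= map_polyX map_polyC /= branch_add.
    rewrite /gam rmorph_prod !big_map /= -!/(index_enum _).
    under eq_bigr do rewrite Ek -mulnSr.
    (* The substitution rotates the branches: the last one becomes [branch n], which is
       [branch 0]. *)
    case: (d) d0 Dd => // d' _ Dd.
    rewrite big_ord_recr [RHS]big_ord_recl /= Dd branchn muln0 branch0 mulrC; congr (_ * _).
  have := coef_prod_scaled (psC z) [seq branch (D * j) | j : 'I_d] j.
  rewrite -E1 coef_map => ->; rewrite size_map -cardE card_ord -rmorphXn /= (prim_expr_order hz).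
  by rewrite rmorph1 mul1r.
have gam_cls j e : pc gam`_j e != 0 -> (d %| e + j)%N.
  move=> pe; have := congr1 (fun f => pc f e) (gamS j).
  rewrite -rmorphXn mulrC pcCM pcS mulrA -exprD => /eqP.
  rewrite -subr_eq0 -{2}[pc gam`_j e]mul1r -mulrBl mulf_eq0 (negPf pe) orbF subr_eq0.
  by rewrite -(prim_order_dvd hz) addnC.
(* If [c j] has degree [M], its leading coefficient appears in the [j]-th coefficient of [gam] at
   the exponent [d - j - M]. Hence [d] divides [M], while [M <= d - j < d]. *)
have c_const j : (0 < j)%N -> (j < d)%N -> (size (c j) <= 1)%N.
  move=> j0 jd; have [->|cj0] := eqVneq (c j) 0; first by rewrite size_poly0.
  have sc0 : (0 < size (c j))%N by rewrite size_poly_gt0.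
  pose M := (size (c j)).-1.
  have H : psX ^+ (d - j) * hat Y M (c j) = psX ^+ M * gam`_j.
    apply/eqP; rewrite -tofrac_eq !rmorphM !rmorphXn /= gamE ?(ltnW jd) // -cE hat_frac ?leqSpred //.
    by rewrite mulrCA.
  have := congr1 (fun f => pc f (d - j)%N) H.
  rewrite !pcXnM leqnn subnn pc_hat0 // -lead_coefE.
  case: leqP => hM; last by move/eqP; rewrite lead_coef_eq0 (negPf cj0).
  move=> E1; have : pc gam`_j (d - j - M)%N != 0 by rewrite -E1 lead_coef_eq0.
  move/gam_cls; have -> : (d - j - M + j = d - M)%N by lia.
  move=> dM; have : (d %| M)%N.
    have Md : (M <= d)%N by lia.
    by rewrite -(subKn Md) dvdn_sub.
  have : (M < d)%N by lia.
  by case: (posnP M) => [|M0 lM /dvdn_leq]; [rewrite /M; lia|move/(_ M0); lia].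
have cd1 : c d = 1.
  have : ev x (c d - 1) = 0.
    rewrite rmorphB /= rmorph1 cE; have := monic_prod_XsubC s predT id.
    by rewrite monicE lead_coefE sGam /= => /eqP ->; rewrite subrr.
  by move/(ev_inj Y0)/eqP; rewrite subr_eq0 => /eqP.
(* Only the difference [W(T) - W(x)] is determined, so the constant term of [W] is normalized to
   0. *)
pose W := \poly_(j < d.+1) (if j == 0%N then 0 else (c j)`_0).
have cW j : (0 < j)%N -> (j <= d)%N -> c j = (W`_j)%:P.
  move=> j0; rewrite coef_poly leq_eqVlt ltnS => /orP[/eqP->|jd].
    by rewrite leqnn gtn_eqF // cd1 coef1.
  by rewrite (ltnW jd) gtn_eqF //; exact/size1_polyC/c_const.
have Wd : W`_d = 1.
  by rewrite coef_poly ltnSn gtn_eqF // cd1 coef1.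
have sW : size W = d.+1.
  apply/eqP; rewrite eqn_leq size_poly /= ltnNge; apply/negP => /leq_sizeP/(_ d (leqnn d)) /eqP.
  by rewrite Wd oner_eq0.
have mW : W \is monic by rewrite monicE lead_coefE sW Wd.
exists W; split => //.
(* [x] is itself a root of [Gam], which expresses the constant coefficient through the others. *)
have c0W : c 0%N = - W.
  apply/eqP; rewrite -addr_eq0; apply/eqP; apply: (ev_inj Y0); rewrite rmorphD /=.
  have xs : x \in s.
    by apply/mapP; exists (Ordinal d0); rewrite ?mem_enum //= muln0 xbranch0.
  have : root Gam x by rewrite root_prod_XsubC.
  rewrite rootE (@horner_coef_wide _ d.+1) ?sGam // big_ord_recl /= expr0 mulr1 -cE => /eqP <-.
  congr (_ + _); rewrite [LHS](@horner_coef_wide _ d.+1); last first.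
    by rewrite (leq_trans (size_poly _ _)) // sW.
  rewrite big_ord_recl coef_map coef_poly /= rmorph0 mul0r add0r; apply: eq_bigr => j _.
  by rewrite -cE cW ?ltn_ord // ev_C coef_map.
have gam0 : gam`_0 = - hat Y d W.
  apply/eqP; rewrite -tofrac_eq rmorphN /= gamE // subn0 -cE c0W hat_frac ?sW //.
  by rewrite rmorphN mulrN.
move=> e; rewrite -oppr_eq0 -pcN -gam0 => /gam_cls; rewrite addn0 => /eqP ->.
by rewrite mod0n.
Qed.
End Luroth.

(** * Consequences of vanishing moments *)

Section MomentTheorems.
Variable F : numClosedFieldType.
Implicit Types (P Q W f : {poly F}) (a b : F).

(* The integrals of P^(i-1) P' Q from a to b vanish for all i > 0. *)
Definition moments P Q a b :=
  forall i f, (0 < i)%N -> f^`() = P ^+ i.-1 * P^`() * Q -> f.[a] = f.[b].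

Lemma moments_coprime_degrees P Q a b : P \is monic -> (1 < size P)%N -> Q != 0 -> a != b ->
  moments P Q a b -> ~~ coprime (size Q).-1 (size P).-1.
Proof.
move=> mP sP Q0 ab mom; apply/negP => cop.
have sPE : size P = (size P).-1.+1 by rewrite prednK // ltnW.
have n0 : (0 < (size P).-1)%N by lia.
have [Y [Y0 _ H]] := moments_coprime mP sPE n0 (leqSpred (size Q)) ab mom.
have := H 0%N (size Q).-1 cop; rewrite add0n => /(_ erefl) /eqP.
by rewrite pc_hat0 // -lead_coefE lead_coef_eq0 (negPf Q0).
Qed.

Lemma moments_comp P Q W a b : moments (P \Po W) (Q \Po W) a b -> moments P Q W.[a] W.[b].
Proof.
move=> mom i f i0 fE; rewrite -!horner_comp; apply: (mom i) => //.
rewrite deriv_comp fE !rmorphM rmorphXn /= deriv_comp; ring.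
Qed.

Theorem moments_prime_power r l P Q a b : prime r -> P \is monic -> size P = (r ^ l).+1 ->
  P.[a] = P.[b] -> a != b -> moments P Q a b ->
  exists Pt Qt W, [/\ W.[a] = W.[b], P = Pt \Po W & Q = Qt \Po W].
Proof.
move=> cpart; elim/ltn_ind: l P Q a b => l IH P Q a b mP sP Pab ab mom.
have r0 := prime_gt0 cpart.
have n0 : (0 < r ^ l)%N by rewrite expn_gt0 r0.
have [Y [Y0 hY H]] := moments_coprime mP sP n0 (leqnSn (size Q)) ab mom.
have [eps heps] := prim_root_exists F n0.
have [d [dn cd dmax]] := @max_class F Q (r ^ l) (size Q) Y n0.
have d0 : (0 < d)%N by exact: dvdn_gt0 dn.
have [W [mW sW cW]] := common_right_factor mP sP n0 (leqnSn (size Q)) Y0 hY heps dn cd dmax.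
have [||U UE] := @represent F W Y d Y0 d0 mW sW cW P (r ^ l).
- by rewrite sP.
- by rewrite hY => -[|e]; rewrite pc1 ?eqxx //= => _; rewrite mod0n (eqP dn).
have [V VE] := @represent F W Y d Y0 d0 mW sW cW Q _ (leqnSn _) cd.
have [Wab|Wab] := eqVneq W.[a] W.[b]; first by exists U, V, W.
have U0 : U != 0.
  by apply: contraTneq (monic_neq0 mP) => U0; rewrite UE U0 comp_poly0 eqxx.
have sU : ((size U).-1 * d = r ^ l)%N by have := size_comp_poly U W; rewrite -UE sP sW.
have sU1 : size U = (size U).-1.+1 by rewrite prednK // size_poly_gt0.
have /(dvdn_pfactor _ _ cpart)[l' l'l UrE] : ((size U).-1 %| r ^ l)%N by rewrite -sU dvdn_mulr.
(* For [l = 0] the polynomial [P] has degree 1 and cannot take the same value at [a] and [b]. *)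
have l0 : (0 < l)%N.
  rewrite lt0n; apply/eqP => l0; case/eqP: ab.
  have := sP; rewrite l0 expn0 => sP2.
  have E y : P.[y] = P`_0 + y.
    have P1 : P`_1 = 1 by have := monicP mP; rewrite lead_coefE sP2.
    by rewrite horner_coef sP2 big_ord_recl big_ord1 /= P1 mul1r expr0 expr1 mulr1.
  by move: Pab; rewrite !E => /addrI.
have rd : (r %| d)%N.
  apply: dmax; first by rewrite dvdn_exp.
  (* A natural number congruent to [size Q - e] mod [r^l], free of truncated subtraction. It is not
     prime to [r^l], so [r] divides it. *)
  move=> e pe; have := H e (size Q + e * (r ^ l).-1)%N.
  have -> : (e + (size Q + e * (r ^ l).-1) = e * r ^ l + size Q)%N.
    by rewrite addnCA -mulnS prednK // addnC.
  rewrite modnMDl => K; have : ~~ coprime (size Q + e * (r ^ l).-1) (r ^ l).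
    by apply/negP => /K/(_ erefl)/eqP; rewrite (negPf pe).
  rewrite coprime_sym coprime_pexpl // prime_coprime // negbK => rk.
  have E : (size Q + e * (r ^ l).-1 + e = size Q + e * r ^ l)%N.
    by rewrite -addnA -mulnSr prednK.
  have : (size Q + e * (r ^ l).-1 + e = e %[mod r])%N.
    by rewrite -modnDml (eqP rk) add0n.
  rewrite E -modnDmr; have -> : (e * r ^ l %% r = 0)%N.
    by apply/eqP; rewrite -/(dvdn _ _) dvdn_mull // dvdn_exp.
  by rewrite addn0.
(* Since [r] divides [d], the inner factor [W] has degree above 1 and the outer one a smaller power
   of [r]. *)
have ll : (l' < l)%N.
  rewrite ltn_neqAle l'l andbT; apply: contraTneq rd => l'E.
  have d1 : d = 1%N.
    by apply/eqP; rewrite -(eqn_pmul2l n0) muln1 -{1}l'E -UrE sU.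
  by rewrite d1 dvdn1 gtn_eqF // prime_gt1.
have mU : U \is monic.
  have := monicP mP; rewrite UE lead_coef_comp ?sW // (monicP mW) expr1n mulr1.
  by rewrite monicE => ->.
have [||||Pt [Qt [W' [W'ab PE QE]]]] := IH l' ll U V W.[a] W.[b] mU.
- by rewrite sU1 UrE.
- by rewrite -!horner_comp -UE.
- exact: Wab.
- by apply: moments_comp; rewrite -UE -VE.
exists Pt, Qt, (W' \Po W); split; first by rewrite !horner_comp.
  by rewrite UE PE comp_polyA.
by rewrite VE QE comp_polyA.
Qed.
End MomentTheorems.

(** * The formal Abel equation *)

Section Primitive.
(** A domain where positive integers are invertible rather than a field: [K] will also be the ring
    of polynomials in [eps]. *)
Variables (K : idomainType) (hK : forall n, n.+1%:R \is a @GRing.unit K) (a : K).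
Implicit Types f g h : {poly K}.

Definition primitive h : {poly K} := \poly_(i < (size h).+1) (h`_i.-1 / i%:R).
Definition integ h : {poly K} := primitive h - (primitive h).[a]%:P.

Lemma deriv_primitive h : (primitive h)^`() = h.
Proof.
apply/polyP => i; rewrite coef_deriv coef_poly ltnS; case: ltnP => hi.
  by rewrite -(mulr_natr (_ / _)) divrK.
by rewrite mul0rn nth_default.
Qed.
Lemma deriv_integ h : (integ h)^`() = h.
Proof. by rewrite derivB derivC subr0 deriv_primitive. Qed.
Lemma integ_a h : (integ h).[a] = 0.
Proof. by rewrite hornerD hornerN hornerC subrr. Qed.

Lemma deriv0_const f x y : f^`() = 0 -> f.[x] = f.[y].
Proof.
move=> h; have -> : f = (f`_0)%:P; last by rewrite !hornerC.
apply: size1_polyC; apply/leq_sizeP => -[|j] // _.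
have := coef_deriv f j; rewrite h coef0 => /esym/eqP.
rewrite -(mulr_natr f`_j.+1) mulf_eq0 => /orP[/eqP //|/eqP j0].
by have := hK j; rewrite j0 unitr0.
Qed.

Lemma integ_unique h f : f^`() = h -> integ h = f - f.[a]%:P.
Proof.
move=> fh; apply/eqP; rewrite -subr_eq0; apply/eqP; set g := _ - _.
have g' : g^`() = 0 by rewrite /g derivB deriv_integ derivB derivC subr0 fh subrr.
have ga : g.[a] = 0 by rewrite /g hornerD integ_a hornerN hornerD hornerN hornerC subrr oppr0 addr0.
apply/polyP => i; rewrite coef0; case: i => [|i].
  by rewrite -horner_coef0 -ga; exact: deriv0_const.
have := coef_deriv g i; rewrite g' coef0 => /esym/eqP.
rewrite -(mulr_natr g`_i.+1) mulf_eq0 => /orP[/eqP //|/eqP j0].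
by have := hK i; rewrite j0 unitr0.
Qed.

Fact integ_is_zmod : zmod_morphism integ.
Proof.
move=> f g; have H : (integ f - integ g)^`() = f - g by rewrite derivB !deriv_integ.
by rewrite (integ_unique H) hornerD hornerN !integ_a subr0 subr0.
Qed.
End Primitive.

Lemma integ_map (K L : idomainType) (hK : forall n, n.+1%:R \is a @GRing.unit K)
    (hL : forall n, n.+1%:R \is a @GRing.unit L) (th : {rmorphism K -> L}) a h :
  map_poly th (integ a h) = integ (th a) (map_poly th h).
Proof.
rewrite (integ_unique hL _ (f := map_poly th (integ a h))); last by rewrite deriv_map deriv_integ.
by rewrite horner_map integ_a rmorph0 subr0.
Qed.

Section MapSeries.
Variables (R S : comNzRingType).
Definition psmap (f : R -> S) (u : ps R) : ps S := PS (fun n => f (pc u n)).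
Lemma pc_map f u n : pc (psmap f u) n = f (pc u n). Proof. by []. Qed.
Variable f : {rmorphism R -> S}.
Fact psmap_is_zmod : zmod_morphism (psmap f).
Proof. by move=> u v; apply: psP => n; rewrite pc_map !pcB !pc_map rmorphB. Qed.
Fact psmap_is_monoid : monoid_morphism (psmap f).
Proof.
split; first by apply: psP => n; rewrite pc_map !pc1 rmorph_nat.
move=> u v; apply: psP => n; rewrite pc_map [in RHS]pcM [in LHS]pcM rmorph_sum.
by apply: eq_bigr => i _; rewrite rmorphM.
Qed.
HB.instance Definition _ := GRing.isZmodMorphism.Build (ps R) (ps S) (psmap f) psmap_is_zmod.
HB.instance Definition _ := GRing.isMonoidMorphism.Build (ps R) (ps S) (psmap f) psmap_is_monoid.
Lemma psmap_C c : psmap f (psC c) = psC (f c).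
Proof. by apply: psP => n; rewrite pc_map !pc_C; case: ifP => // _; rewrite rmorph0. Qed.
Lemma psmap_X : psmap f psX = psX.
Proof. by apply: psP => n; rewrite pc_map !pc_X rmorph_nat. Qed.
End MapSeries.

Section DerivSeries.
Variable K : comNzRingType.
Implicit Types u v : ps {poly K}.
Definition psD u : ps {poly K} := psmap (@deriv K) u.
Lemma psDD u v : psD (u + v) = psD u + psD v.
Proof. by apply: psP => n; rewrite pc_map !pcD derivD. Qed.
Lemma psDM u v : psD (u * v) = psD u * v + u * psD v.
Proof.
apply: psP => n; rewrite pc_map pcD !pcM raddf_sum -big_split.
by apply: eq_bigr => i _; rewrite /= derivM.
Qed.
Lemma psD_X : psD psX = 0.
Proof. by apply: psP => n; rewrite pc_map pc_X pc0; case: (_ == _); rewrite ?deriv0 -?polyC1 ?derivC. Qed.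
Lemma psD_C c : psD (psC c) = psC c^`().
Proof. by apply: psP => n; rewrite pc_map !pc_C; case: ifP => // _; rewrite deriv0. Qed.
Lemma psD1 : psD 1 = 0.
Proof. by apply: psP => n; rewrite pc_map pc1 pc0; case: (_ == _); rewrite ?deriv0 -?polyC1 ?derivC. Qed.
End DerivSeries.

Lemma rmorph_abel_rhs (R S : comNzRingType) (g : {rmorphism R -> S}) x c d y :
  g (x ^+ 2 * c * y ^+ 3 + x * d * y ^+ 2) = g x ^+ 2 * g c * g y ^+ 3 + g x * g d * g y ^+ 2.
Proof. by rewrite rmorphD !(rmorphM g (_ * _)) rmorphM (rmorphM g x) !rmorphXn. Qed.

Section FormalAbel.
Variables (K : idomainType) (hK : forall n, n.+1%:R \is a @GRing.unit K).
Variables (a : K) (p q : {poly K}) (e : K).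

Definition psJ (h : ps {poly K}) : ps {poly K} := psmap (integ a) h.
(** The integral equation for [y = s u]: dividing by [s] leaves [u' = s^2 p u^3 + s eps q u^2] with
    [u(a) = 1], and the powers of [s] make it X-adically contracting. *)
Definition picard (u : ps {poly K}) : ps {poly K} :=
  1 + psJ (psX ^+ 2 * psC p * u ^+ 3 + psX * psC (e%:P * q) * u ^+ 2).

Lemma psJD h : psD (psJ h) = h.
Proof. by apply: psP => n; rewrite !pc_map deriv_integ. Qed.

Lemma integ0 : integ a 0 = 0 :> {poly K}.
Proof. by rewrite -[X in integ a X](subrr 0) integ_is_zmod // subrr. Qed.

Lemma picard_eqm k u v : eqm k u v -> eqm k.+1 (picard u) (picard v).
Proof.
move=> uv; apply: eqmD; first exact: eqm_refl.
have : eqm k.+1 (psX ^+ 2 * psC p * u ^+ 3 + psX * psC (e%:P * q) * u ^+ 2)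
   (psX ^+ 2 * psC p * v ^+ 3 + psX * psC (e%:P * q) * v ^+ 2).
  apply: eqmD.
    rewrite expr2 -!mulrA; apply: eqmS_mulX; apply: eqmM; first exact: eqm_refl.
    by apply: eqmM; [exact: eqm_refl|exact: eqmE].
  by rewrite -!mulrA; apply: eqmS_mulX; apply: eqmM; [exact: eqm_refl|exact: eqmE].
by move=> H i ik; rewrite !pc_map (H i ik).
Qed.

Lemma abel_series : exists u, [/\ pc u 0 = 1, picard u = u & forall k, eqm k (iter k picard 1) u].
Proof.
have [||||u [u0 ue ul]] := @ps_fix {poly K} (fun u => pc u 0 = 1) picard 1.
- by rewrite pc1.
- move=> u _; rewrite pcD pc1 pc_map.
  have -> : pc (psX ^+ 2 * psC p * u ^+ 3 + psX * psC (e%:P * q) * u ^+ 2) 0 = 0.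
    have X0 : pc (psX : ps {poly K}) 0 = 0 by rewrite pc_X.
    by rewrite pcD !pc0M !X0 !mul0r addr0.
  by rewrite integ0 addr0.
- by move=> u /(_ 1%N)[g g0 fg]; rewrite fg.
- by move=> k u v _ _; exact: picard_eqm.
by exists u.
Qed.

Variables (u : ps {poly K}) (u0 : pc u 0 = 1) (ue : picard u = u).
Local Notation Z := (u^-1).

Lemma psD_u : psD u = psX ^+ 2 * psC p * u ^+ 3 + psX * psC (e%:P * q) * u ^+ 2.
Proof. by rewrite -{1}ue /picard psDD psD1 add0r psJD. Qed.

Lemma psD_Z2 : psD (Z ^+ 2) = - (psX ^+ 2 * psC p + psX * psC (e%:P * q) * Z) *+ 2.
Proof.
have uu := ps_unit1 u0.
have ZD : psD Z = - (Z ^+ 2 * psD u).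
  have : psD (u * Z) = 0 by rewrite divrr // psD1.
  rewrite psDM => /(congr1 (fun w => Z * w)); rewrite mulrDr mulr0 [Z * (u * _)]mulrA mulVr // mul1r => /eqP.
  rewrite addrC addr_eq0 => /eqP ->; congr (- _).
  by rewrite expr2 -mulrA [psD u * _]mulrC.
have uZ : u * Z = 1 by rewrite divrr.
move: (psD u) psD_u ZD => Du -> ZD; rewrite expr2 psDM ZD.
have R1 (R : comNzRingType) (x c1 c2 y z : R) : y * z = 1 ->
   - (z ^+ 2 * (x ^+ 2 * c1 * y ^+ 3 + x * c2 * y ^+ 2)) * z +
   z * - (z ^+ 2 * (x ^+ 2 * c1 * y ^+ 3 + x * c2 * y ^+ 2)) =
   - (x ^+ 2 * c1 + x * c2 * z) *+ 2.
  move=> h; transitivity (- (x ^+ 2 * c1 * (y * z) ^+ 3 + x * c2 * (y * z) ^+ 2 * z) *+ 2); first by ring.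
  by rewrite h !expr1n !mulr1.
exact: R1.
Qed.

Lemma psD_const (T : ps {poly K}) x y : psD T = 0 ->
  psmap (horner_eval x) T = psmap (horner_eval y) T.
Proof.
move=> h; apply: psP => n; rewrite !pc_map; apply: (deriv0_const hK).
by have := congr1 (fun T => pc T n) h; rewrite pc_map.
Qed.

Lemma ev_a_u : psmap (horner_eval a) u = 1.
Proof.
rewrite -ue rmorphD rmorph1 -[RHS]addr0; congr (_ + _).
by apply: psP => n; rewrite !pc_map; exact: integ_a.
Qed.

Lemma ev_inv_u y : psmap (horner_eval y) u = 1 -> psmap (horner_eval y) Z = 1.
Proof.
move=> h; have : psmap (horner_eval y) (u * Z) = 1 by rewrite divrr ?ps_unit1 // rmorph1.
by rewrite rmorphM /= h mul1r.
Qed.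

(** With [J] the integral of [q Z], the series [Z^2 + 2 s^2 P + 2 s e J] is constant in [x].
    Comparing its values at [a] and [b], where [Z = 1], leaves [s e J(b) = 0], and [s e] can be
    cancelled in a domain. *)
Lemma center_integ b P : P^`() = p -> P.[a] = P.[b] -> e != 0 ->
  psmap (horner_eval b) u = 1 -> forall j, (integ a (q * pc Z j)).[b] = 0.
Proof.
move=> PE Pab e0 ub; pose J := psJ (psC q * Z).
pose A := psX ^+ 2 * psC P; pose B := psX * (psC e%:P * J); pose T := Z ^+ 2 + (A + A) + (B + B).
have DT : psD T = 0.
  rewrite /T /A /B !psDD psD_Z2 !psDM !psD_C !psD_X PE derivC psJD.
  rewrite rmorphM /= (_ : psC 0 = 0); last exact: rmorph0.
  have R1 (R : comNzRingType) (x c1 c2 c3 c4 c5 z : R) :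
    - (x ^+ 2 * c1 + x * (c2 * c3) * z) *+ 2 +
    ((0 * x + x * 0) * c4 + x ^+ 2 * c1 + ((0 * x + x * 0) * c4 + x ^+ 2 * c1)) +
    (0 * (c2 * c5) + x * (0 * c5 + c2 * (c3 * z)) +
     (0 * (c2 * c5) + x * (0 * c5 + c2 * (c3 * z)))) = 0 by ring.
  exact: R1.
have ET y : psmap (horner_eval y) Z = 1 -> psmap (horner_eval y) T =
    1 + (psX ^+ 2 * psC P.[y] + psX ^+ 2 * psC P.[y]) +
    psX * (psC e * psmap (horner_eval y) J) *+ 2.
  move=> Zy; have Ay : psmap (horner_eval y) A = psX ^+ 2 * psC P.[y].
    by rewrite rmorphM rmorphXn /= psmap_X psmap_C.
  have By : psmap (horner_eval y) B = psX * (psC e * psmap (horner_eval y) J).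
    by rewrite !rmorphM /= psmap_X psmap_C /= [horner_eval _ _]hornerC.
  by rewrite mulr2n -Ay -By /T !rmorphD rmorphXn /= Zy expr1n.
have := psD_const a b DT; rewrite !ET ?ev_inv_u ?ev_a_u // Pab.
have -> : psmap (horner_eval a) J = 0.
  by apply: psP => n; rewrite !pc_map; exact: integ_a.
rewrite !mulr0 mul0rn => /addrI/esym/eqP.
have two : (2%:R : ps K) != 0.
  apply/eqP => /(congr1 (fun f : ps K => pc f 0)) /eqP; rewrite pcMn pc1 pc0.
  by apply/negP; have := hK 1; apply: contraTneq => ->; rewrite unitr0.
have X0 : (psX : ps K) != 0.
  by apply/eqP => /(congr1 (fun f : ps K => pc f 1)) /eqP; rewrite pc_X pc0 oner_eq0.
have pe0 : psC e != 0.
  by apply: contraNneq e0 => /(congr1 (fun f : ps K => pc f 0)); rewrite pc_C pc0 /= => ->.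
rewrite -mulr_natl !mulf_eq0 (negPf two) (negPf X0) (negPf pe0) /= => /eqP EJ j.
by have := congr1 (fun f => pc f j) EJ; rewrite !pc_map pcCM pc0.
Qed.

(** Only after the cancellation above is [e] specialized to 0, here through the morphism [th]. *)
Lemma inv_u_spec (L : idomainType) (hL : forall n, n.+1%:R \is a @GRing.unit L)
    (th : {rmorphism K -> L}) P : P^`() = p -> P.[a] = 0 -> th e = 0 ->
  psmap (map_poly th) Z ^+ 2 = 1 - (psX ^+ 2 * psC (map_poly th P)) *+ 2.
Proof.
move=> PE Pa the.
have Dmap (v : ps {poly K}) : psD (psmap (map_poly th) v) = psmap (map_poly th) (psD v).
  by apply: psP => n; rewrite !pc_map deriv_map.
pose A := psX ^+ 2 * psC P; pose T := psmap (map_poly th) (Z ^+ 2 + (A + A)).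
have DT : psD T = 0.
  rewrite Dmap /A !psDD psD_Z2 !psDM !psD_C PE !psD_X.
  have R1 (R : comNzRingType) (x c1 c2 c3 z : R) : - (x ^+ 2 * c1 + x * c2 * z) *+ 2 +
     ((0 * x + x * 0) * c3 + x ^+ 2 * c1 + ((0 * x + x * 0) * c3 + x ^+ 2 * c1)) = - (x * c2 * z) *+ 2.
    by ring.
  have E0 : psmap (map_poly th) (psC (e%:P * q)) = 0.
    by rewrite psmap_C /= rmorphM /= map_polyC /= the polyC0 mul0r; exact: rmorph0.
  by rewrite R1 rmorphMn rmorphN /= rmorphM /= rmorphM /= E0 mulr0 mul0r oppr0 mul0rn.
have Ey (L' : comNzRingType) (y : L') (f : {rmorphism {poly K} -> L'}) : f P = y -> psmap f A = psX ^+ 2 * psC y.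
  by move=> <-; rewrite rmorphM rmorphXn /= psmap_X psmap_C.
have TE : T = 1.
  apply: psP => n; have Tn : (pc T n)^`() = 0.
    by have := congr1 (fun f => pc f n) DT; rewrite pc_map.
  have E : pc T n = (pc T n).[th a]%:P.
    have := @integ_unique _ hL (th a) 0 (pc T n); rewrite Tn => /(_ erefl).
    have -> : integ (th a) 0 = 0 by rewrite -[X in integ _ X](subrr 0) integ_is_zmod // subrr.
    by move/esym/eqP; rewrite subr_eq0 => /eqP.
  rewrite E pc_map horner_map.
  have -> : (pc (Z ^+ 2 + (A + A)) n).[a] = pc 1 n.
    have : psmap (horner_eval a) (Z ^+ 2 + (A + A)) = 1.
      have A0 : psmap (horner_eval a) A = 0.
        by rewrite (Ey _ 0) // rmorph0 mulr0.
      by rewrite !rmorphD rmorphXn /= ev_inv_u ?ev_a_u // A0 !addr0 expr1n.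
    by move/(congr1 (fun f => pc f n)); rewrite pc_map.
  by rewrite !pc1 !rmorph_nat.
move: TE; rewrite /T !rmorphD rmorphXn /= (Ey _ (map_poly th P)) // -mulr2n => <-.
by rewrite addrK.
Qed.
End FormalAbel.

Section SquareRoot.
Variables (F : numFieldType) (P : {poly F}) (Z : ps {poly F}).
Hypotheses (Z0 : pc Z 0 = 1) (ZE : Z ^+ 2 = 1 - (psX ^+ 2 * psC P) *+ 2).

Lemma poly_mul2_eq0 (f : {poly F}) : f *+ 2 = 0 -> f = 0.
Proof. by rewrite -scaler_nat => /eqP; rewrite scaler_eq0 pnatr_eq0 => /eqP. Qed.

Lemma sqrt_rec j : pc Z j.+1 *+ 2 = (if j == 1%N then - P *+ 2 else 0)
  - \sum_(i < j) pc Z i.+1 * pc Z (j - i).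
Proof.
have := congr1 (fun f => pc f j.+1) ZE.
rewrite pcB pc1 pcMn pcXnM expr2 pcM sub0r.
rewrite big_ord_recl big_ord_recr /= Z0 subn0 mul1r /bump /= add1n subnn Z0 mulr1 => H.
have E : \sum_(i < j) pc Z (1 + i) * pc Z (j.+1 - (1 + i)) = \sum_(i < j) pc Z i.+1 * pc Z (j - i).
  by apply: eq_bigr => i _; rewrite add1n subSS.
rewrite E in H.
have -> : (if j == 1%N then - P *+ 2 else 0) =
    - ((if (2 <= j.+1)%N then pc (psC P) (j.+1 - 2) else 0) *+ 2).
  case: (j) => [|[|i]] //=; rewrite ?pc_C ?mulNrn //= ?mul0rn ?oppr0 //.
by rewrite -H mulr2n; ring.
Qed.

Lemma sqrt_odd l : pc Z l.*2.+1 = 0.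
Proof.
elim/ltn_ind: l => l IH; have := sqrt_rec l.*2.
have -> : (l.*2 == 1)%N = false by lia.
rewrite sub0r big1 ?oppr0 => [|i _]; first exact: poly_mul2_eq0.
have [io|io] := boolP (odd i).
  have [k kE] : exists k, (l.*2 - i = k.*2.+1)%N by exists (l.*2 - i)./2; have := ltn_ord i; lia.
  by rewrite kE [pc Z k.*2.+1]IH ?mulr0 //; have := ltn_ord i; lia.
have [k kE] : exists k, (i.+1 = k.*2.+1)%N by exists i./2; lia.
by rewrite kE [pc Z k.*2.+1]IH ?mul0r //; have := ltn_ord i; lia.
Qed.

(** What matters is [c != 0]. The sign gives it without a formula for binomial coefficients: the
    recursion expresses each coefficient as minus half a sum of products of two negative ones. *)
Lemma sqrt_even l : (0 < l)%N -> exists2 c, c < 0 & pc Z l.*2 = c *: P ^+ l.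
Proof.
elim/ltn_ind: l => l IH l0.
have [->|l1] := eqVneq l 1%N.
  exists (- 1); first by rewrite oppr_lt0 ltr01.
  have := sqrt_rec 1; rewrite eqxx big_ord1 /= -[1%N]/(0.*2.+1) sqrt_odd mul0r subr0 => /eqP.
  rewrite -subr_eq0 -mulrnBl => /eqP/poly_mul2_eq0/eqP; rewrite subr_eq0 => /eqP ->.
  by rewrite expr1 scaleN1r.
pose nn (f : {poly F}) := exists2 t, 0 <= t & f = t *: P ^+ l.
have term i : (i < l.*2.-1)%N -> nn (pc Z i.+1 * pc Z (l.*2.-1 - i)).
  move=> il; have [io|io] := boolP (odd i); last first.
    have [k kE] : exists k, (i.+1 = k.*2.+1)%N by exists i./2; lia.
    by exists 0; rewrite // kE sqrt_odd mul0r scale0r.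
  have [k kE] : exists k, (i.+1 = k.*2)%N by exists i.+1./2; lia.
  have kE2 : (l.*2.-1 - i = (l - k).*2)%N by lia.
  have [||c c0 cE] := IH k; [lia|lia|].
  have [||c' c'0 c'E] := IH (l - k)%N; [lia|lia|].
  exists (c * c'); first by rewrite mulr_le0 // ltW.
  rewrite kE kE2 cE c'E -scalerAl -scalerAr scalerA -exprD subnKC //; lia.
have lE : l.*2 = l.*2.-1.+1 by lia.
have l3 : (1 < l.*2.-1)%N by lia.
(* One term known to be strictly positive; the remaining ones need only be nonnegative. *)
have [t0 t0p t0E] : exists2 t, 0 < t & pc Z 2 * pc Z (l.*2.-1 - 1) = t *: P ^+ l.
  have [||c c0 cE] := IH 1%N; [lia|lia|].
  have [||c' c'0 c'E] := IH l.-1; [lia|lia|].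
  exists (c * c'); first by rewrite nmulr_rgt0.
  have -> : (l.*2.-1 - 1 = l.-1.*2)%N by lia.
  rewrite -[2%N]/(1.*2) cE c'E -scalerAl -scalerAr scalerA -exprD.
  by congr (_ *: _ ^+ _); lia.
have [t t0' tE] : nn (\sum_(i < l.*2.-1 | i != Ordinal l3) pc Z i.+1 * pc Z (l.*2.-1 - i)).
  elim/big_rec: _ => [|i f _ [t t1 ->]]; first by exists 0; rewrite ?scale0r.
  have [t' t'0 ->] := term i (ltn_ord i).
  by exists (t' + t); rewrite ?addr_ge0 // scalerDl.
exists (- (t0 + t) / 2%:R).
  by rewrite pmulr_llt0 ?invr_gt0 ?ltr0n // oppr_lt0 ltr_wpDr.
have two : 2%:R != 0 :> F by rewrite pnatr_eq0.
have := sqrt_rec l.*2.-1; rewrite -lE (bigD1 (Ordinal l3)) //= t0E tE.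
have -> : (l.*2.-1 == 1)%N = false by lia.
rewrite sub0r -scalerDl => H.
apply: (scalerI two); rewrite scalerA mulrC divfK //.
by rewrite scaler_nat scaleNr -H.
Qed.
End SquareRoot.

Lemma poly_eval0 (F : numFieldType) (f : {poly F}) : (forall x, f.[x] = 0) -> f = 0.
Proof.
move=> h; apply/eqP; apply: contraT => f0.
have := max_poly_roots f0 (rs := [seq i%:R | i <- iota 0 (size f)]).
rewrite size_map size_iota ltnn => H; apply: H.
  by apply/allP => _ /mapP[i _ ->]; rewrite rootE h.
by rewrite map_inj_uniq ?iota_uniq // => i j /eqP; rewrite eqr_nat => /eqP.
Qed.

Section Moments.
Variables (F : numFieldType) (P Q : {poly F}) (a b : F).
Hypotheses (Pa : P.[a] = 0) (Pb : P.[b] = 0) (Qa : Q.[a] = 0) (Qb : Q.[b] = 0).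

Lemma num_unit n : n.+1%:R \is a @GRing.unit F.
Proof. by rewrite unitfE pnatr_eq0. Qed.
Lemma num_unit_poly n : n.+1%:R \is a @GRing.unit {poly F}.
Proof. by rewrite -polyC_natr poly_unitE size_polyC coefC /= pnatr_eq0 /= num_unit. Qed.

Local Notation lift := (map_poly (@polyC F)).

Lemma center_moments :
  (forall eps k j, (0 < j)%N -> (j < k)%N -> (pc (iter k (picard a P^`() Q^`() eps) 1) j).[b] = 0) ->
  forall i f, (0 < i)%N -> f^`() = P ^+ i.-1 * P^`() * Q -> f.[a] = f.[b].
Proof.
move=> H i f i0 fE.
(* [eps] is now the indeterminate of the coefficient ring. *)
have [u [u0 ue ul]] := abel_series num_unit_poly a%:P (lift P^`()) (lift Q^`()) ('X : {poly F}).
have spec (eps : F) k : psmap (map_poly (horner_eval eps)) (iter k (picard a%:P (lift P^`()) (lift Q^`()) 'X) 1)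
    = iter k (picard a P^`() Q^`() eps) 1.
  elim: k => [|k IH] /=; first exact: rmorph1.
  rewrite -IH /picard; move: (iter k _ _) => v.
  have liftK (g : {poly F}) : map_poly (horner_eval eps) (lift g) = g.
    rewrite -map_poly_comp map_poly_id // => c _ /=; exact: hornerC.
  have Jmap h : psmap (map_poly (horner_eval eps)) (psJ a%:P h) = psJ a (psmap (map_poly (horner_eval eps)) h).
    apply: psP => n; rewrite !pc_map (integ_map num_unit_poly num_unit).
    by congr (integ _ _); exact: hornerC.
  rewrite rmorphD rmorph1 /= Jmap; congr (1 + psJ _ _).
  rewrite (rmorph_abel_rhs (psmap (map_poly (horner_eval eps)))) /= !psmap_X !psmap_C /= liftK.
  by rewrite rmorphM /= map_polyC /= liftK [horner_eval _ _]hornerX.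
(* Each coefficient at [b] is a polynomial in [eps] that vanishes at every value; the iterate [j.+2]
   already has the final coefficient at [j.+1]. *)
have ub : psmap (horner_eval b%:P) u = 1.
  apply: psP => j; rewrite pc_map pc1; case: j => [|j].
    by rewrite u0 [LHS]hornerC.
  apply: poly_eval0 => eps; have := H eps j.+2 j.+1 isT (ltnSn _).
  rewrite -spec pc_map (ul j.+2 j.+1 (ltnSn _)) => <-.
  by have := horner_map (horner_eval eps) (pc u j.+1) b%:P; rewrite /= [horner_eval eps b%:P]hornerC.
pose th : {rmorphism {poly F} -> F} := @horner_eval F 0.
have liftK (g : {poly F}) : map_poly th (lift g) = g.
  rewrite -map_poly_comp map_poly_id // => c _ /=; exact: hornerC.
have PE : (lift P)^`() = lift P^`() by rewrite deriv_map.
have hE y : (lift P).[y%:P] = P.[y]%:P by rewrite horner_map.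
have X0 : ('X : {poly F}) != 0 by rewrite polyX_eq0.
have I1 := center_integ num_unit_poly u0 ue PE (etrans (hE a) (etrans (congr1 _ (etrans Pa (esym Pb))) (esym (hE b)))) X0 ub.
have thX : th 'X = 0 by exact: hornerX.
have Pa' : (lift P).[a%:P] = 0 by rewrite hE Pa.
have ZE := inv_u_spec num_unit_poly u0 ue num_unit (th := th) PE Pa' thX.
rewrite liftK in ZE; set Z := psmap _ _ in ZE.
have Z0 : pc Z 0 = 1 by rewrite pc_map pc0V // rmorph1.
have I2 j : (integ a (Q^`() * pc Z j)).[b] = 0.
  have := congr1 th (I1 j); rewrite rmorph0.
  have := horner_map th (integ a%:P (lift Q^`() * pc u^-1 j)) b%:P.
  rewrite (integ_map num_unit_poly num_unit) rmorphM /= liftK.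
  by rewrite [th b%:P]hornerC [th a%:P]hornerC => -> .
have [c c0 ZiE] := sqrt_even Z0 ZE i0.
have I3 : (integ a (Q^`() * P ^+ i)).[b] = 0.
  have := I2 i.*2; rewrite ZiE -scalerAr.
  have E : (c *: integ a (Q^`() * P ^+ i))^`() = c *: (Q^`() * P ^+ i).
    by rewrite derivZ deriv_integ //; exact: num_unit.
  rewrite (integ_unique num_unit a E) hornerD hornerN hornerC !hornerZ integ_a mulr0 subr0 => /eqP.
  by rewrite mulf_eq0 (lt_eqF c0) => /eqP.
(* Integration by parts from [P^i Q'] to [i P^(i-1) P' Q], with no boundary term because [Q]
   vanishes at both ends. *)
pose g := P ^+ i * Q - f *+ i.
have gE : g^`() = Q^`() * P ^+ i.
  by rewrite /g derivB derivMn fE derivM deriv_exp; ring.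
have E := integ_unique num_unit a gE; move: I3.
rewrite E /g hornerD hornerN hornerC !hornerD !hornerN !hornerM Qa Qb !mulr0 !sub0r opprK !hornerMn.
rewrite addrC -mulrnBl => /eqP; rewrite mulrn_eq0 (gtn_eqF i0) /= subr_eq0 => /eqP //.
Qed.
End Moments.

(** * Polynomial iterates and the center *)

Section PolySeries.
Variable K : comNzRingType.
Definition pol2ps (U : {poly K}) : ps K := PS (fun j => U`_j).
Lemma pc_pol2ps U j : pc (pol2ps U) j = U`_j. Proof. by []. Qed.
Fact pol2ps_is_zmod : zmod_morphism pol2ps.
Proof. by move=> u v; apply: psP => n; rewrite pcB !pc_pol2ps coefB. Qed.
Fact pol2ps_is_monoid : monoid_morphism pol2ps.
Proof.
split; first by apply: psP => n; rewrite pc_pol2ps pc1 coef1.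
move=> u v; apply: psP => n; rewrite pc_pol2ps [RHS]pcM coefM.
by apply: eq_bigr => i _.
Qed.
HB.instance Definition _ := GRing.isZmodMorphism.Build {poly K} (ps K) pol2ps pol2ps_is_zmod.
HB.instance Definition _ := GRing.isMonoidMorphism.Build {poly K} (ps K) pol2ps pol2ps_is_monoid.
Lemma pol2ps_C c : pol2ps c%:P = psC c.
Proof. by apply: psP => n; rewrite pc_pol2ps coefC pc_C. Qed.
Lemma pol2ps_X : pol2ps 'X = psX.
Proof. by apply: psP => n; rewrite pc_pol2ps coefX pc_X. Qed.
End PolySeries.

Section Iterates.
Variables (F : numFieldType) (a e : F) (p q : {poly F}).

(** The Picard step exists in three forms: here [s] is a number, as needed for estimates; in
    [picard_gen_step] it is a polynomial variable; in [picard] it is a series variable. *)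
Definition picard_step (s : F) (f : {poly F}) : {poly F} :=
  1 + integ a (s ^+ 2 *: (p * f ^+ 3) + (s * e) *: (q * f ^+ 2)).

(* The outer variable is the initial value s. *)
Definition picard_gen_step (U : {poly {poly F}}) : {poly {poly F}} :=
  1 + map_poly (integ a) ('X ^+ 2 * p%:P * U ^+ 3 + 'X * (e%:P * q)%:P * U ^+ 2).

Lemma integ_scale c h : integ a (c *: h) = c *: integ a h :> {poly F}.
Proof.
have E : (c *: integ a h)^`() = c *: h by rewrite derivZ deriv_integ //; exact: num_unit.
by rewrite (integ_unique (@num_unit F) a E) hornerZ integ_a mulr0 polyC0 subr0.
Qed.

Fact integ_is_additive : zmod_morphism (@integ F a).
Proof. exact: (integ_is_zmod (@num_unit F)). Qed.
HB.instance Definition _ := GRing.isZmodMorphism.Build {poly F} {poly F} (@integ F a) integ_is_additive.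

Lemma integ_outer_horner (V : {poly {poly F}}) s :
  (map_poly (integ a) V).[s%:P] = integ a V.[s%:P].
Proof.
rewrite (horner_coef_wide (n := size V)) ?size_poly // horner_coef raddf_sum.
apply: eq_bigr => i _; rewrite coef_map_id0 ?raddf0 //.
by rewrite -!rmorphXn /= ![_ * _%:P]mulrC !mul_polyC integ_scale.
Qed.

Lemma picard_gen_horner k s : (iter k picard_gen_step 1).[s%:P] = iter k (picard_step s) 1.
Proof.
elim: k => [|k IH]; first by rewrite hornerC.
rewrite [in LHS]iterS [in RHS]iterS -IH; set U := iter k _ _.
rewrite /picard_gen_step /picard_step hornerD hornerC integ_outer_horner.
rewrite !(hornerD, hornerM, hornerX, hornerC, hornerXn, horner_exp).
by congr (1 + integ a _); rewrite -!mul_polyC polyC_exp polyCM; ring.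
Qed.

Lemma picard_gen_series k : pol2ps (iter k picard_gen_step 1) = iter k (picard a p q e) 1.
Proof.
elim: k => [|k IH]; first exact: rmorph1.
rewrite [in LHS]iterS [in RHS]iterS -IH; set U := iter k _ _.
apply: psP => j; rewrite pc_pol2ps /picard_gen_step /picard coefD pcD coef1 pc1.
rewrite coef_map_id0 ?raddf0 // pc_map; congr (_ + integ a _).
rewrite -pc_pol2ps; congr (pc _ j).
by rewrite (rmorph_abel_rhs (@pol2ps {poly F})) /= !pol2ps_C pol2ps_X.
Qed.

Lemma picard_step_comp (pt qt W : {poly F}) b s k :
  p = (pt \Po W) * W^`() -> q = (qt \Po W) * W^`() -> W.[a] = W.[b] ->
  exists g, iter k (picard_step s) 1 = g \Po W.
Proof.
move=> pE qE Wab; elim: k => [|k [g gE]]; first by exists 1; rewrite comp_polyC.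
(* Change of variable: the integration is done in [W], from [W(a)]. *)
pose h := integ W.[a] (s ^+ 2 *: (pt * g ^+ 3) + (s * e) *: (qt * g ^+ 2)).
exists (1 + h); rewrite iterS gE /picard_step comp_polyD comp_polyC; congr (1 + _).
have E : (h \Po W)^`() = s ^+ 2 *: (p * (g \Po W) ^+ 3) + (s * e) *: (q * (g \Po W) ^+ 2).
  rewrite deriv_comp deriv_integ ?comp_polyD ?comp_polyZ ?comp_polyM ?rmorphXn /=; last exact: num_unit.
  by rewrite pE qE -!mul_polyC; ring.
by rewrite (integ_unique (@num_unit F) a E) horner_comp integ_a subr0.
Qed.

Lemma picard_step_comp_end (pt qt W : {poly F}) b s k :
  p = (pt \Po W) * W^`() -> q = (qt \Po W) * W^`() -> W.[a] = W.[b] ->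
  (iter k (picard_step s) 1).[b] = 1.
Proof.
move=> pE qE Wab; have [g gE] := picard_step_comp s k pE qE Wab.
rewrite gE horner_comp -Wab -horner_comp -gE.
by case: k gE => [|k] _; rewrite ?hornerC // iterS hornerD hornerC integ_a addr0.
Qed.
End Iterates.

(** Writing [f = g X + c], smallness near 0 forces [c = 0], and dividing by [s] passes the estimate
    on to [g]. *)
Lemma coef_eq0_of_small (F : numFieldType) (f : {poly F}) (A d : F) k : 0 <= A -> 0 < d ->
  (forall s, 0 < s -> s < d -> `|f.[s]| <= A * s ^+ k) -> forall j, (j < k)%N -> f`_j = 0.
Proof.
elim: k f => // k IH f A0 d0 H.
have [g [c fE]] : exists g c, f = g * 'X + c%:P.
  by elim/poly_ind: f {H} => [|g c _]; [exists 0, 0; rewrite mul0r addr0|exists g, c].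
have fs s : f.[s] = g.[s] * s + c by rewrite fE hornerMXaddC.
pose B := \sum_(i < size g) `|g`_i|; have B0 : 0 <= B by apply: sumr_ge0.
have gB s : 0 < s -> s < 1 -> `|g.[s]| <= B.
  move=> s0 s1; rewrite horner_coef; apply: (le_trans (ler_norm_sum _ _ _)); apply: ler_sum => i _.
  rewrite normrM ler_piMr // normrX exprn_ile1 // gtr0_norm //; exact: ltW.
have c0 : c = 0.
  apply/eqP; apply: contraT => cn; have nc : 0 < `|c| by rewrite normr_gt0.
  have d1 : 0 < 1 + d by rewrite ltr_wpDr ?ltW.
  pose N := `|c| + A + B + 1; have N0 : 0 < N by rewrite ltr_wpDl ?ltr01 // !addr_ge0 // ltW.
  (* Both factors lie strictly between 0 and 1, the first also below [d]; so [s] is below 1, [d] and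
     [|c| / N], and the last makes [(A + B) s < |c|]. *)
  pose s := d / (1 + d) * (`|c| / N).
  have d20 : 0 < d / (1 + d) by rewrite divr_gt0.
  have d2d : d / (1 + d) < d by rewrite ltr_pdivrMr // ltr_pMr // ltrDl.
  have d21 : d / (1 + d) < 1 by rewrite ltr_pdivrMr // mul1r ltrDr.
  have h0 : 0 < `|c| / N by rewrite divr_gt0.
  have h1 : `|c| / N < 1.
    by rewrite ltr_pdivrMr // mul1r /N -!addrA ltrDl ltr_wpDl // ltr_wpDl.
  have s0 : 0 < s by rewrite mulr_gt0.
  have s1 : s < 1 by rewrite /s mulr_ilt1 // ltW.
  have sd : s < d by apply: lt_trans d2d; rewrite /s gtr_pMr.
  have sh : s < `|c| / N by rewrite /s gtr_pMl.
  have : `|c| <= (A + B) * s.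
    have -> : c = f.[s] - g.[s] * s by rewrite fs; ring.
    apply: (le_trans (ler_normB _ _)); rewrite mulrDl lerD //.
      apply: (le_trans (H s s0 sd)); rewrite ler_wpM2l // exprS ler_piMr ?(ltW s0) //.
      by rewrite exprn_ile1 // ltW.
    by rewrite normrM (gtr0_norm s0) ler_wpM2r ?gB // ltW.
  move=> le1; have : (A + B) * s < `|c|.
    have AB0 : 0 <= A + B by rewrite addr_ge0.
    apply: (@le_lt_trans _ _ ((A + B) * (`|c| / N))).
      by rewrite ler_wpM2l // ltW.
    rewrite mulrA ltr_pdivrMr // mulrC ltr_pM2l //.
    have -> : N = A + B + (`|c| + 1) by rewrite /N; ring.
    by rewrite ltrDl addr_gt0.
  by move=> lt1; have := le_lt_trans le1 lt1; rewrite ltxx.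
have gk : forall j, (j < k)%N -> g`_j = 0.
  apply: (IH g A0 d0) => s s0 sd; have := H s s0 sd.
  rewrite fs c0 addr0 normrM (gtr0_norm s0) exprSr mulrA ler_pM2r //.
by case=> [|j] jk; rewrite fE c0 addr0 coefMX //= gk.
Qed.

(** * Transfer between the two models of the complex numbers *)

Local Notation F := (complex Rdefinitions.R).

Definition toF (z : C) : F := @mathcomp.real_closed.complex.Complex _ (fst z) (snd z).
Definition ofF (z : F) : C := (complex.Re z, complex.Im z).

Lemma toFK : cancel toF ofF. Proof. by case. Qed.
Lemma ofFK : cancel ofF toF. Proof. by case. Qed.
Lemma toFD x y : toF (Cplus x y) = toF x + toF y. Proof. by []. Qed.
Lemma toFN x : toF (Copp x) = - toF x. Proof. by []. Qed.
Lemma toFM x y : toF (Cmult x y) = toF x * toF y.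
Proof. by []. Qed.
Lemma toF_nat n : toF (RtoC (INR n)) = n%:R.
Proof.
elim: n => [|n IH]; first by [].
by rewrite S_INR RtoC_plus toFD IH -addn1 natrD.
Qed.
Lemma toF_norm z : `|toF z| = toF (RtoC (Cmod z)).
Proof.
case: z => x y; rewrite /toF /= normc_def /= /Cmod /=.
by rewrite -RsqrtE; congr (mathcomp.real_closed.complex.Complex (sqrt _) _); rewrite !expr2 !Rmult_1_r.
Qed.

Definition pol (P : cpoly) : {poly F} := Poly (map toF P).

Lemma horner_pol P x : (pol P).[toF x] = toF (peval P x).
Proof.
rewrite /pol; elim: P => [|c P IH] /=; first exact: horner0.
by rewrite horner_cons IH toFD toFM addrC mulrC.
Qed.
Lemma coef_pol P i : (pol P)`_i = toF (coef P i).
Proof.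
rewrite coef_Poly /coef; elim: P i => [|c P IH] [|i] //=.
Qed.
Lemma deriv_pol P : (pol P)^`() = pol (pderiv P).
Proof.
apply/polyP => i; rewrite coef_deriv !coef_pol.
case: P => [|c P]; first by case: i => [|i]; exact: mul0rn.
suff H k j : toF (List.nth j P (RtoC 0)) *+ (k + j) = toF (List.nth j (pderiv_aux k P) (RtoC 0)).
  exact: (H 1%N i).
elim: P k j => [|d P IH] k [|j] /=; rewrite ?mul0rn //.
  by rewrite toFM toF_nat addn0 mulr_natl.
by rewrite -IH addnS addSn.
Qed.

Definition ofpol (p : {poly F}) : cpoly := map ofF p.
Lemma ofpolK p : pol (ofpol p) = p.
Proof. by rewrite /pol /ofpol -map_comp (eq_map ofFK) map_id polyseqK. Qed.
Lemma peval_ofpol p x : peval (ofpol p) x = ofF p.[toF x].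
Proof. by apply: (can_inj toFK); rewrite -horner_pol ofpolK ofFK. Qed.

Lemma Der_horner (p : {poly F}) a b t :
  Der (fun t => ofF p.[toF (seg a b t)]) t (ofF ((toF b - toF a) * p^`().[toF (seg a b t)])).
Proof.
elim/poly_ind: p => [|p c IH].
  rewrite deriv0 horner0 mulr0.
  have -> : (fun t => ofF (0 : {poly F}).[toF (seg a b t)]) = (fun _ => ofF 0).
    by apply/funext => x; rewrite horner0.
  exact: Der_const.
have -> : (fun t => ofF (p * 'X + c%:P).[toF (seg a b t)]) =
  (fun t => Cplus (Cmult (ofF p.[toF (seg a b t)]) (seg a b t)) (ofF c)).
  apply/funext => x; apply: (can_inj toFK).
  by rewrite toFD toFM !ofFK hornerMXaddC.
have H := Der_plus _ _ _ _ _ (Der_mult _ _ _ _ _ IH (Der_seg a b t)) (Der_const (ofF c) t).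
set l := ofF (_ * (_)^`().[_]); set l' := Cplus _ _ in H.
suff -> : l = l' by exact: H.
apply: (can_inj toFK); rewrite /l /l' !(toFD, toFM, ofFK).
rewrite derivD derivC addr0 derivM derivX mulr1 hornerD hornerM hornerX toFN.
by rewrite addr0 mulrDr mulrA [p.[_] * _]mulrC.
Qed.

Section SegmentIterates.
Variables (a b eps : C) (P Q : cpoly).
Local Notation p := (pol (pderiv P)).
Local Notation q := (pol (pderiv Q)).
Local Notation phi s k := (iter k (picard_step (toF a) (toF eps) p q s) 1).

Definition picard_on_seg (s : C) (k : nat) (t : R) : C :=
  ofF (toF s * (phi (toF s) k).[toF (seg a b t)]).

Lemma seg0 : seg a b 0%R = a.
Proof. by apply: (can_inj toFK); rewrite /seg toFD toFM mul0r addr0. Qed.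
Lemma seg1 : seg a b 1%R = b.
Proof. by apply: (can_inj toFK); rewrite /seg toFD toFM mul1r toFD toFN addrC subrK. Qed.

Lemma picard_on_seg0 s t : picard_on_seg s 0 t = s.
Proof. by rewrite /picard_on_seg hornerC mulr1 toFK. Qed.

Lemma picard_on_seg_start s k : picard_on_seg s k.+1 0%R = s.
Proof. by rewrite /picard_on_seg seg0 iterS /picard_step hornerD hornerC integ_a addr0 mulr1 toFK. Qed.

Lemma Der_picard_on_seg s k t :
  Der (picard_on_seg s k.+1) t (abel_rhs (pderiv P) (pderiv Q) a b eps t (picard_on_seg s k t)).
Proof.
rewrite /picard_on_seg; set f := phi (toF s) k.
have -> : (fun t => ofF (toF s * (phi (toF s) k.+1).[toF (seg a b t)])) =
  (fun t => ofF (toF s *: phi (toF s) k.+1).[toF (seg a b t)]).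
  by apply/funext => x; rewrite hornerZ.
have := Der_horner (toF s *: phi (toF s) k.+1) a b t.
set l := ofF (_ * (_)^`().[_]); set l' := abel_rhs _ _ _ _ _ _ _.
suff -> : l = l' by [].
apply: (can_inj toFK); rewrite /l /l' /abel_rhs ofFK !(toFD, toFM, toFN, ofFK) -!horner_pol.
set y := toF (seg a b t).
rewrite iterS -/f derivZ /picard_step derivD -polyC1 derivC add0r deriv_integ; last exact: num_unit.
rewrite !(hornerZ, hornerD, hornerM, horner_exp).
have E (S : comNzRingType) (c x e' u v w : S) :
    c * (x * (x ^+ 2 * (u * (w * (w * w))) + x * e' * (v * (w * w)))) =
    c * (u * (x * w * (x * w * (x * w))) + e' * (v * (x * w * (x * w)))) by ring.
exact: E.
Qed.

End SegmentIterates.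

Section CenterCoefficients.
Variables (a b : C) (P Q : cpoly).
Local Notation p := (pol (pderiv P)).
Local Notation q := (pol (pderiv Q)).

Lemma picard_on_seg_iterates eps s :
  picard_iterates (pderiv P) (pderiv Q) a b eps s (picard_on_seg a b eps P Q s).
Proof.
split; first exact: picard_on_seg0.
by split; [exact: picard_on_seg_start|exact: Der_picard_on_seg].
Qed.

(** The iterate at [b] is [s] times a polynomial in [s]; dividing the estimate of
    [center_iterates_small] by [s] bounds that polynomial minus 1 by [A s^k]. *)
Lemma center_picard_coef eps k j : center_at (pderiv P) (pderiv Q) a b eps -> (0 < j)%N -> (j < k)%N ->
  (pc (iter k (picard (toF a) p q (toF eps)) 1) j).[toF b] = 0.
Proof.
move=> /center_iterates_small[d [d0 /(_ k)[A [A0 H]]]] j0 jk.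
pose U := iter k (picard_gen_step (toF a) (toF eps) p q) 1.
pose f := map_poly (horner_eval (toF b)) U - 1.
have fs s : f.[s] = (iter k (picard_step (toF a) (toF eps) p q s) 1).[toF b] - 1.
  rewrite /f hornerD hornerN hornerC -picard_gen_horner -/U; congr (_ - _).
  have := horner_map (horner_eval (toF b)) U s%:P.
  by rewrite /= /horner_eval hornerC.
have <- : f`_j = (pc (iter k (picard (toF a) p q (toF eps)) 1) j).[toF b].
  rewrite /f coefB coef1 (gtn_eqF j0) subr0 coef_map /= /horner_eval.
  by rewrite -picard_gen_series pc_pol2ps.
apply: (@coef_eq0_of_small _ f (A%:C)%C (d%:C)%C k) => //.
- rewrite ler0c; exact/RleP.
- rewrite ltcR; exact/RltP.
move=> s s0 sd.
pose x := complex.Re s; have sE : s = (x%:C)%C by rewrite RRe_real // ger0_real // ltW.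
have x0 : 0 < x by move: s0; rewrite sE ltcR.
have xd : x < d by move: sd; rewrite sE ltcR.
have := H x _ (conj (elimT RltP x0) (elimT RltP xd)) (picard_on_seg_iterates eps (RtoC x)).
rewrite /picard_on_seg seg1 -[toF (RtoC x)]/((x%:C)%C) -sE fs; set y := _.[_] => /RleP le.
rewrite -(ler_pM2l s0) -{1}(gtr0_norm s0) -normrM.
have -> : s * (y - 1) = - toF (Cminus (RtoC x) (ofF (s * y))).
  by rewrite /Cminus toFD toFN ofFK -[toF (RtoC x)]/((x%:C)%C) -sE mulrBr mulr1 opprB.
rewrite normrN toF_norm {2 3}sE.
have -> : (x%:C * (A%:C * x%:C ^+ k) = (A * x ^+ k * x)%:C)%C.
  by rewrite -rmorphXn /= -!rmorphM /= mulrC.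
by rewrite lecR -RpowE.
Qed.

End CenterCoefficients.

Lemma composition_conditionP (P Q : cpoly) (a b : C) :
  composition_condition P Q a b <->
  exists Pt Qt W : {poly F}, [/\ W.[toF a] = W.[toF b], pol P = Pt \Po W & pol Q = Qt \Po W].
Proof.
have ext (f g : {poly F}) : (forall x, f.[toF x] = g.[toF x]) -> f = g.
  move=> h; apply/eqP; rewrite -subr_eq0; apply/eqP; apply: poly_eval0 => x.
  by rewrite hornerD hornerN -(ofFK x) h subrr.
split=> [[Pt [Qt [W [Wab [PE QE]]]]]|[Pt [Qt [W [Wab PE QE]]]]].
  exists (pol Pt), (pol Qt), (pol W); split; first by rewrite !horner_pol Wab.
    by apply: ext => x; rewrite horner_comp !horner_pol PE.
  by apply: ext => x; rewrite horner_comp !horner_pol QE.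
exists (ofpol Pt), (ofpol Qt), (ofpol W); split; first by rewrite !peval_ofpol Wab.
split=> x; apply: (can_inj toFK).
  by rewrite -horner_pol PE horner_comp !peval_ofpol !ofFK.
by rewrite -horner_pol QE horner_comp !peval_ofpol !ofFK.
Qed.

Lemma center_of_composition (P Q : cpoly) (a b : C) :
  composition_condition P Q a b -> parametric_center (pderiv P) (pderiv Q) a b.
Proof.
move=> /composition_conditionP[Pt [Qt [W [Wab PE QE]]]] eps.
apply: center_of_iterates => s; exists (picard_on_seg a b eps P Q s).
split=> [|k]; first exact: picard_on_seg_iterates.
rewrite /picard_on_seg seg1 (@picard_step_comp_end _ _ _ _ _ Pt^`() Qt^`() W) ?mulr1 ?toFK //.
  by rewrite -deriv_pol PE deriv_comp.
by rewrite -deriv_pol QE deriv_comp.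
Qed.

(** * Arithmetic of the degrees and conclusion *)

Lemma nprimeP n : nprime n <-> prime n.
Proof.
rewrite /nprime -prime_alt; split=> [[n1 H]|/primeP[n1 H]].
  apply/primeP; split=> [|d dn]; first by lia.
  apply/orP; case: (ltnP 1 d) => [d1|]; last first.
    by case: d dn => [|[|d]] //; [rewrite dvd0n => /eqP; lia|left].
  right; rewrite eqn_leq dvdn_leq //=; last by lia.
  rewrite leqNgt; apply/negP => dn'; case: (H (Z.of_nat d)); first by lia.
  by have /dvdnP[k kE] := dn; exists (Z.of_nat k); lia.
split=> [|d dn [k kE]]; first by lia.
have := H (Z.to_nat d); case: dvdnP => [_ /(_ isT)/orP[]/eqP|[]]; try by lia.
by exists (Z.to_nat k); nia.
Qed.

Lemma dvdnE d n : Nat.divide d n <-> (d %| n)%N.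
Proof. by split=> [[k ->]|/dvdnP[k ->]]; [exact: dvdn_mull|exists k]. Qed.

Lemma Nat_powE r k : Nat.pow r k = (r ^ k)%N.
Proof. by elim: k => // k IH; rewrite expnS /= IH. Qed.

(** Used to make [P] monic. *)
Lemma moments_scale (c : F) P Q a b : moments P Q a b -> moments (c *: P) Q a b.
Proof.
have [->|c0] := eqVneq c 0.
  move=> _ i f i0; rewrite scale0r deriv0 mulr0 mul0r => f'.
  by apply: deriv0_const => //; exact: num_unit.
move=> H i f i0 fE.
have E : (c *: P) ^+ i.-1 * (c *: P)^`() * Q = c ^+ i *: (P ^+ i.-1 * P^`() * Q).
  rewrite exprZn derivZ -[in RHS](prednK i0) exprS -!mul_polyC polyCM /=; ring.
apply: (mulfI (expf_neq0 i (invr_neq0 c0))).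
rewrite -!hornerZ; apply: (H i _ i0); rewrite derivZ fE E.
by rewrite scalerA -exprMn mulVf // expr1n scale1r.
Qed.

Lemma coprime_of_in_U (Rs : nat -> Prop) n m : (0 < n)%N -> (0 < m)%N ->
  (forall r, Rs r -> Nat.gcd n r = 1%N) -> (forall r, nprime r -> Nat.divide r m -> Rs r) ->
  coprime n m.
Proof.
move=> n0 m0 Hn Hm; rewrite /coprime; apply: contraT => g1.
have gp : prime (pdiv (gcdn n m)).
  by apply: pdiv_prime; rewrite ltn_neqAle eq_sym g1 gcdn_gt0 n0.
set r := pdiv _ in gp.
have rg : (r %| gcdn n m)%N by exact: pdiv_dvd.
have rR : Rs r.
  by apply: Hm; [apply/nprimeP|apply/dvdnE/(dvdn_trans rg)/dvdn_gcdr].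
have /dvdnE : Nat.divide r (Nat.gcd n r).
  apply: Nat.gcd_greatest; last exact: Nat.divide_refl.
  by apply/dvdnE/(dvdn_trans rg)/dvdn_gcdl.
by rewrite (Hn r rR) dvdn1 => /eqP r1; rewrite r1 in gp.
Qed.

Lemma size_gt1_of_root (f : {poly F}) x : f != 0 -> f.[x] = 0 -> (1 < size f)%N.
Proof.
move=> f0 fx; rewrite ltnNge; apply/negP => /size1_polyC fE.
by move: f0 fx; rewrite fE hornerC => /eqP f0 f1; apply: f0; rewrite f1.
Qed.

Lemma coef_lead_neq0 (P : cpoly) : pol P != 0 -> coef P (size (pol P)).-1 <> RtoC 0.
Proof.
move=> P0 c0; move: P0; rewrite -lead_coef_eq0 lead_coefE coef_pol c0.
by move/eqP; apply.
Qed.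

Theorem theorem4p5 (a b : C) (Rs : nat -> Prop) (P Q : cpoly) :
  a <> b ->
  (forall r, Rs r -> nprime r) ->
  in_U Rs a b P ->
  in_U1 Rs a b Q ->
  (parametric_center (pderiv P) (pderiv Q) a b <->
   composition_condition P Q a b).
Proof.
move=> ab Rsp [[Pa Pb] HP] [[Qa Qb] HQ]; split; last exact: center_of_composition.
move=> H; apply/composition_conditionP.
have ab' : toF a != toF b by apply/eqP => /(can_inj toFK).
have pa : (pol P).[toF a] = 0 by rewrite horner_pol Pa.
have pb : (pol P).[toF b] = 0 by rewrite horner_pol Pb.
have qa : (pol Q).[toF a] = 0 by rewrite horner_pol Qa.
have qb : (pol Q).[toF b] = 0 by rewrite horner_pol Qb.
have M : moments (pol P) (pol Q) (toF a) (toF b).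
  apply: (center_moments pa pb qa qb) => eps k j j0 jk.
  by have := center_picard_coef (H (ofF eps)) j0 jk; rewrite ofFK -!deriv_pol.
(* The zero polynomial has no leading exponent; then the other polynomial, which vanishes at both
   ends, serves as [W]. *)
have [P0|P0] := eqVneq (pol P) 0.
  by exists 0, 'X, (pol Q); rewrite qa qb P0 comp_poly0 comp_polyX.
have [Q0|Q0] := eqVneq (pol Q) 0.
  by exists 'X, 0, (pol P); rewrite pa pb Q0 comp_poly0 comp_polyX.
have sP := size_gt1_of_root P0 pa; have sQ := size_gt1_of_root Q0 qa.
pose c := lead_coef (pol P); have c0 : c != 0 by rewrite lead_coef_eq0.
pose P1 := c^-1 *: pol P.
have P1m : P1 \is monic by rewrite monicE lead_coefZ mulVf.
have sP1 : size P1 = size (pol P) by rewrite size_scale ?invr_eq0.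
have M1 : moments P1 (pol Q) (toF a) (toF b) by exact: moments_scale.
set n := (size (pol P)).-1; set m := (size (pol Q)).-1.
have n0 : (0 < n)%N by rewrite /n; lia.
have m0 : (0 < m)%N by rewrite /m; lia.
(* The first alternative makes the two degrees coprime and is contradictory. The second also allows
   [k = 0], which [moments_prime_power] covers. *)
have [Hn|[r [k [rR nE]]]] := HP n (elimT ssrnat.leP n0) (coef_lead_neq0 P0).
  have cop := coprime_of_in_U n0 m0 Hn (HQ m (elimT ssrnat.leP m0) (coef_lead_neq0 Q0)).
  have := @moments_coprime_degrees _ P1 (pol Q) (toF a) (toF b) P1m.
  by rewrite sP1 -/n -/m coprime_sym cop => /(_ sP Q0 ab' M1).
have rp : prime r by apply/nprimeP/Rsp.
have [||Pt [Qt [W [Wab PE QE]]]] := @moments_prime_power _ r k P1 (pol Q) (toF a) (toF b) rp P1m _ _ ab' M1.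
- by rewrite sP1 -Nat_powE -nE /n; lia.
- by rewrite !hornerZ pa pb.
exists (c *: Pt), Qt, W; split=> //.
by rewrite comp_polyZ -PE scalerA divff // scale1r.
Qed.
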